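(* Let $(M,g)$ be a closed Riemannian manifold and let $f:M\to\mathbb{C}$ be a $(\lambda,\mu)$-eigenfunction. Then $\lambda\le\mu<0$.
   Context: Closed means compact without boundary. $\Delta$ is the Laplace-Beltrami operator with the sign convention $\Delta=\operatorname{div}\nabla$, extended complex-linearly to complex-valued functions. The metric $g$ is extended complex-bilinearly to $T^{\mathbb{C}}M=TM\otimes\mathbb{C}$, and the conformality operator is $\kappa(\varphi,\psi)=g(\nabla\varphi,\nabla\psi)$ for smooth $\varphi,\psi:M\to\mathbb{C}$ (complex bilinear, not Hermitian). For $\lambda,\mu\in\mathbb{C}$, a smooth function $f:M\to\mathbb{C}$ is a $(\lambda,\mu)$-eigenfunction if $\Delta f=\lambda f$ and $\kappa(f,f)=\mu f^2$.
   Formalization: The function f is additionally assumed not to be locally constant (on connected M: non-constant), since a nonzero constant f has λ=μ=0 and f=0 is an eigenfunction for all λ, μ. *)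

(* Defs.v *)
(* The complex numbers are R[i] for R : realType; in their order, z <= w means
   that z and w have equal imaginary parts and Re z <= Re w. *)
From HB Require Import structures.
From mathcomp Require Import all_boot all_order all_algebra.
From mathcomp Require Export complex.
From mathcomp Require Import all_classical all_reals all_analysis.

Set Implicit Arguments.
Unset Strict Implicit.
Unset Printing Implicit Defensive.

Import Order.TTheory GRing.Theory Num.Theory.
Import numFieldNormedType.Exports.

Local Open Scope classical_set_scope.
Local Open Scope ring_scope.
Local Open Scope complex_scope.

Section euclidean_calculus.
Context {R : realType} {n : nat}.
Implicit Types (U : set 'rV[R]_n) (y : 'rV[R]_n) (i : 'I_n).

Definition partial i (h : 'rV[R]_n -> R) y : R := 'D_(delta_mx 0 i) h y.

Definition cpartial i (h : 'rV[R]_n -> R[i]) y : R[i] :=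
  partial i (fun z => complex.Re (h z)) y
    +i* partial i (fun z => complex.Im (h z)) y.

(* The next three are only used for U open. *)
Fixpoint Ck_on (k : nat) U (h : 'rV[R]_n -> R) : Prop :=
  (forall y, U y -> {for y, continuous h}) /\
  (if k is k'.+1 then
     forall i, (forall y, U y -> derivable h y (delta_mx 0 i)) /\
               Ck_on k' U (partial i h)
   else True).

Definition smooth_on U (h : 'rV[R]_n -> R) : Prop := forall k, Ck_on k U h.

Definition csmooth_on U (h : 'rV[R]_n -> R[i]) : Prop :=
  smooth_on U (fun y => complex.Re (h y)) /\
  smooth_on U (fun y => complex.Im (h y)).

End euclidean_calculus.

(* [coord] and [param] are total functions; only their values on
   [chart_dom] and on [chart_img] are meaningful. *)
Record chart (R : realType) (n : nat) (M : Type) := Chart {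
  chart_dom : set M;
  coord : M -> 'rV[R]_n;
  param : 'rV[R]_n -> M }.

Definition chart_img (R : realType) n M (a : chart R n M) : set 'rV[R]_n :=
  coord a @` chart_dom a.

Definition is_chart (R : realType) n (M : topologicalType)
    (a : chart R n M) : Prop :=
  [/\ open (chart_dom a), open (chart_img a),
      (forall x, chart_dom a x -> param a (coord a x) = x),
      {within chart_dom a, continuous (coord a)} &
      {within chart_img a, continuous (param a)}].

Definition transition (R : realType) n M (a b : chart R n M) :
  'rV[R]_n -> 'rV[R]_n := fun y => coord b (param a y).

Definition transition_jacobian (R : realType) n M (a b : chart R n M)
    (y : 'rV[R]_n) : 'M[R]_n :=
  \matrix_(k < n, i < n) partial i (fun z => transition a b z 0 k) y.

(* Charts take values in open subsets of R^n (no half-spaces), so these are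
   manifolds without boundary. *)
Record smoothManifold (R : realType) (n : nat) := SmoothManifold {
  carrier :> topologicalType;
  atlas : set (chart R n carrier);
  manifold_hausdorff : hausdorff_space carrier;
  manifold_second_countable : @second_countable carrier;
  atlas_chart : forall a, atlas a -> is_chart a;
  atlas_cover : forall x : carrier, exists2 a, atlas a & chart_dom a x;
  atlas_smooth : forall a b, atlas a -> atlas b -> forall k : 'I_n,
    smooth_on (coord a @` (chart_dom a `&` chart_dom b))
              (fun y => transition a b y 0 k) }.

Definition closed_manifold (R : realType) n (M : smoothManifold R n) : Prop :=
  compact [set: M].

(* A metric is given by its components (g_ij) in each chart, related by the
   transformation law of a covariant 2-tensor. *)
Record riemannianMetric (R : realType) (n : nat) (M : smoothManifold R n) :=
  RiemannianMetric {
  metric :> chart R n M -> 'rV[R]_n -> 'M[R]_n;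
  metric_smooth : forall a, atlas a -> forall i j,
    smooth_on (chart_img a) (fun y => metric a y i j);
  metric_sym : forall a, atlas a -> forall y, chart_img a y ->
    (metric a y)^T = metric a y;
  metric_posdef : forall a, atlas a -> forall y, chart_img a y ->
    forall v : 'rV[R]_n, v != 0 -> 0 < (v *m metric a y *m v^T) 0 0;
  metric_transform : forall a b, atlas a -> atlas b ->
    forall x, chart_dom a x -> chart_dom b x ->
    metric a (coord a x) =
      (transition_jacobian a b (coord a x))^T *m metric b (coord b x)
        *m transition_jacobian a b (coord a x) }.

Section operators.
Context {R : realType} {n : nat} {M : smoothManifold R n}.
Variable g : riemannianMetric M.
Implicit Types (a : chart R n M) (f phi psi : M -> R[i]) (y : 'rV[R]_n).

Definition smooth_fun f : Prop :=
  forall a, atlas a -> csmooth_on (chart_img a) (fun y => f (param a y)).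

(* (nabla f)^i = g^ij d_j f *)
Definition grad a f y (i : 'I_n) : R[i] :=
  \sum_j (invmx (g a y) i j)%:C * cpartial j (fun z => f (param a z)) y.

(* complex-bilinear extension of g *)
Definition cmetric a y (v w : 'I_n -> R[i]) : R[i] :=
  \sum_i \sum_j (g a y i j)%:C * v i * w j.

(* div X = |g|^(-1/2) d_i (|g|^(1/2) X^i), where |g| = det (g_ij) *)
Definition divergence a (X : 'rV[R]_n -> 'I_n -> R[i]) y : R[i] :=
  ((Num.sqrt (\det (g a y)))^-1)%:C *
  \sum_i cpartial i (fun z => (Num.sqrt (\det (g a z)))%:C * X z i) y.

(* Chart expressions at a point x of [chart_dom a]. Their values do not depend
   on the chart a around x. *)
Definition laplacian_in a f (x : M) : R[i] :=
  divergence a (grad a f) (coord a x).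

Definition kappa_in a phi psi (x : M) : R[i] :=
  cmetric a (coord a x) (grad a phi (coord a x)) (grad a psi (coord a x)).

(* An identity between globally defined functions such as Laplacian f = u
   means that it holds in every chart. *)
Definition has_laplacian f (u : M -> R[i]) : Prop :=
  forall a, atlas a -> forall x, chart_dom a x -> laplacian_in a f x = u x.

Definition has_kappa phi psi (u : M -> R[i]) : Prop :=
  forall a, atlas a -> forall x, chart_dom a x -> kappa_in a phi psi x = u x.

Definition eigenfunction (lambda mu : R[i]) f : Prop :=
  [/\ smooth_fun f,
      has_laplacian f (fun x => lambda * f x) &
      has_kappa f f (fun x => mu * f x ^+ 2)].

End operators.

Definition locally_constant (M : topologicalType) (T : Type) (f : M -> T) :=
  forall x : M, \forall y \near x, f y = f x.

(* Main.v *)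
(* Write f = u + iv, w = |f|^2, E = |du|^2 + |dv|^2, p = u du + v dv = dw / 2 and
   q = u dv - v du. The equation kappa(f, f) = mu f^2 says |p|^2 - |q|^2 = Re(mu) w^2
   and 2 <p, q> = Im(mu) w^2. At a maximum of w, p vanishes, hence mu is real and <= 0.
   Green's formula for (u, u) and (v, v) gives Re(lambda) I(w) + I(E) = 0, and for
   (u, v) and (v, u) it gives Im(lambda) = 0. Since w E = |p|^2 + |q|^2 =
   2 |p|^2 - mu w^2, E >= - mu w, whence lambda <= mu. If mu were 0, then df would
   vanish at the maximum x of w and the Hessian H of f at x would satisfy H G H^T = 0,
   with G the inverse metric; by symmetry of H, H G is then nilpotent, so
   lambda f(x) = tr (H G) = 0, lambda = 0, I(E) = 0 and f is locally constant.

   Green's formula needs only a positive functional I: on R^n a translation-invariant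
   functional is an ultrafilter limit of lattice sums, its uniqueness yields the
   change of variables formula, and a C^1 partition of unity globalizes it. *)
Require Import Defs.
From HB Require Import structures.
From mathcomp Require Import all_boot all_order all_fingroup all_algebra.
From mathcomp Require Import complex.
From mathcomp Require Import all_classical all_reals all_analysis.
From mathcomp Require Import ring lra zify.
Set Implicit Arguments.
Unset Strict Implicit.
Unset Printing Implicit Defensive.

Import Order.TTheory GRing.Theory Num.Theory.
Import numFieldNormedType.Exports.

(* Otherwise coord would be the coordinate function of the vector library. *)
Import Defs.

(** The pair p, q comes from [conj(f) df = p + i q]: multiplying [kappa(f, f) = mu f^2] by
    [conj(f)^2] gives the right-hand side [mu w^2], and the Hermitian square of [conj(f) df] is
    [w E]. On the zero set of f, where one cannot divide by w, the bound [E >= - mu w] reduces to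
    [E >= 0]. When mu = 0 the integrated inequality says only [lambda <= 0], so an argument at a
    single point is needed.

    The main obstacle is the change of variables formula. Here it is drawn from translation
    invariance alone: an invariant functional gives the same weight to all translates of a small
    tent, hence is determined up to a scalar; composing it with an invertible matrix therefore
    multiplies it by a character of GL_n, shown to be [|det|^-1]; and a diffeomorphism is nearly
    affine at the scale of a small tent. That partial derivatives have integral zero is invariance
    again, through difference quotients. Green's formula differentiates the cut-off argument only
    once, so C^1 bumps suffice. *)

Section rowvec_norm.
Local Open Scope ring_scope.
Context {R : realType} {n : nat}.
Implicit Types (x y : 'rV[R]_n).

Lemma coord_le_norm y i : `|y 0 i| <= `|y|.
Proof.
rewrite [leRHS]/Num.norm /= mx_normrE; apply/bigmax_geP; right => /=.
by exists (0, i).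
Qed.

Lemma rV_norm_le y (c : R) : 0 <= c -> (forall i, `|y 0 i| <= c) -> `|y| <= c.
Proof.
move=> c0 yc; rewrite [leLHS]/Num.norm /= mx_normrE; apply/bigmax_leP; split => //=.
by move=> [j i] _ /=; rewrite ord1.
Qed.

Lemma rV_norm_gt y (c : R) : 0 <= c -> c < `|y| -> exists i, c < `|y 0 i|.
Proof.
move=> c0 cy; apply: contrapT => /forallNP H.
move: cy; rewrite ltNge => /negP; apply; apply: rV_norm_le => // i.
by rewrite leNgt; apply/negP/H.
Qed.

End rowvec_norm.

(** * Continuous functions of compact support on R^n *)

Section compact_support.
Local Open Scope classical_set_scope.
Local Open Scope ring_scope.
Context {R : realType} {n : nat}.
Local Notation V := 'rV[R]_n.
Implicit Types (h k : V -> R) (K U : set V).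

(** Only p is confined to K; w is any nearby point, possibly outside K, whence the extra conclusion
    [U w]. A radius r valid at x serves, halved, for every x' within r / 2 of x, and the
    near-covering form of compactness makes one radius work on all of K. *)
Lemma compact_uniform_continuity U K h : open U -> compact K -> K `<=` U ->
  (forall y, U y -> {for y, continuous h}) ->
  forall e : R, 0 < e -> exists2 d : R, 0 < d &
    forall p w : V, K p -> `|p - w| < d -> U w /\ `|h p - h w| < e.
Proof.
move=> oU cK KU ch e e0.
pose P (d : R) (p : V) := forall w : V, `|p - w| < d -> U w /\ `|h p - h w| < e.
have e20 : 0 < e / 2 by rewrite divr_gt0.
have loc : forall x, K x -> \forall x' \near x & d \near (0 : R)^'+, P d x'.
  move=> x Kx.
  have Ux : nbhs x U by apply: open_nbhs_nbhs; split => //; exact: KU.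
  have hx : \forall w \near x, `|h x - h w| < e / 2.
    by move: (ch x (KU _ Kx)) => /cvgrPdist_lt /(_ _ e20).
  have : \forall w \near x, U w /\ `|h x - h w| < e / 2 by exact: filterI.
  rewrite -nbhs_nearE => /nbhs_ballP[r /= r0 rP].
  have r2 : 0 < r / 2 by rewrite divr_gt0.
  exists (ball x (r / 2), [set d | d < r / 2]) => /=.
    by split; [exact: nbhsx_ballx|exact: nbhs_right_lt].
  move=> [x' d] /= []; rewrite -ball_normE /= => xx' dr w wd.
  have [|Uw hw] := rP w.
    rewrite -ball_normE /=; apply: le_lt_trans (ler_distD x' _ _) _.
    by rewrite (splitr r) ltrD// (lt_trans wd).
  have [|_ hx'] := rP x'.
    by rewrite -ball_normE /= (lt_trans xx')// gtr_pMr// invf_lt1// ltr1n.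
  split => //; apply: le_lt_trans (ler_distD (h x) _ _) _.
  by rewrite (splitr e) ltrD// distrC.
have /compact_near_coveringP := cK.
move=> /(_ R (0 : R)^'+ P (at_right_proper_filter 0) loc) H.
have [d [d0 /= Pd]] : exists d : R, 0 < d /\ K `<=` P d.
  have : \forall d \near (0 : R)^'+, 0 < d /\ K `<=` P d.
    by apply: filterI; [exact: nbhs_right_gt | exact: H].
  by move=> /filter_ex.
by exists d => // p w Kp pw; exact: Pd.
Qed.

Lemma compact_norm_ball (p : V) (r : R) : compact [set y : V | `|p - y| <= r].
Proof.
apply: bounded_closed_compact.
  exists (`|p| + `|r|); split; first exact: num_real.
  move=> x xlt y /= py; apply: ltW; apply: le_lt_trans xlt.
  rewrite -[y](subKr p); apply: le_trans (ler_normB _ _) _.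
  by rewrite lerD2l (le_trans py)// ler_norm.
rewrite (_ : [set _ | _] = (fun y => `|p - y|) @^-1` [set x | x <= r]) //.
apply: closed_comp; last exact: closed_le.
move=> y _; apply: continuous_comp; last exact: norm_continuous.
by apply: continuousB; [exact: cst_continuous | exact: id].
Qed.

(** Compact support is expressed as vanishing outside a ball: closed balls being compact, nothing is
    lost, and supports are controlled by explicit numbers. *)
Definition Cc (h : V -> R) :=
  continuous h /\ exists B : R, forall y : V, B < `|y| -> h y = 0.

Lemma Cc_uniform h : Cc h -> forall e : R, 0 < e -> exists2 d : R, 0 < d &
  forall x y : V, `|x - y| < d -> `|h x - h y| < e.
Proof.
move=> [ch [B hB]] e e0.
have [d d0 Hd] := compact_uniform_continuity openT
  (compact_norm_ball (p := 0) (r := B + 1)) (@subsetT _ _) (fun y _ => ch y) e0.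
(* If x lies outside the ball of radius B + 1, a point y within 1 of it lies outside the ball of
   radius B, and both values are 0. *)
exists (Num.min d 1); first by rewrite lt_min d0 ltr01.
move=> x y; rewrite lt_min => /andP[xyd xy1].
have [xB|xB] := leP `|x| (B + 1).
  by have [] := Hd x y; rewrite //= sub0r normrN.
have yB : B < `|y|.
  rewrite -(ltrD2r 1); apply: lt_le_trans xB _.
  by rewrite -{1}(subrK y x) addrC (le_trans (ler_normD _ _))// lerD2l ltW.
rewrite !hB// ?subrr ?normr0//.
by apply: lt_trans xB; rewrite ltrDl.
Qed.

Lemma Cc_bound2 h k : Cc h -> Cc k -> exists2 B : R, 0 <= B &
  forall y : V, B < `|y| -> h y = 0 /\ k y = 0.
Proof.
move=> [_ [B hB]] [_ [C kC]]; exists (`|B| + `|C|); first exact: addr_ge0.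
move=> y ylt; split; [apply: hB|apply: kC]; apply: le_lt_trans ylt.
  by rewrite (le_trans (ler_norm _))// lerDl.
by rewrite (le_trans (ler_norm _))// lerDr.
Qed.

Lemma Cc_bound h : Cc h -> exists2 B : R, 0 <= B & forall y : V, B < `|y| -> h y = 0.
Proof. by move=> /[dup] ch /(Cc_bound2 ch)[B B0 H]; exists B => // y /H[]. Qed.

Lemma CcD h k : Cc h -> Cc k -> Cc (fun y => h y + k y).
Proof.
move=> /[dup] ch [hc _] /[dup] /(Cc_bound2 ch)[B _ HB] [kc _]; split.
  by move=> y; apply: continuousD; [exact: hc|exact: kc].
by exists B => y /HB[-> ->]; rewrite addr0.
Qed.

Lemma CcM h k : Cc h -> continuous k -> Cc (fun y => k y * h y).
Proof.
move=> [hc [B HB]] kc; split.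
  by move=> y; apply: continuousM; [exact: kc|exact: hc].
by exists B => y /HB->; rewrite mulr0.
Qed.

Lemma CcZ c h : Cc h -> Cc (fun y => c * h y).
Proof. by move=> hc; apply: CcM => // y; exact: cst_continuous. Qed.

Lemma CcN h : Cc h -> Cc (fun y => - h y).
Proof.
by move=> /(CcZ (-1)); congr Cc; apply/funext => y; rewrite mulN1r.
Qed.

Lemma CcB h k : Cc h -> Cc k -> Cc (fun y => h y - k y).
Proof. by move=> hc /CcN; exact: CcD. Qed.

Lemma Cc_cst0 : Cc (fun=> 0).
Proof. by split=> [y|]; [exact: cst_continuous|exists 0]. Qed.

Lemma Cc_sum (I : Type) (r : seq I) (F : I -> V -> R) :
  (forall i, Cc (F i)) -> Cc (fun y => \sum_(i <- r) F i y).
Proof.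
move=> FC; elim: r => [|i r IH].
  by under eq_fun do rewrite big_nil; exact: Cc_cst0.
by under eq_fun do rewrite big_cons; exact: CcD.
Qed.

Lemma Cc_comp h (g : V -> V) : Cc h -> continuous g ->
  (forall B : R, exists C : R, forall y : V, C < `|y| -> B < `|g y|) ->
  Cc (fun y => h (g y)).
Proof.
move=> [hc [B HB]] gc Hg; split.
  by move=> y; apply: continuous_comp; [exact: gc|exact: hc].
by have [C HC] := Hg B; exists C => y /HC /HB.
Qed.

Lemma Cc_translate h t : Cc h -> Cc (fun y => h (y + t)).
Proof.
move=> hC; apply: (@Cc_comp h (+%R^~ t)) => // [y|B].
  by apply: continuousD; [exact: id|exact: cst_continuous].
exists (B + `|t|) => y; rewrite -ltrBrDr => /lt_le_trans; apply.
by rewrite -{1}(addrK t y) lerBlDr ler_normB.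
Qed.

Lemma Cc_bounded h : Cc h -> exists2 c, 0 <= c & forall y, `|h y| <= c.
Proof.
move=> hC; have [B B0 hB] := Cc_bound hC.
have [||c _ hc] := @EVT_max_rV R n (fun y => `|h y|) _ _
    (compact_norm_ball (p := 0) (r := B)).
- by exists 0; rewrite /= subr0 normr0.
- apply: continuous_subspaceT => y; apply: continuous_comp; first exact: hC.1.
  exact: norm_continuous.
exists `|h c| => // y; have [yB|/hB->] := leP `|y| B; last by rewrite normr0.
by apply: hc; rewrite inE /= sub0r normrN.
Qed.

Lemma continuous_max0 (T : topologicalType) (F : T -> R) x :
  {for x, continuous F} -> {for x, continuous (fun y => Num.max 0 (F y))}.
Proof.
move=> Fx; apply: (@continuous_max R T (fun=> 0) F) => //.
exact: cst_continuous.
Qed.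

(** A majorant in [Cc]: a bound by e on the ball of radius B, for a function vanishing outside,
    becomes a bound by [e * L (bump_over B)] for a positive functional L. *)
Definition bump_over (B : R) : V -> R := fun y => Num.max 0 (B + 1 - `|y|).

Lemma bump_over_ge0 B y : 0 <= bump_over B y.
Proof. by rewrite /bump_over le_max lexx. Qed.

Lemma bump_over_ge1 B y : `|y| <= B -> 1 <= bump_over B y.
Proof. by move=> yB; rewrite /bump_over le_max; apply/orP; right; lra. Qed.

Lemma Cc_bump_over B : Cc (bump_over B).
Proof.
split.
  move=> y; apply: (@continuous_max0 V (fun y => B + 1 - `|y|)) => /=.
  apply: continuousB; first exact: cst_continuous.
  exact: norm_continuous.
by exists (B + 1) => y yB; apply/max_idPl; rewrite subr_le0 ltW.
Qed.

End compact_support.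

(** * Translation-invariant integration on R^n *)

Section haar.
Local Open Scope classical_set_scope.
Local Open Scope ring_scope.
Context {R : realType} {n : nat}.
Local Notation V := 'rV[R]_n.
Implicit Types (h k : V -> R).

(** The image ultrafilter lives on a compact segment and has a cluster point p there. For a
    neighbourhood W of p, either the preimage of W or that of its complement is in G, and the second
    would contradict clustering. *)
Lemma ultra_bounded_cvg (G : set_system nat) (u : nat -> R) (M : R) :
  UltraFilter G -> (forall N, `|u N| <= M) -> cvg (u @ G).
Proof.
move=> GU uM.
have GP : ProperFilter G by exact: ultra_proper.
have : (u @ G) [set` `[- M, M]].
  by apply: nearW => N /=; rewrite in_itv /= -ler_norml.
move=> /(@segment_compact _ (- M) M _ _)[p [_ cp]].
apply/cvg_ex; exists p => W Wp /=.
have [//|GW] := in_ultra_setVsetC (u @^-1` W) GU.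
have [q [/= nWq Wq]] := cp (~` W) W GW Wp.
by [].
Qed.

(** An invariant integral as a positive functional, with no measure behind it. The values outside
    [Cc] are unconstrained, and the last clause excludes the zero functional. *)
Definition haar (L : (V -> R) -> R) :=
  [/\ forall h k, Cc h -> Cc k -> L (fun y => h y + k y) = L h + L k,
      forall c h, Cc h -> L (fun y => c * h y) = c * L h,
      forall h, Cc h -> (forall y, 0 <= h y) -> 0 <= L h,
      forall h t, Cc h -> L (fun y => h (y + t)) = L h &
      exists2 h, Cc h & 0 < L h].

Local Notation box K := {ffun 'I_n -> 'I_(K.*2.+1)}.

Definition boxpt K (z : box K) : 'rV[int]_n := \row_i ((z i)%:Z - K%:Z).

(** This is a finitely supported sum over all of Z^n (0 by convention if the support is infinite),
    so that invariance under integer translations is a mere reindexing; [lattice_sum_box] returns to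
    a box for estimates. *)
Definition lattice_sum (F : 'rV[int]_n -> R) := \sum_(z \in [set: 'rV[int]_n]) F z.

Lemma boxpt_inj K : injective (@boxpt K).
Proof.
move=> z w /rowP zw; apply/ffunP => i; have := zw i; rewrite !mxE.
by move=> /addIr [] /val_inj.
Qed.

Lemma boxpt_le K (z : box K) i : `|boxpt z 0 i| <= K%:Z.
Proof. by rewrite mxE; case: (z i) => k /=; lia. Qed.

Lemma lattice_sum_box F K :
  (forall (z : 'rV[int]_n) i, K%:Z < `|z 0 i| -> F z = 0) ->
  lattice_sum F = \sum_(z : box K) F (boxpt z).
Proof.
move=> F0; rewrite /lattice_sum.
pose r := [seq boxpt z | z <- index_enum (box K)].
have -> : \sum_(z : box K) F (boxpt z) = \sum_(w <- r) F w by rewrite big_map.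
rewrite [RHS]fsbig_seq; last first.
  by rewrite map_inj_uniq ?index_enum_uniq //; exact: boxpt_inj.
symmetry; apply: fsbig_widen => // w [_ /= wr].
have [i wi] : exists i, K%:Z < `|w 0 i|.
  apply: contrapT => /forallNP wK; apply: wr.
  have wb i : (absz (w 0 i + K%:Z)%R < K.*2.+1)%N by have := wK i; lia.
  apply/mapP; exists [ffun i => Ordinal (wb i)]; first exact: mem_index_enum.
  by apply/rowP => i; rewrite !mxE ffunE /=; move: (wK i); move: (w 0 i) => x; lia.
exact: F0 wi.
Qed.

Lemma lattice_sum_translate F w :
  lattice_sum (fun z => F (z + w)) = lattice_sum F.
Proof.
rewrite /lattice_sum [RHS](reindex_fsbigT (fun z : 'rV[int]_n => z + w)) //.
by exists (fun z => z - w) => z; rewrite ?addrK ?subrK.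
Qed.

Definition lat (z : 'rV[int]_n) : V := map_mx intr z.

Lemma latD z w : lat (z + w) = lat z + lat w.
Proof. by apply/rowP => i; rewrite !mxE rmorphD. Qed.

Definition riemann (N : nat) h : R :=
  N.+1%:R ^- n * lattice_sum (fun z => h (N.+1%:R^-1 *: lat z)).

Lemma scaled_lat_gt N (B : R) K (z : 'rV[int]_n) i : B * N.+1%:R <= K%:R -> K%:Z < `|z 0 i| ->
  B < `|N.+1%:R^-1 *: lat z|.
Proof.
move=> BK Kz; apply: lt_le_trans (coord_le_norm _ i).
rewrite !mxE normrM gtr0_norm ?invr_gt0 ?ltr0n// mulrC ltr_pdivlMr ?ltr0n//.
apply: le_lt_trans BK _.
by rewrite -intr_norm -[K%:R]/(K%:Z%:~R) ltr_int.
Qed.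

Lemma riemann_box h B N K : (forall y : V, B < `|y| -> h y = 0) ->
  B * N.+1%:R <= K%:R ->
  riemann N h = N.+1%:R ^- n * \sum_(z : box K) h (N.+1%:R^-1 *: lat (boxpt z)).
Proof.
move=> hB BK; rewrite /riemann (@lattice_sum_box _ K)// => z i Kz.
by apply: hB; exact: scaled_lat_gt BK Kz.
Qed.

Lemma riemannD h k N : Cc h -> Cc k ->
  riemann N (fun y => h y + k y) = riemann N h + riemann N k.
Proof.
move=> /Cc_bound2 /[apply] -[B B0 hk].
pose K := (Num.Def.trunc (B * N.+1%:R)).+1.
have BK : B * N.+1%:R <= K%:R.
  exact: ltW (truncnS_gt _).
rewrite !(@riemann_box _ B _ K) //; first last.
- by move=> y /hk[-> ->]; rewrite addr0.
- by move=> y /hk[].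
- by move=> y /hk[].
by rewrite big_split mulrDr.
Qed.

Lemma riemannZ c h N : riemann N (fun y => c * h y) = c * riemann N h.
Proof. by rewrite /riemann /lattice_sum -mulr_fsumr mulrCA. Qed.

Lemma riemann_ge0 h N : (forall y, 0 <= h y) -> 0 <= riemann N h.
Proof.
move=> h0; apply: mulr_ge0; first by rewrite invr_ge0 exprn_ge0.
by apply: fsumr_ge0 => z _; exact: h0.
Qed.

(** With K = trunc(B(N+1)) + 1 each side of the box has 2K + 1 <= 2B(N+1) + 3 <= (2B+3)(N+1) points.
    The factor (N+1)^-n then leaves a bound independent of N, as the limit along an ultrafilter
    requires. *)
Lemma riemann_le h (B c : R) N : 0 <= B -> 0 <= c ->
  (forall y : V, B < `|y| -> h y = 0) -> (forall y, `|h y| <= c) ->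
  `|riemann N h| <= c * (2 * B + 3) ^+ n.
Proof.
move=> B0 c0 hB hc.
pose K := (Num.Def.trunc (B * N.+1%:R)).+1.
rewrite (@riemann_box h B _ K) //; last exact: ltW (truncnS_gt _).
have N0 : (0 : R) < N.+1%:R by rewrite ltr0n.
rewrite normrM gtr0_norm ?invr_gt0 ?exprn_gt0// mulrC ler_pdivrMr ?exprn_gt0//.
apply: le_trans (ler_norm_sum _ _ _) _.
apply: le_trans (ler_sum _ (fun z _ => hc _)) _.
rewrite sumr_const card_ffun !card_ord -[leLHS]mulr_natr -mulrA ler_wpM2l//.
rewrite -exprMn natrX lerXn2r ?nnegrE ?ler0n//.
  by rewrite mulr_ge0 ?ler0n// addr_ge0 ?mulr_ge0.
have : (Num.Def.trunc (B * N.+1%:R))%:R <= B * N.+1%:R by rewrite truncn_le mulr_ge0.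
rewrite /K; set t := Num.Def.trunc _ => tB.
have -> : t.+1.*2.+1%:R = 2 * t%:R + 3 :> R.
  by rewrite -natrM -natrD; congr _%:R; lia.
have : (1 : R) <= N.+1%:R by rewrite ler1n.
by move: (N.+1%:R : R) tB => M tB M1; nra.
Qed.

(** Rounding t down to the lattice of mesh 1/(N+1) splits off a lattice vector, which is absorbed
    exactly by reindexing, and a remainder s with |s| <= 1/(N+1), which is handled by uniform
    continuity. As |s| <= 1, the difference vanishes outside the ball of radius B + 1. *)
Lemma riemann_translate h t : Cc h ->
  (fun N => riemann N (fun y => h (y + t)) - riemann N h) @ \oo --> (0 : R).
Proof.
move=> hC; have [B B0 hB] := Cc_bound hC.
have C0 : 0 < (2 * (B + 1) + 3) ^+ n by rewrite exprn_gt0//; lra.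
apply/cvgrPdist_le => /= e e0.
have d0 : 0 < e / (2 * (B + 1) + 3) ^+ n by rewrite divr_gt0.
have [d dp dh] := Cc_uniform hC d0.
near=> N.
have N0 : (0 : R) < N.+1%:R by rewrite ltr0n.
have Nd : (N.+1%:R : R)^-1 < d by near: N; exact: near_infty_natSinv_lt (PosNum dp).
have N1 : (N.+1%:R : R)^-1 <= 1 by rewrite invf_le1// ler1n.
pose w : 'rV[int]_n := \row_i Num.floor (N.+1%:R * t 0 i).
pose s : V := t - N.+1%:R^-1 *: lat w.
have sN : `|s| <= N.+1%:R^-1.
  apply: rV_norm_le => [|i]; first by rewrite invr_ge0.
  rewrite !mxE -(ler_pM2l N0) mulfV ?gt_eqF// -[X in X * _]gtr0_norm// -normrM.
  rewrite mulrBr mulrA mulfV ?gt_eqF// mul1r.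
  have := floor_le (N.+1%:R * t 0 i); have := floorD1_gt (N.+1%:R * t 0 i).
  by rewrite intrD ler_norml; move: (_ * t 0 i) (_%:~R) => a b; lra.
have -> : riemann N (fun y => h (y + t)) = riemann N (fun y => h (y + s)).
  rewrite /riemann -[in RHS](lattice_sum_translate _ w); congr (_ * _).
  congr lattice_sum; apply/funext => z; congr h.
  by rewrite latD scalerDr /s -addrA; congr (_ + _); rewrite addrC subrK.
have hsC := Cc_translate s hC.
rewrite sub0r normrN.
have -> : riemann N (fun y => h (y + s)) - riemann N h =
    riemann N (fun y => h (y + s) - h y).
  rewrite (riemannD N hsC (CcN hC)); congr (_ + _).
  by rewrite -[LHS]mulN1r -riemannZ; congr riemann; apply/funext => y; rewrite mulN1r.
have -> : e = e / (2 * (B + 1) + 3) ^+ n * (2 * (B + 1) + 3) ^+ n.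
  by rewrite divfK// gt_eqF.
apply: riemann_le => [||y yB|y]; [lra|exact: ltW| |].
  rewrite !hB ?subrr//; first lra.
  rewrite -(ltrD2r `|s|); apply: lt_le_trans (ler_normB _ _); rewrite addrK.
  by apply: le_lt_trans yB; rewrite lerD2l (le_trans sN).
by apply/ltW/dh; rewrite addrAC subrr add0r (le_lt_trans sN).
Unshelve. all: by end_near. Qed.

(** K and M are not compared. The truncation [F'] of F to the box of size M is supported in both
    boxes, so its sums over the two agree. *)
Lemma lattice_sum_ge_box (F : 'rV[int]_n -> R) K M :
  (forall z, 0 <= F z) ->
  (forall (z : 'rV[int]_n) i, K%:Z < `|z 0 i| -> F z = 0) ->
  \sum_(z : box M) F (boxpt z) <= lattice_sum F.
Proof.
move=> F0 FK.
pose F' (z : 'rV[int]_n) := if [forall i, `|z 0 i| <= M%:Z] then F z else 0.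
have F'M (z : 'rV[int]_n) i : M%:Z < `|z 0 i| -> F' z = 0.
  by move=> Mz; rewrite /F'; case: ifP => // /forallP /(_ i); rewrite leNgt Mz.
have F'K (z : 'rV[int]_n) i : K%:Z < `|z 0 i| -> F' z = 0.
  by move=> Kz; rewrite /F' (FK _ _ Kz) if_same.
rewrite (lattice_sum_box FK); apply: (@le_trans _ _ (\sum_(z : box K) F' (boxpt z))).
  rewrite -(lattice_sum_box F'K) (lattice_sum_box F'M) le_eqVlt; apply/orP; left.
  apply/eqP/eq_bigr => z _; rewrite /F' ifT//; apply/forallP => i.
  exact: boxpt_le.
by apply: ler_sum => z _; rewrite /F'; case: ifP.
Qed.

(** Convergence of Riemann sums is never proved: along an ultrafilter finer than the eventual filter
    every bounded sequence has a limit, and linearity, positivity and invariance pass to it. *)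
Lemma haar_exists : exists L, haar L.
Proof.
have [G [GU ooG]] := ultraFilterLemma (@eventually_filter).
have GP : ProperFilter G by exact: ultra_proper.
have cvgG h : Cc h -> cvg (riemann N h @[N --> G]).
  move=> hC; have [B B0 hB] := Cc_bound hC.
  have [c c0 hc] := Cc_bounded hC.
  by apply: (ultra_bounded_cvg GU) => N; exact: riemann_le hB hc.
pose L h := lim (riemann N h @[N --> G]).
have LE h l : Cc h -> riemann N h @[N --> G] --> l -> L h = l.
  by move=> hC hl; exact: cvg_lim.
exists L; split.
- move=> h k hC kC; apply: LE; first exact: CcD.
  under eq_fun do rewrite riemannD//.
  by apply: cvgD; exact: cvgG.
- move=> c h hC; apply: LE; first exact: CcZ.
  under eq_fun do rewrite riemannZ.
  by apply: cvgMr; exact: cvgG.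
- move=> h hC h0; apply: limr_ge; first exact: cvgG.
  by apply: nearW => N; exact: riemann_ge0.
- move=> h t hC; apply: LE; first exact: Cc_translate.
  have := riemann_translate t hC.
  move=> /(cvg_trans (cvg_app _ ooG)) H.
  have /(cvgD H) := cvgG _ hC; rewrite add0r.
  by apply: cvg_trans; apply: near_eq_cvg; apply: nearW => N /=; rewrite subrK.
(* [bump_over 1] is at least 1 at the (2N+3)^n points of the box of size [N.+1], so every Riemann
   sum is at least 1. It vanishes outside the ball of radius 2, whence the box of size
   [2 * N.+1]. *)
- exists (bump_over 1); first exact: Cc_bump_over.
  apply: (@lt_le_trans _ _ 1) => //.
  apply: limr_ge; first exact/cvgG/Cc_bump_over.
  apply: nearW => N.
  have N0 : (0 : R) < N.+1%:R by rewrite ltr0n.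
  rewrite /riemann mulrC ler_pdivlMr ?exprn_gt0// mul1r.
  apply: le_trans (@lattice_sum_ge_box _ (2 * N.+1) N.+1 _ _).
  - apply: (@le_trans _ _ (\sum_(z : box N.+1) (1 : R))).
      rewrite sumr_const card_ffun !card_ord natrX.
      by rewrite lerXn2r ?nnegrE ?ler0n// ler_nat; lia.
    apply: ler_sum => z _; apply: bump_over_ge1.
    apply: rV_norm_le => // i; rewrite [lat _]lock !mxE -lock mxE.
    rewrite normrM gtr0_norm ?invr_gt0// mulrC ler_pdivrMr// mul1r.
    rewrite -intr_norm -[N.+1%:R]/(N.+1%:Z%:~R) ler_int.
    exact: boxpt_le.
  - by move=> z; exact: bump_over_ge0.
  - move=> z i Kz; apply/max_idPl; rewrite subr_le0; apply/ltW.
    by apply: scaled_lat_gt Kz; rewrite natrM.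
Qed.
End haar.

(** * Tents, interpolation and uniqueness of the invariant integral *)

Section tents.
Local Open Scope classical_set_scope.
Local Open Scope ring_scope.
Context {R : realType} {n : nat}.
Local Notation V := 'rV[R]_n.
Local Notation box K := {ffun 'I_n -> 'I_(K.*2.+1)}.
Implicit Types (h k : V -> R) (x : R) (y : V).

Definition hat x : R := Num.max 0 (1 - `|x|).

Lemma hat_ge0 x : 0 <= hat x.
Proof. by rewrite /hat le_max lexx. Qed.

Lemma hat_le1 x : hat x <= 1.
Proof. by rewrite /hat ge_max ler01 /= gerBl. Qed.

Lemma hat_out x : 1 <= `|x| -> hat x = 0.
Proof. by move=> x1; apply/max_idPl; rewrite subr_le0. Qed.

Lemma hat_in x : `|x| <= 1 -> hat x = 1 - `|x|.
Proof. by move=> x1; apply/max_idPr; rewrite subr_ge0. Qed.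

Lemma hat_continuous : continuous hat.
Proof.
move=> x; apply: (@continuous_max0 R R^o (fun x => 1 - `|x|)) => /=.
apply: continuousB; first exact: cst_continuous.
exact: norm_continuous.
Qed.

(** Only the hats centred at the two integers next to x can be nonzero there, and their values add
    up to 1. *)
Lemma hat_sum K x : 0 <= x <= K%:R -> \sum_(j < K.+1) hat (x - j%:R) = 1.
Proof.
elim: K => [|K IH] /andP[x0 xK].
  have -> : x = 0 by apply/eqP; rewrite eq_le x0 xK.
  by rewrite big_ord_recr big_ord0 /= subrr add0r hat_in ?normr0 ?subr0.
rewrite big_ord_recr /=.
have [xK'|Kx] := leP x K%:R.
  rewrite IH ?x0// hat_out ?addr0// ler0_norm; rewrite -natr1; lra.
rewrite big_ord_recr /= big1 ?add0r => [|j _].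
  rewrite -natr1 in xK *; rewrite !hat_in.
  - by rewrite ger0_norm ?ler0_norm; lra.
  - by rewrite ler0_norm; lra.
  - by rewrite ger0_norm; lra.
rewrite hat_out//; have jK : (j%:R : R) + 1 <= K%:R by rewrite natr1 ler_nat ltn_ord.
by rewrite ger0_norm; lra.
Qed.

Definition tent y : R := \prod_i hat (y 0 i).

Lemma tent_ge0 y : 0 <= tent y.
Proof. by apply: prodr_ge0 => i _; exact: hat_ge0. Qed.

Lemma tent_le1 y : tent y <= 1.
Proof. by apply: prodr_ile1 => i _; rewrite hat_ge0 hat_le1. Qed.

Lemma tent_out y : 1 <= `|y| -> tent y = 0.
Proof.
move=> y1.
have [i yi] : exists i, 1 <= `|y 0 i|.
  apply: contrapT => /forallNP H; move: y1; rewrite leNgt => /negP; apply.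
  rewrite [ltLHS]/Num.norm /= mx_normrE; apply/bigmax_ltP; split => //= -[j i] _ /=.
  by rewrite ord1 ltNge; apply/negP.
by rewrite /tent (bigD1 i)//= hat_out ?mul0r.
Qed.

Lemma tent0 : tent 0 = 1.
Proof.
by rewrite /tent big1// => i _; rewrite mxE hat_in ?normr0 ?subr0.
Qed.

Lemma continuous_prod (T : topologicalType) (I : Type) (r : seq I)
    (F : I -> T -> R) t : (forall i, {for t, continuous (F i)}) ->
  {for t, continuous (fun t => \prod_(i <- r) F i t)}.
Proof.
move=> FC; rewrite /prop_for; elim: r => [|i r IH].
  by under eq_fun do rewrite big_nil; exact: cst_continuous.
under eq_fun do rewrite big_cons.
by apply: (@continuousM _ _ (F i) (fun t => \prod_(i <- r) F i t)).
Qed.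

Lemma tent_continuous : continuous tent.
Proof.
move=> y; rewrite /tent.
have : forall i, {for y, continuous (fun y : V => hat (y 0 i))}.
  move=> i; apply: continuous_comp; first exact: coord_continuous.
  exact: hat_continuous.
by move=> H; exact: continuous_prod.
Qed.

Lemma Cc_tent : Cc tent.
Proof.
by split; [exact: tent_continuous|exists 1 => y /ltW; exact: tent_out].
Qed.

Lemma tent_sum K y : `|y| <= K%:R ->
  \sum_(z : box K) tent (y - lat (boxpt z)) = 1.
Proof.
move=> yK.
under eq_bigr => z _.
  rewrite /tent; under eq_bigr => i _.
    rewrite !mxE rmorphB /= opprB addrA.
    rewrite -[X in X - _]/(y 0 i + K%:R) -[(z i)%:~R]/((z i)%:R).
  over.
over.
(* A sum over the box of products over coordinates factors into one-variable sums; adding K moves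
   each coordinate from [-K, K] to [0, 2K], where [hat_sum] applies. *)
rewrite -(bigA_distr_bigA (fun i (j : 'I_K.*2.+1) => hat (y 0 i + K%:R - j%:R))).
rewrite big1// => i _; rewrite hat_sum// -addnn natrD.
have := le_trans (coord_le_norm y i) yK; rewrite ler_norml => /andP[]; lra.
Qed.

Definition tent_at m (p : V) : V -> R := fun y => tent (m.+1%:R *: (y - p)).

Lemma Cc_tent_at m p : Cc (tent_at m p).
Proof.
apply: (@Cc_comp _ _ tent (fun y => m.+1%:R *: (y - p))); first exact: Cc_tent.
  move=> y; apply: (@continuous_comp _ _ _ (fun y => y - p) (fun y : V => m.+1%:R *: y)).
    by apply: continuousB; [exact: id|exact: cst_continuous].
  exact: scaler_continuous.
move=> B; exists (B + `|p|) => y yB.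
rewrite normrZ gtr0_norm ?ltr0n//.
have : B < `|y - p|.
  by rewrite -(ltrD2r `|p|) (lt_le_trans yB)// -{1}(subrK p y) ler_normD.
move=> /lt_le_trans; apply.
by rewrite ler_peMl ?normr_ge0// ler1n.
Qed.

Lemma tent_at_out m p y : m.+1%:R^-1 <= `|y - p| -> tent_at m p y = 0.
Proof.
move=> yp; apply: tent_out; rewrite normrZ gtr0_norm ?ltr0n//.
by rewrite -ler_pdivrMl ?ltr0n// mulr1.
Qed.

Definition grid m (z : 'rV[int]_n) : V := m.+1%:R^-1 *: lat z.

Lemma tent_at_sum m K y : m.+1%:R * `|y| <= K%:R ->
  \sum_(z : box K) tent_at m (grid m (boxpt z)) y = 1.
Proof.
move=> yK; rewrite -(@tent_sum K (m.+1%:R *: y)); last first.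
  by rewrite normrZ gtr0_norm ?ltr0n.
apply: eq_bigr => z _; rewrite /tent_at /grid scalerBr scalerA mulfV ?scale1r//.
Qed.

(* Piecewise multilinear interpolation of h on the grid of mesh 1/(m+1). *)
Definition interp m K h : V -> R :=
  fun y => \sum_(z : box K) h (grid m (boxpt z)) * tent_at m (grid m (boxpt z)) y.

(** Since the tents sum to 1, the error at y is an average of differences [h y - h p] over grid
    points p within 1/(m+1) of y. Beyond radius B + 1 both h and its interpolation vanish, so the
    error is dominated by a fixed function of [Cc]. *)
Lemma interp_close h B e : 0 <= B -> (forall y, B < `|y| -> h y = 0) -> Cc h ->
  0 < e -> \forall m \near \oo, forall K, m.+1%:R * (B + 1) <= K%:R ->
    forall y, `|h y - interp m K h y| <= e * bump_over (B + 1) y.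
Proof.
move=> B0 hB hC e0.
have [d d0 dh] := Cc_uniform hC e0.
near=> m.
have md : (m.+1%:R : R)^-1 < d by near: m; exact: near_infty_natSinv_lt (PosNum d0).
have m1 : (m.+1%:R : R)^-1 <= 1 by rewrite invf_le1 ?ltr0n// ler1n.
move=> K BK y; have [yB|By] := leP `|y| (B + 1); last first.
  rewrite hB ?sub0r; last lra.
  rewrite normrN /interp big1 ?normr0 ?mulr_ge0 ?bump_over_ge0 ?ltW// => z _.
  have [gB|Bg] := leP `|grid m (boxpt z)| B; last by rewrite hB ?mul0r.
  rewrite tent_at_out ?mulr0// (le_trans m1)//.
  rewrite -(lerD2r `|grid m (boxpt z)|).
  apply: le_trans (ler_normD _ _); rewrite subrK.
  by apply: le_trans (ltW By); rewrite addrC lerD2r.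
have S1 := @tent_at_sum m K y (le_trans (ler_wpM2l (ler0n _ _) yB) BK).
rewrite -[h y]mulr1 -S1 mulr_sumr /interp -sumrB.
under eq_bigr do rewrite -mulrBl.
apply: le_trans (ler_norm_sum _ _ _) _.
apply: (@le_trans _ _ (\sum_(z : box K) e * tent_at m (grid m (boxpt z)) y)).
  apply: ler_sum => z _; rewrite normrM [X in _ * X]ger0_norm ?tent_ge0//.
  have [g1|/tent_at_out->] := ltP `|y - grid m (boxpt z)| m.+1%:R^-1; last by rewrite !mulr0.
  by rewrite ler_wpM2r ?tent_ge0// ltW// dh// (lt_trans g1).
by rewrite -mulr_sumr S1 ler_pM2l// bump_over_ge1.
Unshelve. all: by end_near. Qed.

Section haar_theory.
Variables (L : (V -> R) -> R) (hL : haar L).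

Lemma haarD h k : Cc h -> Cc k -> L (fun y => h y + k y) = L h + L k.
Proof. by case: hL => H _ _ _ _; exact: H. Qed.

Lemma haarZ c h : Cc h -> L (fun y => c * h y) = c * L h.
Proof. by case: hL => _ H _ _ _; exact: H. Qed.

Lemma haar_ge0 h : Cc h -> (forall y, 0 <= h y) -> 0 <= L h.
Proof. by case: hL => _ _ H _ _; exact: H. Qed.

Lemma haar_translate h t : Cc h -> L (fun y => h (y + t)) = L h.
Proof. by case: hL => _ _ _ H _; exact: H. Qed.

Lemma haarB h k : Cc h -> Cc k -> L (fun y => h y - k y) = L h - L k.
Proof.
move=> hC kC; rewrite -[X in _ = _ + X]mulN1r -haarZ// -haarD//; last exact: CcZ.
by congr L; apply/funext => y; rewrite mulN1r.
Qed.

Lemma haar_le h k : Cc h -> Cc k -> (forall y, h y <= k y) -> L h <= L k.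
Proof.
move=> hC kC hk; rewrite -subr_ge0 -haarB//; apply: haar_ge0; first exact: CcB.
by move=> y; rewrite subr_ge0.
Qed.

Lemma haar_norm_le h k : Cc h -> Cc k -> (forall y, `|h y| <= k y) -> `|L h| <= L k.
Proof.
move=> hC kC hk; rewrite ler_norml; apply/andP; split; last first.
  by apply: haar_le => // y; apply: le_trans (ler_norm _) (hk y).
rewrite -mulN1r -haarZ//; apply: haar_le => //; first exact: CcZ.
by move=> y; rewrite mulN1r; have := hk y; rewrite ler_norml => /andP[].
Qed.

Lemma haar0 : L (fun=> 0) = 0.
Proof.
rewrite -[RHS](mul0r (L (fun=> 0))) -haarZ; last exact: Cc_cst0.
by congr L; apply/funext => y; rewrite mul0r.
Qed.

Lemma haar_sum (I : Type) (r : seq I) (F : I -> V -> R) : (forall i, Cc (F i)) ->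
  L (fun y => \sum_(i <- r) F i y) = \sum_(i <- r) L (F i).
Proof.
move=> FC; elim: r => [|i r IH].
  by rewrite big_nil; under eq_fun do rewrite big_nil; exact: haar0.
rewrite big_cons -IH; under eq_fun do rewrite big_cons.
by rewrite haarD//; exact: Cc_sum.
Qed.

Definition mesh_weight m := L (tent_at m 0).

Lemma haar_tent_at m p : L (tent_at m p) = mesh_weight m.
Proof.
rewrite /mesh_weight -(haar_translate (- p) (Cc_tent_at m 0)); congr L.
by apply/funext => y; rewrite /tent_at subr0.
Qed.

Lemma Cc_interp m K h : Cc (interp m K h).
Proof. by apply: Cc_sum => z; apply: CcZ; exact: Cc_tent_at. Qed.

Lemma haar_interp m K h :
  L (interp m K h) = mesh_weight m * \sum_(z : box K) h (grid m (boxpt z)).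
Proof.
rewrite /interp haar_sum; last by move=> z; apply: CcZ; exact: Cc_tent_at.
rewrite mulr_sumr; apply: eq_bigr => z _.
by rewrite haarZ ?haar_tent_at 1?mulrC//; exact: Cc_tent_at.
Qed.

Lemma grid_sum_box m h (B : R) K : (forall y : V, B < `|y| -> h y = 0) ->
  B * m.+1%:R <= K%:R ->
  lattice_sum (fun z => h (grid m z)) = \sum_(z : box K) h (grid m (boxpt z)).
Proof.
move=> hB BK; rewrite (@lattice_sum_box _ _ _ K)// => z i Kz.
by apply: hB; exact: scaled_lat_gt BK Kz.
Qed.

(** All tents of one mesh have the same integral by invariance, so L evaluates an interpolation as
    this weight times a lattice sum. Thus L is determined by the sequence [mesh_weight]. *)
Lemma haar_mesh_cvg h : Cc h ->
  mesh_weight m * lattice_sum (fun z => h (grid m z)) @[m --> \oo] --> L h.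
Proof.
move=> hC; have [B B0 hB] := Cc_bound hC.
have bC : Cc (bump_over (B + 1) : V -> R) by exact: Cc_bump_over.
have b0 : 0 <= L (bump_over (B + 1)) by apply: haar_ge0 => // y; exact: bump_over_ge0.
have b1 : 0 < 1 + L (bump_over (B + 1)) by rewrite ltr_wpDr.
apply/cvgrPdist_le => /= e e0.
have e1 : 0 < e / (1 + L (bump_over (B + 1))) by rewrite divr_gt0.
near=> m.
pose K := (Num.Def.trunc (m.+1%:R * (B + 1))).+1.
have BK : m.+1%:R * (B + 1) <= K%:R by exact: ltW (truncnS_gt _).
rewrite (@grid_sum_box _ _ B K)//; last first.
  by apply: le_trans BK; rewrite mulrC ler_wpM2l ?ler0n// lerDl.
rewrite -haar_interp -haarB//; last exact: Cc_interp.
have : forall y, `|h y - interp m K h y| <=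
    e / (1 + L (bump_over (B + 1))) * bump_over (B + 1) y.
  by move: K BK; near: m; exact: interp_close.
move=> /(haar_norm_le (CcB hC (@Cc_interp _ _ _)) (CcZ _ bC)) /le_trans; apply.
rewrite haarZ// mulrAC ler_pdivrMr// ler_pM2l// lerDr//.
Unshelve. all: by end_near. Qed.

Lemma haar_bump_gt0 : exists B, 0 < L (bump_over B).
Proof.
case: hL => _ _ _ _ [h hC h0]; have [B B0 hB] := Cc_bound hC.
have [c c0 hc] := Cc_bounded hC; exists B.
have bC : Cc (bump_over B : V -> R) by exact: Cc_bump_over.
have : L h <= c * L (bump_over B).
  rewrite -haarZ//; apply: haar_le => //; first exact: CcZ.
  move=> y; have [yB|/hB->] := leP `|y| B; last by rewrite mulr_ge0 ?bump_over_ge0.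
  by rewrite (le_trans (ler_norm _))// (le_trans (hc y))// ler_peMr// bump_over_ge1.
have b0 : 0 <= L (bump_over B) by apply: haar_ge0 => // y; exact: bump_over_ge0.
move=> hb; rewrite lt_neqAle b0 andbT; apply/eqP => z0.
by move: (lt_le_trans h0 hb); rewrite -z0 mulr0 ltxx.
Qed.

(** If the weight were 0, a finite sum of tents dominating a bump of positive integral would have
    integral 0. *)
Lemma mesh_weight_gt0 m : 0 < mesh_weight m.
Proof.
have [B B0] := haar_bump_gt0.
rewrite lt_neqAle eq_sym haar_ge0 ?andbT; last 2 first.
- exact: Cc_tent_at.
- by move=> y; exact: tent_ge0.
apply/negP => /eqP w0; move: B0; apply/negP; rewrite -leNgt.
have bC : Cc (bump_over B : V -> R) by exact: Cc_bump_over.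
pose K := (Num.Def.trunc (m.+1%:R * `|B + 1|)).+1.
have BK : m.+1%:R * `|B + 1| <= K%:R by exact: ltW (truncnS_gt _).
have [c c0 hc] := Cc_bounded bC.
pose F y := c * \sum_(z : box K) tent_at m (grid m (boxpt z)) y.
have sC : Cc (fun y => \sum_(z : box K) tent_at m (grid m (boxpt z)) y).
  by apply: Cc_sum => z; exact: Cc_tent_at.
apply: (@le_trans _ _ (L F)).
  apply: haar_le => //; first exact: CcZ.
  move=> y; have [yB|yB] := leP `|y| `|B + 1|.
    rewrite /F tent_at_sum ?mulr1; first exact: le_trans (ler_norm _) (hc y).
    by apply: le_trans BK; rewrite ler_wpM2l.
  rewrite (_ : bump_over B y = 0).
    by rewrite mulr_ge0// sumr_ge0// => z _; exact: tent_ge0.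
  by apply/max_idPl; rewrite subr_le0 (le_trans _ (ltW yB))// ler_norm.
rewrite haarZ// haar_sum => [|z]; last exact: Cc_tent_at.
by rewrite big1 ?mulr0// => z _; rewrite haar_tent_at.
Qed.

(** Uniform continuity places below h a narrow tent at y0 of height [h y0 / 2], and tents have
    positive weight. *)
Lemma haar_gt0 h y0 : Cc h -> (forall y, 0 <= h y) -> 0 < h y0 -> 0 < L h.
Proof.
move=> hC h0 hy0.
have e0 : 0 < h y0 / 2 by rewrite divr_gt0.
have [d d0 dh] := Cc_uniform hC e0.
pose m := Num.Def.trunc d^-1.
have md : (m.+1%:R : R)^-1 < d.
  by rewrite invf_plt ?posrE ?ltr0n// truncnS_gt.
have tC : Cc (fun y => h y0 / 2 * tent_at m y0 y) by apply: CcZ; exact: Cc_tent_at.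
apply: (@lt_le_trans _ _ (L (fun y => h y0 / 2 * tent_at m y0 y))).
  by rewrite haarZ ?mulr_gt0 ?haar_tent_at ?mesh_weight_gt0//; exact: Cc_tent_at.
apply: haar_le => // y.
have [ym|/tent_at_out->] := ltP `|y - y0| m.+1%:R^-1; last by rewrite mulr0.
apply: (@le_trans _ _ (h y0 / 2)); first by rewrite ler_piMr ?tent_le1// ltW.
have := dh y0 y; rewrite distrC => /(_ (lt_trans ym md)).
by rewrite ltr_norml => /andP[]; lra.
Qed.

End haar_theory.

(** The product of the two mesh weights and of the lattice sums of h and k is one sequence; grouping
    its factors in two ways makes it tend both to [L' h * L k] and to [L h * L' k]. *)
Lemma haar_unique (L L' : (V -> R) -> R) : haar L -> haar L' ->
  exists2 c, 0 < c & forall h, Cc h -> L' h = c * L h.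
Proof.
move=> hL hL'.
have [B B0] := haar_bump_gt0 hL.
have bC : Cc (bump_over B : V -> R) by exact: Cc_bump_over.
have cross h k : Cc h -> Cc k -> L' h * L k = L h * L' k.
  move=> hC kC.
  have c1 := cvgM (haar_mesh_cvg hL' hC) (haar_mesh_cvg hL kC).
  have c2 := cvgM (haar_mesh_cvg hL hC) (haar_mesh_cvg hL' kC).
  apply: (cvg_unique _ (c1 _)) => //; apply: cvg_trans (c2 _); apply: near_eq_cvg.
  by apply: nearW => m /=; ring.
exists (L' (bump_over B) / L (bump_over B)); last first.
  by move=> h hC; rewrite mulrAC (cross _ _ bC hC) mulrAC mulfV ?mul1r ?gt_eqF.
rewrite divr_gt0//; have [C C0] := haar_bump_gt0 hL'.
have CC : Cc (bump_over C : V -> R) by exact: Cc_bump_over.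
have := cross _ _ CC bC; have : 0 <= L' (bump_over B).
  by apply: haar_ge0 => // y; exact: bump_over_ge0.
rewrite le_eqVlt => /predU1P[<-|//].
by rewrite mulr0 => /eqP; rewrite mulf_eq0 !gt_eqF.
Qed.

End tents.

(** * The modulus of a linear change of variables *)

Section determinant_character.
Local Open Scope ring_scope.
Context {R : realType}.

Definition dil n (i : 'I_n) (a : R) : 'M[R]_n :=
  diag_mx (\row_j (if j == i then a else 1)).

Lemma det_dil n (i : 'I_n) a : \det (dil i a) = a.
Proof.
rewrite det_diag (bigD1 i)//= big1 ?mulr1 => [|j /negPf ji]; rewrite mxE ?eqxx//.
by rewrite ji.
Qed.

Lemma dil_unit n (i : 'I_n) a : a != 0 -> dil i a \in unitmx.
Proof. by rewrite unitmxE det_dil unitfE. Qed.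

Lemma lift0_dil n (i : 'I_n) a : lift0_mx (dil i a) = dil (rshift 1 i) a.
Proof.
apply/matrixP => j k; rewrite mxE; case: splitP => j' jE; rewrite mxE;
  case: splitP => k' kE; rewrite !mxE -!val_eqE /= jE kE.
- by rewrite !ord1.
- by rewrite ord1.
- by rewrite ord1 mulr0n.
- by rewrite !eqn_add2l.
Qed.

Lemma dil0_block n (a : R) : block_mx a%:M 0 0 1%:M = dil (0 : 'I_(1 + n)) a.
Proof.
apply/matrixP => j k; rewrite mxE; case: splitP => j' jE; rewrite mxE;
  case: splitP => k' kE; rewrite !mxE -!val_eqE /= jE kE ?ord1.
- by [].
- by [].
- by [].
- by rewrite eqn_add2l.
Qed.

Lemma lift0_mxM n (E F : 'M[R]_n) : lift0_mx (E *m F) = lift0_mx E *m lift0_mx F.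
Proof.
by rewrite /lift0_mx -idmxE mulmx_block !(mul1mx, mulmx0, mul0mx, addr0, add0r).
Qed.

(* A transvection is conjugate to its square. *)
Lemma char_lower n (chi : 'M[R]_(1 + n) -> R) (v : 'cV[R]_n) :
  {in unitmx &, forall A B, chi (A *m B) = chi A * chi B} ->
  {in unitmx, forall A, 0 < chi A} ->
  chi (block_mx 1%:M 0 v 1%:M) = 1.
Proof.
move=> chiM chi0.
pose E (w : 'cV[R]_n) : 'M[R]_(1 + n) := block_mx 1%:M 0 w 1%:M.
have Eu w : E w \in unitmx by rewrite unitmxE det_lblock !det1 mul1r unitr1.
pose P : 'M[R]_(1 + n) := block_mx (2^-1)%:M 0 0 1%:M.
have Pu : P \in unitmx.
  by rewrite unitmxE det_lblock det1 mulr1 det_scalar1 unitfE invr_eq0 pnatr_eq0.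
have EE : E v *m E v = E (v + v).
  by rewrite mulmx_block !(mul1mx, mulmx1, mul0mx, mulmx0, addr0, add0r).
have PE : P *m E v = E (v + v) *m P.
  rewrite !mulmx_block !(mul1mx, mulmx1, mul0mx, mulmx0, addr0, add0r).
  rewrite mul_mx_scalar -mulr2n -[v *+ 2]scaler_nat scalerA mulVf ?scale1r//.
have : chi (E v) * chi (E v) = chi (E v).
  rewrite -chiM// EE; apply: (mulfI (x := chi P)); first by rewrite gt_eqF ?chi0.
  by rewrite -[RHS]chiM// PE chiM// mulrC.
by rewrite -[X in _ = X -> _]mulr1; apply: mulfI; rewrite gt_eqF ?chi0.
Qed.

Lemma char_upper n (chi : 'M[R]_(1 + n) -> R) (v : 'rV[R]_n) :
  {in unitmx &, forall A B, chi (A *m B) = chi A * chi B} ->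
  {in unitmx, forall A, 0 < chi A} ->
  chi (block_mx 1%:M v 0 1%:M) = 1.
Proof.
move=> chiM chi0.
have := @char_lower n (fun A => chi A^T) v^T.
rewrite tr_block_mx !trmx1 !trmx0 trmxK; apply.
  by move=> A B Au Bu; rewrite trmx_mul chiM ?unitmx_tr// mulrC.
by move=> A Au; rewrite chi0 ?unitmx_tr.
Qed.

(** Block Gaussian elimination: once a column permutation has made the corner entry nonzero, A is
    the product of a lower transvection, a dilation of the first coordinate, the lift of the Schur
    complement [D] and an upper transvection. The character is 1 on transvections, prescribed on
    dilations and known on the lift by induction. *)
Lemma char_det n (chi : 'M[R]_n -> R) :
  {in unitmx &, forall A B, chi (A *m B) = chi A * chi B} ->
  {in unitmx, forall A, 0 < chi A} ->
  (forall s, chi (perm_mx s) = 1) ->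
  (forall i a, a != 0 -> chi (dil i a) = `|a|^-1) ->
  {in unitmx, forall A, chi A = `|\det A|^-1}.
Proof.
elim: n chi => [|n IH] chi chiM chi0 chiP chiD A Au.
  rewrite (_ : A = 1%:M); last by apply/matrixP => -[].
  by rewrite det1 normr1 invr1 -perm_mx1 chiP.
wlog A00 : A Au / A 0 0 != 0.
  move=> H; have [j Aj] : exists j, A 0 j != 0.
    apply: contrapT => /forallNP A0; move: Au; rewrite unitmxE (expand_det_row _ 0).
    rewrite big1 ?unitr0// => j _; have /negP := A0 j.
    by rewrite negbK => /eqP->; rewrite mul0r.
  have pu : perm_mx (tperm 0 j) \in @unitmx R n.+1 by exact: unitmx_perm.
  have := H (A *m perm_mx (tperm 0 j)).
  rewrite unitmx_mul Au pu chiM// chiP mulr1 det_mulmx det_perm normrM normrX.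
  rewrite normrN1 expr1n mulr1 => -> //.
  rewrite -[perm_mx _]/(tperm_mx 0 j) -xcolE mxE tpermL//.
pose B : 'M[R]_(1 + n) := A.
pose a := A 0 0.
have Ba : ulsubmx B = a%:M.
  by apply/matrixP => i j; rewrite !ord1 !mxE !lshift0 mulr1n.
pose D := drsubmx B - a^-1 *: (dlsubmx B *m ursubmx B).
have BE : B = block_mx 1%:M 0 (a^-1 *: dlsubmx B) 1%:M *m
    (block_mx a%:M 0 0 1%:M *m
    (block_mx 1%:M 0 0 D *m block_mx 1%:M (a^-1 *: ursubmx B) 0 1%:M)).
  rewrite !mulmx_block !(mul1mx, mulmx1, mul0mx, mulmx0, addr0, add0r).
  rewrite -[LHS]submxK Ba; congr block_mx.
  - by rewrite -scalemxAr mul_scalar_mx scalerA mulVf// scale1r.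
  - by rewrite mul_mx_scalar scalerA mulfV// scale1r.
  - rewrite mul_scalar_mx scalerA mulfV// scale1r -scalemxAl /D addrC subrK//.
rewrite dil0_block in BE.
have lu : block_mx 1%:M 0 (a^-1 *: dlsubmx B) 1%:M \in unitmx.
  by rewrite unitmxE det_lblock !det1 mul1r unitr1.
have uu : block_mx 1%:M (a^-1 *: ursubmx B) 0 1%:M \in unitmx.
  by rewrite unitmxE det_ublock !det1 mul1r unitr1.
have du : dil 0 a \in @unitmx R (1 + n) by exact: dil_unit.
have detB : \det B = a * \det D.
  have := congr1 (fun X => \det X) BE; rewrite !det_mulmx !(det_lblock, det_ublock).
  by rewrite !det1 det_dil !(mul1r, mulr1) => ->.
have Du : D \in unitmx.
  move: Au; rewrite -[A]/B !unitmxE detB !unitfE mulf_eq0 negb_or.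
  by case/andP.
have Lu E : E \in unitmx -> lift0_mx E \in @unitmx R (1 + n).
  by rewrite !unitmxE det_lblock det1 mul1r.
rewrite -[A]/B; have -> := congr1 chi BE.
rewrite chiM ?unitmx_mul ?lu ?du ?uu ?Lu// char_lower// mul1r.
rewrite chiM ?unitmx_mul ?du ?uu ?Lu// chiM ?uu ?Lu// char_upper// mulr1.
rewrite detB normrM invfM chiD//; congr (_ * _).
apply: (IH (fun E => chi (lift0_mx E))) => //.
- by move=> E F Eu Fu; rewrite -chiM ?Lu// -lift0_mxM.
- by move=> E Eu; rewrite chi0 ?Lu.
- by move=> s; rewrite lift0_mx_perm chiP.
- by move=> i b b0; rewrite lift0_dil chiD.
Qed.

End determinant_character.

Section haar_modulus.
Local Open Scope classical_set_scope.
Local Open Scope ring_scope.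
Context {R : realType} {n : nat}.
Local Notation V := 'rV[R]_n.
Implicit Types (A B : 'M[R]_n) (h : V -> R).

(** A crude bound for the operator norm of right multiplication by A in the sup norm. *)
Definition entry_sum A := \sum_i \sum_j `|A i j|.

Lemma entry_sum_ge0 A : 0 <= entry_sum A.
Proof. by apply: sumr_ge0 => i _; apply: sumr_ge0. Qed.

Lemma mulmx_norm_le A (y : V) : `|y *m A| <= `|y| * entry_sum A.
Proof.
apply: rV_norm_le => [|j]; first by rewrite mulr_ge0 ?entry_sum_ge0.
rewrite mxE; apply: le_trans (ler_norm_sum _ _ _) _.
rewrite /entry_sum mulr_sumr; apply: ler_sum => i _.
rewrite normrM ler_pM ?coord_le_norm//.
by rewrite (bigD1 j)//= lerDl sumr_ge0.
Qed.

Lemma mulmx_continuous A : continuous (fun y : V => y *m A).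
Proof.
move=> y; apply/(@cvgrPdist_lt _ _ _ (nbhs y)) => /= e e0.
have C0 : 0 < entry_sum A + 1 by rewrite ltr_wpDl ?entry_sum_ge0.
have d0 : 0 < e / (entry_sum A + 1) by rewrite divr_gt0.
apply: filterS (nbhsx_ballx y _ d0) => z; rewrite -ball_normE /= => yz.
rewrite -mulmxBl; apply: le_lt_trans (mulmx_norm_le _ _) _.
apply: (@le_lt_trans _ _ (`|y - z| * (entry_sum A + 1))).
  by rewrite ler_wpM2l// lerDl.
by rewrite -ltr_pdivlMr.
Qed.

Lemma Cc_mulmx A h : A \in unitmx -> Cc h -> Cc (fun y => h (y *m A)).
Proof.
move=> Au hC; apply: (@Cc_comp _ _ h (fun y => y *m A)) => //.
  exact: mulmx_continuous.
move=> B; exists (`|B| * entry_sum (invmx A)) => y; rewrite ltNge.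
apply: contraNlt; rewrite -{2}(mulmxK Au y) => yB.
apply: le_trans (mulmx_norm_le _ _) _.
by rewrite ler_wpM2r ?entry_sum_ge0// (le_trans yB)// ler_norm.
Qed.

Variables (L : (V -> R) -> R) (hL : haar L).

Lemma haar_mulmx A : A \in unitmx -> haar (fun h => L (fun y => h (y *m A))).
Proof.
move=> Au; split.
- by move=> h k hC kC; rewrite haarD//; exact: Cc_mulmx.
- by move=> c h hC; rewrite haarZ//; exact: Cc_mulmx.
- by move=> h hC h0; apply: haar_ge0 => //; exact: Cc_mulmx.
- move=> h t hC; rewrite -(haar_translate hL (t *m invmx A) (Cc_mulmx Au hC)).
  by congr L; apply/funext => y; rewrite mulmxDl mulmxKV.
- case: hL => _ _ _ _ [h hC h0]; exists (fun y => h (y *m invmx A)).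
    by apply: Cc_mulmx => //; rewrite unitmx_inv.
  rewrite (_ : (fun y => _) = h)//; apply/funext => y.
  by rewrite mulmxK.
Qed.

Lemma haar_tent_gt0 : 0 < L tent.
Proof.
apply: (@haar_gt0 _ _ _ hL _ 0); first exact: Cc_tent.
  exact: tent_ge0.
by rewrite tent0.
Qed.

Definition modulus A := L (fun y => tent (y *m A)) / L tent.

(** By uniqueness a linear change of variables can only rescale L, and the tent reads off the
    factor. *)
Lemma modulusP A : A \in unitmx -> 0 < modulus A /\
  forall h, Cc h -> L (fun y => h (y *m A)) = modulus A * L h.
Proof.
move=> Au; have [c c0 cP] := haar_unique hL (haar_mulmx Au).
have <- : c = modulus A.
  by rewrite /modulus cP ?mulfK ?gt_eqF ?haar_tent_gt0//; exact: Cc_tent.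
by [].
Qed.

Lemma modulusM : {in unitmx &, forall A B,
  modulus (A *m B) = modulus A * modulus B}.
Proof.
move=> A B Au Bu.
have ABu : A *m B \in unitmx by rewrite unitmx_mul Au.
have tC := @Cc_tent R n.
apply: (mulIf (x := L tent)); first by rewrite gt_eqF// haar_tent_gt0.
rewrite -(modulusP ABu).2// -mulrA -(modulusP Bu).2//.
rewrite -(modulusP Au).2; last exact: Cc_mulmx.
by congr L; apply/funext => y; rewrite mulmxA.
Qed.

Lemma modulus_perm (s : {perm 'I_n}) : modulus (perm_mx s) = 1.
Proof.
rewrite /modulus (_ : (fun y => _) = tent) ?mulfV ?gt_eqF ?haar_tent_gt0//.
apply/funext => y; rewrite -[s]invgK -col_permE /tent.
by rewrite [RHS](reindex_perm (s^-1)%g); apply: eq_bigr => i _; rewrite mxE.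
Qed.

Lemma mulmx_dil (i : 'I_n) (a : R) (y : V) j :
  (y *m dil i a) 0 j = y 0 j * (if j == i then a else 1).
Proof. by rewrite mul_mx_diag !mxE. Qed.

(** The factor of the tent that ignores coordinate i: dilations and translations along i leave it
    alone, so the modulus of [dil i a] becomes a question about functions of one variable. *)
Let cotent (i : 'I_n) (y : V) := \prod_(j | j != i) hat (y 0 j).

Let tentE i y : tent y = hat (y 0 i) * cotent i y.
Proof. by rewrite /tent (bigD1 i). Qed.

Let cotent_dil i a y : cotent i (y *m dil i a) = cotent i y.
Proof. by apply: eq_bigr => j /negPf ji; rewrite mulmx_dil ji mulr1. Qed.

Let cotent_shift i t y : cotent i (y + t *: (delta_mx 0 i : V)) = cotent i y.
Proof.
by apply: eq_bigr => j /negPf ji; rewrite !mxE eqxx /= ji mulr0 addr0.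
Qed.

Let cotent_ge0 i y : 0 <= cotent i y.
Proof. by apply: prodr_ge0 => j _; exact: hat_ge0. Qed.

Lemma modulus_dil_norm i a : modulus (dil i a) = modulus (dil i `|a|).
Proof.
congr (L _ / _); apply/funext => y; rewrite !(tentE i) !cotent_dil !mulmx_dil eqxx.
by congr (_ * _); rewrite /hat !normrM normr_id.
Qed.

(* The trapezoid equal to 1 on [0, k - 1] and to 0 outside ]-1, k[. *)
Let trap (k : nat) (x : R) := \sum_(j < k) hat (x - j%:R).

Let trap_ge0 k x : 0 <= trap k x.
Proof. by apply: sumr_ge0 => j _; exact: hat_ge0. Qed.

Let trap_eq1 k x : 0 <= x <= k%:R -> trap k.+1 x = 1.
Proof. exact: hat_sum. Qed.

Let trap_le1 k x : trap k x <= 1.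
Proof.
have trapS a b : trap a b <= trap a.+1 b.
  by rewrite /trap big_ord_recr /= lerDl hat_ge0.
have trapW a b c : trap a c <= trap (a + b).+1 c.
  elim: b => [|b IH]; first by rewrite addn0.
  by rewrite addnS; apply: le_trans IH _.
have nonneg x' : 0 <= x' -> trap k x' <= 1.
  move=> x0; apply: le_trans (trapW k (Num.Def.trunc x').+1 x') _.
  rewrite trap_eq1// x0 natrD /= ler_wpDl ?ler0n// ltW// truncnS_gt//.
have [/nonneg//|x0] := leP 0 x.
apply: le_trans (nonneg 0 _) => //; apply: ler_sum => j _.
have j0 : 0 <= j%:R :> R by [].
rewrite /hat ge_max le_max lexx /= le_max; apply/orP; right.
rewrite sub0r normrN (ger0_norm j0) ler0_norm; lra.
Qed.

Let trap_eq0 k x : x <= -1 \/ k%:R <= x -> trap k x = 0.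
Proof.
move=> xk; rewrite /trap big1// => j _; apply: hat_out.
have jk : (j%:R : R) + 1 <= k%:R by rewrite natr1 ler_nat.
have j0 : 0 <= j%:R :> R by [].
by case: xk => H; [rewrite ler0_norm|rewrite ger0_norm]; lra.
Qed.

Let trap_tent i k (y : V) : trap k (y 0 i) * cotent i y =
  \sum_(j < k) tent (y + (- j%:R) *: (delta_mx 0 i : V)).
Proof.
rewrite /trap mulr_suml; apply: eq_bigr => j _.
by rewrite (tentE i) cotent_shift !mxE !eqxx mulr1.
Qed.

Let haar_trap i k : Cc (fun y : V => trap k (y 0 i) * cotent i y) /\
  L (fun y : V => trap k (y 0 i) * cotent i y) = k%:R * L tent.
Proof.
under eq_fun do rewrite trap_tent.
have tC j : Cc (fun y : V => tent (y + (- j%:R) *: (delta_mx 0 i : V))).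
  by apply: Cc_translate; exact: Cc_tent.
split; first by apply: Cc_sum => j; exact: tC.
rewrite haar_sum//; under eq_bigr do rewrite (haar_translate hL _ (@Cc_tent R n)).
by rewrite sumr_const card_ord mulr_natl.
Qed.

(** A trapezoid made of k hats, dilated by s and shifted by s, vanishes outside ]0, (k+1)s[ and lies
    below one made of K + 1 hats with K about (k+1)s. Each hat contributes [L tent], so
    [k * v <= k * s + (s + 2)] for every k; large k forces [v <= s]. *)
Let modulus_dil_le i s : 0 < s -> modulus (dil i s^-1) <= s.
Proof.
move=> s0; have su : dil i s^-1 \in unitmx by rewrite dil_unit// invr_eq0 gt_eqF.
set v := modulus _.
have bound k : k%:R * v <= k%:R * s + (s + 2).
  pose K := (Num.Def.trunc ((k.+1)%:R * s)).+1.
  have Kk : (k.+1)%:R * s <= K%:R by exact: ltW (truncnS_gt _).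
  have kK : K%:R <= (k.+1)%:R * s + 1.
    by rewrite -[K%:R]natr1 lerD2r truncn_le mulr_ge0// ltW.
  have [Ck Lk] := haar_trap i k; have [CK LK] := haar_trap i K.+1.
  have e1 := (modulusP su).2 _ Ck.
  have e2 := haar_translate hL (s *: (delta_mx 0 i : V)) CK.
  have : modulus (dil i s^-1) * (k%:R * L tent) <= K.+1%:R * L tent.
    rewrite -Lk -LK -e1 -e2.
    apply: haar_le => //; first exact: (Cc_mulmx su Ck).
      exact: (Cc_translate (s *: (delta_mx 0 i : V)) CK).
    move=> y /=; rewrite cotent_dil cotent_shift ler_wpM2r//.
    rewrite mulmx_dil !mxE !eqxx mulr1.
    have [y1|y1] := leP (y 0 i / s) (-1).
      by rewrite trap_eq0 ?trap_ge0//; left.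
    have [y2|y2] := leP k%:R (y 0 i / s).
      by rewrite trap_eq0 ?trap_ge0//; right.
    rewrite trap_eq1 ?trap_le1//.
    rewrite ltr_pdivlMr// in y1; rewrite ltr_pdivrMr// in y2.
    by rewrite -natr1 in Kk; nra.
  rewrite -/v mulrA ler_pM2r ?haar_tent_gt0// mulrC -[K.+1%:R]natr1 => H.
  by rewrite -natr1 in kK; nra.
rewrite leNgt; apply/negP => sv.
pose k := (Num.Def.trunc ((s + 2) / (v - s))).+1.
have := bound k; apply/negP; rewrite -ltNge.
have : (s + 2) / (v - s) < k%:R by exact: truncnS_gt.
by rewrite ltr_pdivrMr ?subr_gt0//; nra.
Qed.

(** The moduli of the dilations by s and 1/s are inverse to each other, so [modulus_dil_le] at s and
    at 1/s gives both inequalities. *)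
Lemma modulus_dil i a : a != 0 -> modulus (dil i a) = `|a|^-1.
Proof.
move=> a0; rewrite modulus_dil_norm.
have s0 : 0 < `|a| by rewrite normr_gt0.
move: `|a| s0 => s s0.
have su (t : R) : 0 < t -> dil i t \in unitmx by move=> t0; rewrite dil_unit// gt_eqF.
apply/eqP; rewrite eq_le; apply/andP; split.
  by rewrite -{1}[s]invrK modulus_dil_le// invr_gt0.
have ss : dil i s *m dil i s^-1 = 1%:M.
  rewrite mulmx_diag -diag_const_mx; congr diag_mx; apply/rowP => j; rewrite !mxE.
  by case: eqP => _; rewrite ?mulr1// mulfV// gt_eqF.
have si0 : 0 < s^-1 by rewrite invr_gt0.
have := modulusM (su s s0) (su s^-1 si0).
rewrite ss -perm_mx1 modulus_perm => m1.
have m0 := (modulusP (su s s0)).1.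
rewrite -div1r ler_pdivrMr// {1}m1 ler_pM2l//.
exact: modulus_dil_le.
Qed.

Lemma haar_linear A h : A \in unitmx -> Cc h ->
  L (fun y => h (y *m A)) = `|\det A|^-1 * L h.
Proof.
move=> Au hC; rewrite (modulusP Au).2//; congr (_ * _).
apply: (@char_det _ _ modulus) Au.
- exact: modulusM.
- by move=> B /modulusP[].
- exact: modulus_perm.
- exact: modulus_dil.
Qed.

End haar_modulus.

(** * C^1 functions of several variables *)

Section linear_form.
Local Open Scope ring_scope.
Context {R : realType} {n : nat}.

Definition lin_form (c : 'I_n -> R) (h : 'rV[R]_n) : R := \sum_i c i * h 0 i.

Fact lin_form_is_linear c : linear (lin_form c : 'rV[R]_n -> R^o).
Proof.
move=> a x y; rewrite /lin_form scaler_sumr -big_split; apply: eq_bigr => i _ /=.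
by rewrite !mxE mulrDr [a *: _]mulrCA.
Qed.

HB.instance Definition _ c := GRing.isLinear.Build R 'rV[R]_n R^o *:%R (lin_form c)
  (lin_form_is_linear c).

End linear_form.

Section C1.
Local Open Scope classical_set_scope.
Local Open Scope ring_scope.
Context {R : realType}.

Lemma eq_near_continuous (T S : topologicalType) (f g : T -> S) (y : T) :
  (\forall z \near y, f z = g z) -> {for y, continuous f} -> {for y, continuous g}.
Proof.
move=> fg fc; rewrite /prop_for /continuous_at -(nbhs_singleton fg).
by apply: cvg_trans fc; apply: near_eq_cvg; near=> z; near: z; exact: fg.
Unshelve. all: by end_near. Qed.

Lemma continuous_sum (T : topologicalType) (I : Type) (r : seq I)
    (f : I -> T -> R) t : (forall i, {for t, continuous (f i)}) ->
  {for t, continuous (fun t => \sum_(i <- r) f i t)}.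
Proof.
move=> fc; rewrite /prop_for; elim: r => [|i r IH].
  by under eq_fun do rewrite big_nil; exact: cst_continuous.
under eq_fun do rewrite big_cons.
by apply: (@continuousD _ _ _ (f i) (fun t => \sum_(i <- r) f i t)).
Qed.

Section fixed_dimension.
Context {n : nat}.
Local Notation V := 'rV[R]_n.
Implicit Types (U : set V) (F G : V -> R) (y : V) (i : 'I_n).
Local Notation e_ i := (delta_mx 0 i : V).

Definition C1 U F := forall y, U y ->
  [/\ {for y, continuous F}, forall i, derivable F y (e_ i) &
      forall i, {for y, continuous (partial i F)}].

Lemma Ck_on_C1 k U F : Ck_on k.+1 U F -> C1 U F.
Proof.
move=> [Fc Fd] y Uy; split; first exact: Fc.
  by move=> i; exact: (Fd i).1.
by move=> i; case: k {Fc} Fd => [|k] Fd; exact: (Fd i).2.1.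
Qed.

Lemma smooth_C1 U F : smooth_on U F -> C1 U F.
Proof. by move=> /(_ 1) /Ck_on_C1. Qed.

Lemma smooth_partial_C1 U F i : smooth_on U F -> C1 U (partial i F).
Proof. by move=> /(_ 2)[_ /(_ i)[_ H]]; exact: (@Ck_on_C1 0 U (partial i F)). Qed.

Lemma C1_sub U W F : U `<=` W -> C1 W F -> C1 U F.
Proof. by move=> UW FC y /UW /FC. Qed.

Lemma C1U U W F : C1 U F -> C1 W F -> C1 (U `|` W) F.
Proof. by move=> FU FW y [/FU|/FW]. Qed.

Lemma near_partial i F G y : (\forall z \near y, F z = G z) ->
  partial i F y = partial i G y.
Proof. exact: near_eq_derive. Qed.

Lemma C1_eq U F G : open U -> (forall y, U y -> F y = G y) -> C1 U F -> C1 U G.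
Proof.
move=> oU FG FC y Uy; have [Fc Fd Fp] := FC y Uy.
have nU z : U z -> \forall w \near z, F w = G w.
  by move=> Uz; apply: filterS (open_nbhs_nbhs (conj oU Uz)) => w; exact: FG.
split; first exact: eq_near_continuous (nU y Uy) Fc.
  by move=> i; apply: near_eq_derivable (nU y Uy) (Fd i).
move=> i; apply: eq_near_continuous (Fp i).
apply: filterS (open_nbhs_nbhs (conj oU Uy)) => z Uz.
exact: near_partial (nU z Uz).
Qed.

Lemma line_derive F y v t : derivable F (y + t *: v) v ->
  is_derive t 1 (fun s : R => F (y + s *: v)) ('D_v F (y + t *: v)).
Proof.
have E : (fun h : R => h^-1 *: (F (y + (h *: 1 + t) *: v) - F (y + t *: v))) =
         (fun h : R => h^-1 *: (F (h *: v + (y + t *: v)) - F (y + t *: v))).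
  by apply/funext => h; rewrite [h *: 1]mulr1 scalerDl addrCA.
move=> Fd; apply: DeriveDef; first by rewrite /derivable E.
by rewrite /derive E.
Qed.

Lemma coord_MVT F y i (d : R) :
  (forall t, `|t| <= `|d| -> derivable F (y + t *: e_ i) (e_ i)) ->
  exists2 t, `|t| <= `|d| & F (y + d *: e_ i) - F y = d * partial i F (y + t *: e_ i).
Proof.
move=> Fd.
pose f t := F (y + t *: e_ i).
have fd (t : R) : `|t| <= `|d| -> is_derive t 1 f (partial i F (y + t *: e_ i)).
  by move=> td; exact: line_derive (Fd t td).
have fc (t : R) : `|t| <= `|d| -> {for t, continuous f}.
  move=> /fd td; apply/differentiable_continuous/derivable1_diffP.
  exact: ex_derive.
have f0 : f 0 = F y by rewrite /f scale0r addr0.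
have [d0|d0] := leP 0 d.
  have sub (t : R) : t \in `[0, d] -> `|t| <= `|d|.
    by rewrite in_itv /= => /andP[t0 td]; rewrite !ger0_norm.
  have [||t td] := @MVT_segment R f (fun t => partial i F (y + t *: e_ i)) 0 d d0.
  - by move=> t /subset_itv_oo_cc /sub /fd.
  - by apply: continuous_in_subspaceT => t; rewrite inE => /sub /fc.
  by rewrite subr0 f0 => H; exists t; [exact: sub|rewrite mulrC].
have sub (t : R) : t \in `[d, 0] -> `|t| <= `|d|.
  by rewrite in_itv /= => /andP[t0 td]; rewrite !ler0_norm ?lerN2// ltW.
have [||t td] := @MVT_segment R f (fun t => partial i F (y + t *: e_ i)) d 0 (ltW d0).
- by move=> t /subset_itv_oo_cc /sub /fd.
- by apply: continuous_in_subspaceT => t; rewrite inE => /sub /fc.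
rewrite sub0r f0 => H; exists t; first exact: sub.
by rewrite -opprB -/(f d) H mulrN opprK mulrC.
Qed.

(* The point w is reached from p by changing one coordinate at a time. *)
Lemma C1_expansion U (K : set V) F : open U -> compact K -> K `<=` U -> C1 U F ->
  forall e : R, 0 < e -> exists2 d : R, 0 < d & forall p w : V, K p -> `|p - w| < d ->
    U w /\ `|F w - F p - lin_form (fun i => partial i F p) (w - p)| <= e * `|p - w|.
Proof.
move=> oU cK KU FC e e0.
(* The error e is shared among the n coordinate steps; dividing by n + 1 covers n = 0 as well. *)
have en : 0 < e / n.+1%:R by rewrite divr_gt0.
have [d d0 dP] : exists2 d : R, 0 < d & forall p w : V, K p -> `|p - w| < d ->
    U w /\ forall i, `|partial i F p - partial i F w| < e / n.+1%:R.
  have [d1 d10 d1P] := compact_uniform_continuity oU cK KU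
    (fun y Uy => let: And3 Fc _ _ := FC y Uy in Fc) en.
  have H i : \forall d \near (0 : R)^'+, forall p w : V, K p -> `|p - w| < d ->
      `|partial i F p - partial i F w| < e / n.+1%:R.
    have [d d0 dP] := compact_uniform_continuity oU cK KU
      (fun y Uy => let: And3 _ _ Fp := FC y Uy in Fp i) en.
    near=> r => p w Kp pw; apply: (dP p w Kp _).2.
    by apply: lt_trans pw _; near: r; exact: nbhs_right_lt.
  have : \forall d \near (0 : R)^'+, [/\ 0 < d, d < d1 & forall i (p w : V), K p ->
      `|p - w| < d -> `|partial i F p - partial i F w| < e / n.+1%:R].
    near=> r; split; near: r; [exact: nbhs_right_gt|exact: nbhs_right_lt|].
    exact: filter_forall.
  move=> /filter_ex[d [d0 dd1 dP]]; exists d => // p w Kp pw; split.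
    exact: (d1P p w Kp (lt_trans pw dd1)).1.
  by move=> i; exact: dP.
exists d => // p w Kp pw; split; first exact: (dP p w Kp pw).1.
pose q k : V := \row_i (if (i < k)%N then w 0 i else p 0 i).
have q0 : q 0 = p by apply/rowP => i; rewrite mxE ltn0.
have qn : q n = w by apply/rowP => i; rewrite mxE ltn_ord.
have qS (k : 'I_n) : q k.+1 = q k + (w - p) 0 k *: e_ k.
  apply/rowP => i; rewrite !mxE eqxx /=; case: (ltngtP i k) => [ik|ki|/val_inj->].
  - by rewrite ltnS ltnW// -(inj_eq val_inj) ltn_eqF// mulr0 addr0.
  - by rewrite ltnS leqNgt ki /= -(inj_eq val_inj) gtn_eqF// mulr0 addr0.
  - by rewrite ltnS leqnn eqxx mulr1 addrC subrK.
have near_q (k : 'I_n) t : `|t| <= `|(w - p) 0 k| ->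
    `|p - (q k + t *: e_ k)| <= `|p - w|.
  move=> tk; apply: rV_norm_le => // i; rewrite !mxE eqxx /=.
  have [->|ik] := eqVneq i k.
    rewrite ltnn mulr1 opprD addrA subrr sub0r normrN (le_trans tk)//.
    by rewrite distrC; exact: coord_le_norm.
  rewrite mulr0 addr0; case: ifP => _; last by rewrite subrr normr0.
  by have := coord_le_norm (p - w) i; rewrite !mxE.
have -> : F w - F p = \sum_(k < n) (F (q k.+1) - F (q k)).
  by rewrite -(big_mkord xpredT (fun k => F (q k.+1) - F (q k))) telescope_sumr// q0 qn.
rewrite /lin_form -sumrB.
apply: le_trans (ler_norm_sum _ _ _) _.
apply: (@le_trans _ _ (\sum_(k < n) e / n.+1%:R * `|p - w|)).
  apply: ler_sum => k _; rewrite qS.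
  have [|t tk ->] := @coord_MVT F (q k) k ((w - p) 0 k).
    move=> t tk; have Ut : U (q k + t *: e_ k).
      by apply: (dP p _ Kp _).1; exact: le_lt_trans (near_q k t tk) pw.
    by have [_ + _] := FC _ Ut; exact.
  rewrite [X in _ - X]mulrC -mulrBr normrM mulrC; apply: ler_pM => //.
    apply: ltW; rewrite distrC; apply: (dP p _ Kp _).2.
    exact: le_lt_trans (near_q k t tk) pw.
  by rewrite distrC; exact: coord_le_norm.
rewrite sumr_const card_ord -mulrnAl ler_wpM2r// -mulrnAr.
apply: ler_piMr; first exact: ltW.
by rewrite -mulr_natl ler_pdivrMr ?ltr0n// mul1r ler_nat.
Unshelve. all: by end_near. Qed.

Lemma lin_form_continuous (c : 'I_n -> R) : continuous (lin_form c).
Proof.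
move=> z; rewrite /lin_form.
apply: continuous_sum => i; apply: continuousM; first exact: cst_continuous.
exact: coord_continuous.
Qed.

Lemma C1_differentiable U F y : open U -> C1 U F -> U y -> differentiable F y.
Proof.
move=> oU FC Uy.
pose df := lin_form (fun i => partial i F y).
have dfE : F \o shift y = cst (F y) + df +o_ (0 : V) id.
  apply/eqaddoP => e e0.
  have yU : [set y] `<=` U by move=> _ ->.
  have [d d0 dP] := C1_expansion oU (@compact_set1 _ y) yU FC e0.
  have : nbhs (0 : V) (ball (0 : V) d) by exact: nbhsx_ballx.
  apply: filterS => h; rewrite -ball_normE /= sub0r normrN => hd.
  have [|_] := dP y (h + y) (erefl y); first by rewrite opprD addrCA subrr addr0 normrN.
  rewrite addrK opprD addrCA subrr addr0 normrN => H.
  by rewrite /= opprD addrA.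
have dfc : continuous df by exact: lin_form_continuous.
have dE := diff_unique dfc dfE.
by apply/diff_locallyP; rewrite dE.
Qed.

Lemma diff_partial F y h : differentiable F y ->
  'd F y h = lin_form (fun i => partial i F y) h.
Proof.
move=> Fd; rewrite {1}[h]row_sum_delta linear_sum; apply: eq_bigr => i _.
by rewrite linearZ /= /partial deriveE// mulrC.
Qed.

Lemma C1_cst U (c : R) : C1 U (fun=> c).
Proof.
move=> y Uy; split; first exact: cst_continuous.
  by move=> i; exact: derivable_cst.
move=> i; apply: (@eq_near_continuous _ _ (fun=> 0 : R)); last exact: cst_continuous.
by apply: (@filterE _ (nbhs y)) => z; rewrite /partial derive_cst.
Qed.

Lemma C1_by_formula U F (dF : 'I_n -> V -> R) : open U ->
  (forall y, U y -> {for y, continuous F}) ->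
  (forall y i, U y -> is_derive y (e_ i) F (dF i y)) ->
  (forall y i, U y -> {for y, continuous (dF i)}) -> C1 U F.
Proof.
move=> oU Fc Fd dFc y Uy; split; first exact: Fc.
  by move=> i; have [] := Fd y i Uy.
move=> i; apply: eq_near_continuous (dFc y i Uy).
apply: filterS (open_nbhs_nbhs (conj oU Uy)) => z Uz.
by rewrite /partial; have := Fd z i Uz => /@derive_val ->.
Qed.

Lemma C1_is_derive U F y i : C1 U F -> U y -> is_derive y (e_ i) F (partial i F y).
Proof. by move=> FC Uy; have [_ Fd _] := FC y Uy; exact/derivableP. Qed.

Lemma C1D U F G : open U -> C1 U F -> C1 U G -> C1 U (fun y => F y + G y).
Proof.
move=> oU FC GC.
apply: (@C1_by_formula _ _ (fun i y => partial i F y + partial i G y)) => //.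
- move=> y Uy; have [Fc _ _] := FC y Uy; have [Gc _ _] := GC y Uy.
  exact: continuousD.
- by move=> y i Uy; exact: (is_deriveD (C1_is_derive i FC Uy) (C1_is_derive i GC Uy)).
- move=> y i Uy; have [_ _ Fp] := FC y Uy; have [_ _ Gp] := GC y Uy.
  by apply: continuousD; [exact: Fp|exact: Gp].
Qed.

Lemma partialM U F G y i : C1 U F -> C1 U G -> U y ->
  partial i (fun y => F y * G y) y = F y * partial i G y + G y * partial i F y.
Proof.
move=> FC GC Uy; have Fi := C1_is_derive i FC Uy; have Gi := C1_is_derive i GC Uy.
by have := is_deriveM Fi Gi => /@derive_val.
Qed.

Lemma C1M U F G : open U -> C1 U F -> C1 U G -> C1 U (fun y => F y * G y).
Proof.
move=> oU FC GC.
apply: (@C1_by_formula _ _ (fun i y => F y * partial i G y + G y * partial i F y)) => //.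
- move=> y Uy; have [Fc _ _] := FC y Uy; have [Gc _ _] := GC y Uy.
  exact: continuousM.
- by move=> y i Uy; exact: (is_deriveM (C1_is_derive i FC Uy) (C1_is_derive i GC Uy)).
- move=> y i Uy; have [Fc _ Fp] := FC y Uy; have [Gc _ Gp] := GC y Uy.
  by apply: continuousD; apply: continuousM.
Qed.

Lemma C1_sum U (I : Type) (r : seq I) (F : I -> V -> R) : open U ->
  (forall j : I, C1 U (F j)) -> C1 U (fun y => \sum_(i <- r) F i y).
Proof.
move=> oU FC; elim: r => [|i r IH].
  by under eq_fun do rewrite big_nil; exact: C1_cst.
by under eq_fun do rewrite big_cons; exact: (C1D oU (FC i) IH).
Qed.

Lemma C1_prod U (I : Type) (r : seq I) (F : I -> V -> R) : open U ->
  (forall j : I, C1 U (F j)) -> C1 U (fun y => \prod_(i <- r) F i y).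
Proof.
move=> oU FC; elim: r => [|i r IH].
  by under eq_fun do rewrite big_nil; exact: C1_cst.
by under eq_fun do rewrite big_cons; exact: (C1M oU (FC i) IH).
Qed.

Lemma C1_comp1 U (O : set R) (s ds : R -> R) F : open U -> C1 U F ->
  (forall y, U y -> O (F y)) ->
  (forall x, O x -> is_derive x 1 s (ds x)) ->
  (forall x, O x -> {for x, continuous ds}) ->
  C1 U (fun y => s (F y)).
Proof.
move=> oU FC FO sd dsc.
apply: (@C1_by_formula _ _ (fun i y => ds (F y) * partial i F y)) => //.
- move=> y Uy; have [Fc _ _] := FC y Uy; apply: continuous_comp => //.
  have [sF _] := sd _ (FO y Uy).
  exact/differentiable_continuous/derivable1_diffP.
- move=> y i Uy; have Fd := C1_differentiable oU FC Uy.
  have [sF sE] := sd _ (FO y Uy).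
  have s1 : differentiable s (F y) by exact/derivable1_diffP.
  have sFd : differentiable (s \o F) y by exact: differentiable_comp.
  apply: DeriveDef; first exact: diff_derivable.
  by rewrite deriveE// diff_comp//= diff1E// derive1E sE -deriveE// mulrC.
- move=> y i Uy; have [Fc _ Fp] := FC y Uy.
  apply: continuousM; last exact: Fp.
  by apply: continuous_comp => //; exact/dsc/FO.
Qed.

Lemma C1V U F : open U -> C1 U F -> (forall y, U y -> F y != 0) ->
  C1 U (fun y => (F y)^-1).
Proof.
move=> oU FC F0.
apply: (@C1_comp1 _ [set x | x != 0] (fun x => x^-1) (fun x => - x ^- 2)) => //.
- move=> x x0; apply: DeriveDef; first by apply: derivableV => //; exact: derivable_id.
  have d1 : derivable (@id R) x 1 by exact: derivable_id.
  have := deriveV x0 d1; rewrite derive_id => ->.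
  by rewrite [_ *: _]mulr1.
- move=> x x0; apply: continuousN; apply: continuousV.
    by rewrite expf_neq0.
  exact: exprn_continuous.
Qed.

Lemma C1_sqrt U F : open U -> C1 U F -> (forall y, U y -> 0 < F y) ->
  C1 U (fun y => Num.sqrt (F y)).
Proof.
move=> oU FC F0.
apply: (@C1_comp1 _ [set x | 0 < x] Num.sqrt (fun x => (2 * Num.sqrt x)^-1)) => //.
- move=> x x0; apply: continuousV; first by rewrite mulf_neq0// gt_eqF// sqrtr_gt0.
  by apply: continuousM; [exact: cst_continuous|exact: sqrt_continuous].
Qed.

End fixed_dimension.

Section composition.
Context {n m : nat}.
Implicit Types (U : set 'rV[R]_n) (W : set 'rV[R]_m).

Lemma differentiable_map U (Phi : 'rV[R]_n -> 'rV[R]_m) y : open U ->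
  (forall k, C1 U (fun y => Phi y 0 k)) -> U y ->
  differentiable Phi y /\
  forall h, 'd Phi y h = \row_k lin_form (fun i => partial i (fun z => Phi z 0 k) y) h.
Proof.
move=> oU PC Uy.
pose f k : 'rV[R]_n -> 'rV[R]_m := fun z => (Phi z 0 k) *: delta_mx 0 k.
have PE : Phi = \sum_(k < m) f k.
  apply/funext => z; rewrite fct_sumE {1}[Phi z]row_sum_delta.
  by [].
have fd k : differentiable (f k) y.
  by apply: differentiableZl; exact: C1_differentiable (PC k) Uy.
have Pd : differentiable Phi y by rewrite PE; exact: differentiable_sum.
split => // h; apply/rowP => k; rewrite mxE.
have kd := C1_differentiable oU (PC k) Uy.
rewrite -(diff_partial h kd).
have prE : lin_form (fun j => (j == k)%:R) \o Phi = (fun z => Phi z 0 k).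
  apply/funext => z /=; rewrite /lin_form (bigD1 k)//= eqxx mul1r big1 ?addr0// => j.
  by move=> /negPf->; rewrite mul0r.
pose pr := lin_form (fun j => (j == k)%:R) : {linear 'rV[R]_m -> R^o}.
have prc : continuous pr by exact: lin_form_continuous.
have prd : differentiable pr (Phi y) by exact: linear_differentiable.
rewrite -prE (_ : 'd _ y h = pr ('d Phi y h)); last first.
  by rewrite [LHS](congr1 (fun f => f h) (diff_comp Pd prd)) /= diff_lin.
rewrite /pr /= /lin_form (bigD1 k)//= eqxx mul1r big1 ?addr0// => j.
by move=> /negPf->; rewrite mul0r.
Qed.

Lemma partial_comp U W (Phi : 'rV[R]_n -> 'rV[R]_m) F y i : open U -> open W ->
  (forall k, C1 U (fun y => Phi y 0 k)) -> C1 W F -> U y -> W (Phi y) ->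
  is_derive y (delta_mx 0 i : 'rV[R]_n) (F \o Phi)
    (\sum_k partial k F (Phi y) * partial i (fun z => Phi z 0 k) y).
Proof.
move=> oU oW PC FC Uy Wy.
have [Pd PE] := differentiable_map oU PC Uy.
have Fd := C1_differentiable oW FC Wy.
have FPd : differentiable (F \o Phi) y by exact: differentiable_comp.
apply: DeriveDef; first exact: diff_derivable.
rewrite deriveE// diff_comp//= PE diff_partial// /lin_form.
apply: eq_bigr => k _; congr (_ * _); rewrite mxE /lin_form (bigD1 i)//= big1 => [|j ji].
  by rewrite !mxE !eqxx mulr1 addr0.
by rewrite mxE eqxx (negPf ji) mulr0.
Qed.

Lemma C1_comp U W (Phi : 'rV[R]_n -> 'rV[R]_m) F : open U -> open W ->
  (forall k, C1 U (fun y => Phi y 0 k)) -> C1 W F -> (forall y, U y -> W (Phi y)) ->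
  C1 U (F \o Phi).
Proof.
move=> oU oW PC FC UW.
have Pc y : U y -> {for y, continuous Phi}.
  by move=> /(differentiable_map oU PC)[/differentiable_continuous].
apply: (@C1_by_formula _ _ _
  (fun i y => \sum_k partial k F (Phi y) * partial i (fun z => Phi z 0 k) y)) => //.
- move=> y Uy; have [Fc _ _] := FC _ (UW y Uy).
  by apply: continuous_comp => //; exact: Pc.
- by move=> y i Uy; apply: (partial_comp i oU oW) => //; exact: UW.
- move=> y i Uy; have [_ _ Fp] := FC _ (UW y Uy).
  apply: continuous_sum => k; have [_ _ Pp] := PC k y Uy.
  apply: continuousM; last exact: Pp.
  by apply: continuous_comp; [exact: Pc|exact: Fp].
Qed.

End composition.
End C1.

(** * Integrals of partial derivatives on R^n *)

Section integration_by_parts.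
Local Open Scope classical_set_scope.
Local Open Scope ring_scope.
Context {R : realType} {n : nat}.
Local Notation E := 'rV[R]_n.
Implicit Types (F h : E -> R) (y : E).

Lemma open_norm_gt (B : R) : open [set y : E | B < `|y|].
Proof.
rewrite (_ : [set _ | _] = (fun y : E => `|y|) @^-1` [set x | B < x]) //.
apply: open_comp; last exact: open_gt.
by move=> y _; exact: norm_continuous.
Qed.

Lemma Cc_partial F i : C1 setT F -> Cc F -> Cc (partial i F).
Proof.
move=> FC FCc; have [B B0 FB] := Cc_bound FCc; split.
  by move=> y; have [_ _ Fp] := FC y I; exact: Fp.
exists B => y By; rewrite (@near_partial _ _ i F (fun=> 0)).
  by rewrite /partial derive_cst.
by apply: filterS (open_nbhs_nbhs (conj (@open_norm_gt B) By)) => z; exact: FB.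
Qed.

(** Difference quotients of F have integral 0 by translation invariance, and by the mean value
    theorem they approach the partial derivative uniformly with supports in a common ball. *)
Lemma haar_partial (L : (E -> R) -> R) F i : haar L -> C1 setT F -> Cc F ->
  L (partial i F) = 0.
Proof.
move=> hL FC FCc; have pC := Cc_partial i FC FCc.
have [B B0 FB] := Cc_bound2 FCc pC.
have bC : Cc (bump_over (B + 1) : E -> R) by exact: Cc_bump_over.
have b0 : 0 <= L (bump_over (B + 1)).
  by apply: (haar_ge0 hL) => // y; exact: bump_over_ge0.
apply/eqP; rewrite -normr_le0; apply/ler_addgt0Pr => e e0; rewrite add0r.
have e1 : 0 < e / (1 + L (bump_over (B + 1))) by rewrite divr_gt0// ltr_wpDr.
have [d d0 dP] := Cc_uniform pC e1.
(* [t < d] keeps the intermediate point within the modulus of continuity of the derivative; [t <= 1]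
   keeps the support of the quotient in the ball of radius B + 1. *)
pose t : R := Num.min (d / 2) 1.
have t0 : 0 < t by rewrite lt_min ltr01 divr_gt0.
have td : t < d by rewrite /t gt_min ltr_pdivrMr// ltr_pMr// ltr1n.
have t1 : t <= 1 by rewrite /t ge_min lexx orbT.
pose v : E := t *: delta_mx 0 i.
have vn (s : R) : `|s| <= t -> `|s *: (delta_mx 0 i : E)| <= t.
  move=> st; apply: rV_norm_le => [|j]; first exact: ltW.
  rewrite !mxE eqxx /=; case: (j == i); rewrite ?mulr1// mulr0 normr0.
  exact: ltW.
pose G y := t^-1 * (F (y + v) - F y).
have GC : Cc G by apply: CcZ; apply: CcB => //; exact: Cc_translate.
have GL : L G = 0.
  rewrite (haarZ hL)//; last by apply: CcB => //; exact: Cc_translate.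
  rewrite (haarB hL)//; last exact: Cc_translate.
  by rewrite (haar_translate hL)// subrr mulr0.
rewrite -[L _]subr0 -GL -(haarB hL)//.
apply: (@le_trans _ _ (e / (1 + L (bump_over (B + 1))) * L (bump_over (B + 1)))).
  rewrite -(haarZ hL)//; apply: (haar_norm_le hL); [exact: CcB|exact: CcZ|move=> y].
  have [yB|By] := leP `|y| (B + 1); last first.
    have vB : B < `|y + v|.
      rewrite -(ltrD2r `|v|); apply: lt_le_trans (ler_normB _ _); rewrite addrK.
      by apply: le_lt_trans By; rewrite lerD2l (le_trans (vn t _))// gtr0_norm.
    rewrite /G (FB _ vB).1 (FB y _).1 ?(FB y _).2 ?subrr ?mulr0 ?subrr ?normr0.
    - by rewrite mulr_ge0 ?bump_over_ge0 ?ltW.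
    - by rewrite (le_lt_trans _ By)// lerDl.
    - by rewrite (le_lt_trans _ By)// lerDl.
  have [|s st sE] := @coord_MVT R n F y i t.
    by move=> s _; have [_ + _] := FC (y + s *: delta_mx 0 i) I; exact.
  rewrite /G /v sE mulrA mulVf ?gt_eqF// mul1r.
  rewrite (gtr0_norm t0) in st.
  apply: (@le_trans _ _ (e / (1 + L (bump_over (B + 1))))).
    apply/ltW/dP; rewrite opprD addrA subrr sub0r normrN.
    by rewrite (le_lt_trans _ td)// vn.
  by rewrite ler_peMr ?(ltW e1)// bump_over_ge1.
rewrite mulrAC ler_pdivrMr ?ltr_wpDr// ler_pM2l//.
by rewrite lerDr.
Qed.

End integration_by_parts.

(** * Change of variables *)

Section change_of_variables.
Local Open Scope classical_set_scope.
Local Open Scope ring_scope.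
Context {R : realType} {n : nat}.
Local Notation E := 'rV[R]_n.
Implicit Types (h F : E -> R) (U W K : set E) (Phi Psi : E -> E) (p w y : E).

Lemma common_radius (I : finType) (P : I -> R -> Prop) :
  (forall i d d', 0 < d' -> d' <= d -> P i d -> P i d') ->
  (forall i, exists2 d, 0 < d & P i d) -> exists2 d, 0 < d & forall i, P i d.
Proof.
move=> Pdec Pex.
have H i : \forall d \near (0 : R)^'+, P i d.
  have [d d0 dP] := Pex i; near=> r; apply: Pdec dP.
    by near: r; exact: nbhs_right_gt.
  by near: r; exact: nbhs_right_le.
have : \forall d \near (0 : R)^'+, 0 < d /\ forall i, P i d.
  apply: filterI; first exact: nbhs_right_gt.
  exact: filter_forall H.
by move=> /filter_ex[d [d0 dP]]; exists d.
Unshelve. all: by end_near. Qed.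

Lemma bounded_on_compact (T : topologicalType) (K : set T) (F : T -> R) :
  compact K -> (forall y : T, K y -> {for y, continuous F}) ->
  exists2 C, 0 < C & forall y : T, K y -> `|F y| <= C.
Proof.
move=> cK Fc.
have /ex_strict_bound_gt0[C C0 /= CP] : bounded_set (F @` K).
  apply/compact_bounded/continuous_compact => //.
  by apply: continuous_in_subspaceT => y; rewrite inE; exact: Fc.
by exists C => // y Ky; apply/ltW/CP; exists y.
Qed.

(** Vectors being rows, the differential at p is right multiplication by this matrix, the transpose
    of the usual Jacobian. *)
Definition jac Phi p : 'M[R]_n := \matrix_(i, k) partial i (fun z => Phi z 0 k) p.

Definition C1_map U Phi := forall k, C1 U (fun y => Phi y 0 k).

Lemma C1_map_continuous U Phi y : open U -> C1_map U Phi -> U y ->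
  {for y, continuous Phi}.
Proof. by move=> oU PC /(differentiable_map oU PC)[/differentiable_continuous]. Qed.

Lemma jac_continuous U Phi y i k : C1_map U Phi -> U y ->
  {for y, continuous (fun z => jac Phi z i k)}.
Proof.
move=> PC Uy; have [_ _ Pp] := PC k y Uy.
by apply: eq_near_continuous (Pp i); apply: (@filterE _ (nbhs y)) => z; rewrite mxE.
Qed.

Lemma jac_expansion U K Phi : open U -> compact K -> K `<=` U -> C1_map U Phi ->
  forall e : R, 0 < e -> exists2 d : R, 0 < d & forall p w, K p -> `|p - w| < d ->
    U w /\ `|Phi w - Phi p - (w - p) *m jac Phi p| <= e * `|p - w|.
Proof.
move=> oU cK KU PC e e0.
(* Applied to the zero function, uniform continuity just yields a radius whose neighbourhood of K
   stays in U; the expansion in each component gives no such radius when n = 0. *)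
have [d1 d10 d1P] := compact_uniform_continuity (h := fun=> 0) oU cK KU
  (fun y _ => @cst_continuous _ _ 0 y) e0.
have [||d2 d20 d2P] := @common_radius 'I_n (fun k d => forall p w : E, K p -> `|p - w| < d ->
    `|Phi w 0 k - Phi p 0 k - lin_form (fun i => jac Phi p i k) (w - p)| <= e * `|p - w|).
- by move=> k d d' _ dd H p w Kp pw; apply: H => //; exact: lt_le_trans pw dd.
- move=> k; have [d d0 dP] := C1_expansion oU cK KU (PC k) e0.
  exists d => // p w Kp pw.
  rewrite (_ : jac Phi p ^~ k = fun i => partial i (fun y => Phi y 0 k) p).
    exact: (dP p w Kp pw).2.
  by apply/funext => i; rewrite mxE.
exists (Num.min d1 d2); first by rewrite lt_min d10.
move=> p w Kp; rewrite lt_min => /andP[pw1 pw2]; split; first exact: (d1P _ _ Kp pw1).1.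
apply: rV_norm_le => [|k]; first by rewrite mulr_ge0// ltW.
have := d2P k p w Kp pw2; congr (`|_| <= _).
rewrite !mxE; congr (_ - _); rewrite /lin_form; apply: eq_bigr => i _.
by rewrite !mxE mulrC.
Qed.

Lemma partial_coord (i k : 'I_n) y : partial i (fun z : E => z 0 k) y = (i == k)%:R.
Proof.
pose pr := lin_form (fun j => (j == k)%:R) : {linear E -> R^o}.
have prE : (fun z : E => z 0 k) = pr.
  apply/funext => z; rewrite /pr /= /lin_form (bigD1 k)//= eqxx mul1r big1 ?addr0// => j.
  by move=> /negPf->; rewrite mul0r.
have prc : continuous pr by exact: lin_form_continuous.
rewrite /partial prE deriveE; last exact: linear_differentiable.
rewrite diff_lin// -prE !mxE eqxx /= eq_sym.
by [].
Qed.

Lemma jac_inverse U W Phi Psi p : open U -> open W ->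
  C1_map U Phi -> C1_map W Psi -> (forall y, U y -> W (Phi y)) ->
  (forall y, U y -> Psi (Phi y) = y) -> U p ->
  jac Phi p *m jac Psi (Phi p) = 1%:M.
Proof.
move=> oU oW PC QC UW QP Up; apply/matrixP => i k.
have H := partial_comp i oU oW PC (QC k) Up (UW p Up).
rewrite !mxE -(partial_coord i k p).
rewrite -(@near_partial _ _ i ((fun z => Psi z 0 k) \o Phi)); last first.
  by apply: filterS (open_nbhs_nbhs (conj oU Up)) => z Uz /=; rewrite QP.
have := H => /@derive_val; rewrite /partial => ->.
by apply: eq_bigr => l _; rewrite !mxE mulrC.
Qed.

Definition pushforward W Psi h w := if w \in W then h (Psi w) else 0.

(** The function vanishes off the compact, hence closed, set Phi(K). Continuity is local on two open
    sets that cover the space: W and the complement of Phi(K). *)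
Lemma Cc_pushforward U W K Phi Psi h : open U -> open W ->
  C1_map U Phi -> C1_map W Psi -> (forall w, W w -> Phi (Psi w) = w) ->
  (forall y, U y -> W (Phi y)) ->
  compact K -> K `<=` U -> continuous h -> (forall y, ~ K y -> h y = 0) ->
  Cc (pushforward W Psi h).
Proof.
move=> oU oW PC QC PQ UW cK KU hc hK.
have cPK : compact (Phi @` K).
  apply: continuous_compact => //; apply: continuous_in_subspaceT => y.
  by rewrite inE => /KU; exact: C1_map_continuous.
have clPK : closed (Phi @` K) by apply: compact_closed => //; exact: norm_hausdorff.
have out w : ~ (Phi @` K) w -> pushforward W Psi h w = 0.
  move=> wK; rewrite /pushforward; case: ifP => //; rewrite inE => Ww.
  by apply: hK => KQ; apply: wK; exists (Psi w) => //; exact: PQ.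
split.
  move=> w; have [Ww|nWw] := pselect (W w).
    apply: (@eq_near_continuous _ _ (h \o Psi)).
      apply: filterS (open_nbhs_nbhs (conj oW Ww)) => z Wz /=.
      by rewrite /pushforward mem_set.
    apply: continuous_comp; first exact: C1_map_continuous QC Ww.
    exact: hc.
  have nK : ~ (Phi @` K) w by move=> [y Ky yw]; apply: nWw; rewrite -yw; exact/UW/KU.
  apply: (@eq_near_continuous _ _ (fun=> 0)); last exact: cst_continuous.
  have oC : open (~` (Phi @` K)) by exact: closed_openC.
  by apply: filterS (open_nbhs_nbhs (conj oC nK)) => z /out.
have /ex_strict_bound_gt0[B B0 /= BP] : bounded_set (Phi @` K) by exact: compact_bounded.
exists B => w Bw; apply: out => wK.
by have := BP w wK; rewrite ltNge ltW.
Qed.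

Lemma det_continuous (T : topologicalType) (A : T -> 'M[R]_n) (t : T) :
  (forall i j, {for t, continuous (fun s => A s i j)}) ->
  {for t, continuous (fun s => \det (A s))}.
Proof.
move=> Ac; rewrite /determinant.
apply: continuous_sum => s; apply: continuousM; first exact: cst_continuous.
by apply: continuous_prod => i; exact: Ac.
Qed.

Lemma jac_det_continuous U Phi y : C1_map U Phi -> U y ->
  {for y, continuous (fun z => `|\det (jac Phi z)|)}.
Proof.
move=> PC Uy; apply: continuous_comp; last exact: norm_continuous.
by apply: det_continuous => i j; exact: jac_continuous PC Uy.
Qed.

Lemma entry_sum_bound U K Phi : compact K -> K `<=` U -> C1_map U Phi ->
  exists2 C, 0 < C & forall p, K p -> entry_sum (jac Phi p) <= C.
Proof.
move=> cK KU PC.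
have [|C C0 CP] := @bounded_on_compact _ K (fun p => entry_sum (jac Phi p)) cK.
  move=> y /KU Uy; rewrite /entry_sum; apply: continuous_sum => i.
  apply: continuous_sum => j; apply: continuous_comp; last exact: norm_continuous.
  exact: jac_continuous PC Uy.
by exists C => // p Kp; exact: le_trans (ler_norm _) (CP p Kp).
Qed.

Variables (L : (E -> R) -> R) (hL : haar L).

Lemma haar_dilate m h : Cc h ->
  L (fun y => h (m.+1%:R *: y)) = m.+1%:R ^- n * L h.
Proof.
move=> hC; have Au : m.+1%:R%:M \in @unitmx R n.
  by rewrite unitmxE det_scalar unitrX// unitfE pnatr_eq0.
have := haar_linear hL Au hC; rewrite det_scalar normrX ger0_norm ?ler0n// => <-.
by congr L; apply/funext => y; rewrite mul_mx_scalar.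
Qed.

Lemma mesh_weightE m : mesh_weight L m = m.+1%:R ^- n * L tent.
Proof.
rewrite -haar_dilate; last exact: Cc_tent.
by congr L; apply/funext => y; rewrite /tent_at subr0.
Qed.

Context {U W K : set E} {Phi Psi : E -> E}.
Hypotheses (oU : open U) (oW : open W) (PC : C1_map U Phi) (QC : C1_map W Psi).
Hypotheses (PU : forall y, U y -> W (Phi y)).
Hypotheses (QP : forall y, U y -> Psi (Phi y) = y).
Hypotheses (PQ : forall w, W w -> Phi (Psi w) = w).
Hypotheses (cK : compact K) (KU : K `<=` U).

(** Near q = Phi(p) the inverse Psi is its affine approximation up to an error small against
    1/(m+1), so the transported tent is e-close to [lin], a tent composed with an affine map, whose
    integral is given by [haar_linear]. The two differ only in a ball of radius comparable to
    1/(m+1); by scaling its cost is [e * T * mesh_weight L m], with T independent of p and m. *)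
Lemma tent_pushforward : exists2 T, 0 <= T & forall e, 0 < e ->
  \forall m \near \oo, forall p, K p ->
    Cc (pushforward W Psi (tent_at m p)) /\
    `|L (pushforward W Psi (tent_at m p)) - `|\det (jac Phi p)| * mesh_weight L m|
      <= e * T * mesh_weight L m.
Proof.
have [C1 C10 C1P] := entry_sum_bound cK KU PC.
(* A Lipschitz constant for Phi at points of K: [C1] from the differential and 1 from the remainder
   of the expansion taken with error 1. *)
pose C := C1 + 1.
have C0 : 0 < C by rewrite addr_gt0.
have bC : Cc (bump_over C : E -> R) by exact: Cc_bump_over.
have b0 : 0 <= L (bump_over C).
  by apply: (haar_ge0 hL) => // y; exact: bump_over_ge0.
have T0 := haar_tent_gt0 hL.
exists (L (bump_over C) / L tent); first by rewrite divr_ge0// ltW.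
move=> e e0.
have [eta eta0 etaP] := Cc_uniform (@Cc_tent R n) e0.
have [dP dP0 dPP] := jac_expansion oU cK KU PC ltr01.
have cPK : compact (Phi @` K).
  apply: continuous_compact => //; apply: continuous_in_subspaceT => y.
  by rewrite inE => /KU; exact: C1_map_continuous.
have PKW : Phi @` K `<=` W by move=> _ [y /KU /PU + <-].
(* At distance at most C/(m+1) from q this slope makes the error of Psi at most eta/(2(m+1)); the
   tent multiplies it by m + 1, which leaves less than eta. *)
have ec0 : 0 < eta / (2 * C) by rewrite divr_gt0// mulr_gt0.
have [dQ dQ0 dQP] := jac_expansion oW cPK PKW QC ec0.
have dQC : 0 < dQ / C by rewrite divr_gt0.
near=> m.
have M0 : (0 : R) < m.+1%:R by rewrite ltr0n.
have mP : (m.+1%:R : R)^-1 < dP by near: m; exact: near_infty_natSinv_lt (PosNum dP0).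
have mQ : C * (m.+1%:R : R)^-1 < dQ.
  rewrite mulrC -ltr_pdivlMr//.
  by near: m; exact: near_infty_natSinv_lt (PosNum dQC).
move=> p Kp.
have supp y : tent_at m p y != 0 -> `|p - y| < m.+1%:R^-1.
  by rewrite distrC; apply: contraNT; rewrite -leNgt => /tent_at_out->.
have PLip y : `|p - y| < dP -> `|Phi y - Phi p| <= C * `|p - y|.
  move=> py; have [_ H] := dPP p y Kp py.
  rewrite -(subrK ((y - p) *m jac Phi p) (Phi y - Phi p)).
  apply: le_trans (ler_normD _ _) _; rewrite /C mulrDl addrC lerD//.
  by apply: le_trans (mulmx_norm_le _ _) _; rewrite distrC mulrC ler_wpM2r// C1P.
have pC : Cc (pushforward W Psi (tent_at m p)).
  apply: (@Cc_pushforward U W [set y | `|p - y| <= m.+1%:R^-1] Phi) => //.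
  - exact: compact_norm_ball.
  - by move=> y /= py; have [] := dPP p y Kp (le_lt_trans py mP).
  - by have [] := @Cc_tent_at R n m p.
  - move=> y /= /negP; rewrite -ltNge => py; apply: tent_at_out.
    by rewrite distrC ltW.
split => //.
pose q := Phi p; pose B := jac Psi q.
have AB : jac Phi p *m B = 1%:M by apply: (jac_inverse oU oW) => //; exact: KU.
have dAB : \det (jac Phi p) * \det B = 1 by rewrite -det_mulmx AB det1.
have Bu : B \in unitmx by case: (mulmx1_unit AB).
have BA : B *m jac Phi p = 1%:M by exact: mulmx1C.
pose lin w := tent_at m 0 ((w - q) *m B).
have tC := @Cc_tent_at R n m 0.
have linC : Cc lin by exact: (Cc_translate (- q) (Cc_mulmx Bu tC)).
have linL : L lin = `|\det (jac Phi p)| * mesh_weight L m.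
  rewrite [LHS](haar_translate hL (- q) (Cc_mulmx Bu tC)) (haar_linear hL)//.
  congr (_ * _); apply: (mulIf (x := `|\det B|)).
    by rewrite normr_eq0; apply/eqP => dB; move: dAB; rewrite dB mulr0 => /eqP; rewrite eq_sym oner_eq0.
  rewrite -normrM dAB normr1 mulVf// normr_eq0.
  by apply/eqP => dB; move: dAB; rewrite dB mulr0 => /eqP; rewrite eq_sym oner_eq0.
rewrite -linL -(haarB hL)//.
pose dom w := e * bump_over C (m.+1%:R *: (w - q)).
have domC0 : Cc (fun w => bump_over C (m.+1%:R *: w) : R).
  have Au : m.+1%:R%:M \in @unitmx R n.
    by rewrite unitmxE det_scalar unitrX// unitfE pnatr_eq0.
  have := Cc_mulmx Au bC; congr Cc; apply/funext => y.
  by rewrite mul_mx_scalar.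
have domC : Cc dom by apply: CcZ; exact: (Cc_translate (- q) domC0).
have -> : e * (L (bump_over C) / L tent) * mesh_weight L m = L dom.
  rewrite /dom (haarZ hL); last exact: (Cc_translate (- q) domC0).
  rewrite (haar_translate hL (- q) domC0) haar_dilate// mesh_weightE.
  move: (m.+1%:R ^- n) => Mn; field.
  by rewrite gt_eqF.
apply: (haar_norm_le hL) => //; first exact: CcB.
move=> w.
have [wq|wq] := leP `|q - w| (C * m.+1%:R^-1); last first.
  have -> : lin w = 0.
    apply: tent_at_out; rewrite subr0 leNgt; apply/negP => small.
    move: wq; rewrite ltNge => /negP; apply.
    rewrite distrC -[w - q]mulmx1 -BA mulmxA.
    apply: le_trans (mulmx_norm_le _ _) _; rewrite mulrC.
    apply: ler_pM; rewrite ?entry_sum_ge0// ?(ltW small)//.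
    by rewrite (le_trans (C1P p Kp))// lerDl.
  have -> : pushforward W Psi (tent_at m p) w = 0.
    rewrite /pushforward; case: ifP => //; rewrite inE => Ww.
    apply/eqP; apply: contraT => /supp py.
    exfalso; move: wq; rewrite ltNge => /negP; apply.
    rewrite distrC -{1}(PQ Ww); apply: le_trans (PLip _ (lt_trans py mP)) _.
    by rewrite ler_wpM2l ?ltW.
  by rewrite subrr normr0 mulr_ge0 ?bump_over_ge0 ?ltW.
have qK : (Phi @` K) q by exists p.
have [Ww Qexp] := dQP q w qK (le_lt_trans wq mQ).
rewrite /pushforward mem_set//.
apply: (@le_trans _ _ e).
  apply/ltW/etaP; rewrite subr0 -scalerBr normrZ gtr0_norm//.
  have -> : Psi w - p - (w - q) *m B = Psi w - Psi q - (w - q) *m B.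
    by rewrite /q QP//; exact: KU.
  rewrite -ltr_pdivlMl//; apply: le_lt_trans Qexp _.
  apply: (@le_lt_trans _ _ (eta / (2 * C) * (C * m.+1%:R^-1))).
    by rewrite ler_pM2l.
  have -> : eta / (2 * C) * (C * m.+1%:R^-1) = m.+1%:R^-1 * (eta / 2).
    by move: (m.+1%:R^-1 : R) => x; field; rewrite gt_eqF.
  by rewrite ltr_pM2l ?invr_gt0// gtr_pMr// invf_lt1// ltr1n.
rewrite /dom ler_peMr ?(ltW e0)// bump_over_ge1// normrZ gtr0_norm//.
by rewrite distrC -ler_pdivlMl// mulrC.
Unshelve. all: by end_near. Qed.

(** Replacing h by its interpolation turns the transported function into a combination of
    transported tents. By [tent_pushforward] their integrals form, up to a small error, the mesh sum
    of [h |det jac|], which tends to the right-hand side by [haar_mesh_cvg]. *)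
Lemma haar_change_of_variables h : continuous h -> (forall y, ~ K y -> h y = 0) ->
  [/\ Cc (pushforward W Psi h), Cc (fun y => h y * `|\det (jac Phi y)|) &
    L (pushforward W Psi h) = L (fun y => h y * `|\det (jac Phi y)|)].
Proof.
move=> hc hK.
have pushC : Cc (pushforward W Psi h) by exact: (Cc_pushforward oU oW PC QC PQ PU cK KU).
have hC : Cc h.
  split=> //; have /ex_strict_bound_gt0[B B0 /= BP] : bounded_set K by exact: compact_bounded.
  by exists B => w Bw; apply: hK => /BP; rewrite ltNge ltW.
pose hd y := h y * `|\det (jac Phi y)|.
have hdK y : ~ K y -> hd y = 0 by move=> /hK; rewrite /hd => ->; rewrite mul0r.
have hdC : Cc hd.
  have [B B0 hB] := Cc_bound hC.
  split; last by exists B => y /hB; rewrite /hd => ->; rewrite mul0r.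
  move=> y; have [Uy|nU] := pselect (U y).
    apply: (@continuousM _ _ h (fun y => `|\det (jac Phi y)|)); first exact: hc.
    exact: jac_det_continuous PC Uy.
  have nK : (~` K) y by move=> /KU.
  have clK : closed K by apply: compact_closed => //; exact: norm_hausdorff.
  have oC : open (~` K) by exact: closed_openC.
  apply: (@eq_near_continuous _ _ (fun=> 0)); last exact: cst_continuous.
  by apply: filterS (open_nbhs_nbhs (conj oC nK)) => z /hdK.
split => //.
have [B B0 hB] := Cc_bound hC.
have [T T0 TP] := tent_pushforward.
have [C1 C10 C1P] := entry_sum_bound cK KU PC.
have [dP dP0 dPP] := jac_expansion oU cK KU PC ltr01.
have [D D0 DP] : exists2 D, 0 < D & forall y, K y -> `|Phi y| <= D.
  have [|D D0 DP] := @bounded_on_compact _ K (fun y => `|Phi y|) cK.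
    move=> y /KU Uy; apply: continuous_comp; last exact: norm_continuous.
    exact: C1_map_continuous PC Uy.
  by exists D => // y /DP; rewrite normr_id.
(* G bounds Phi on the dP-neighbourhood of K, which contains the supports of all fine tents centred
   in K; hence the transported functions vanish outside the ball of radius G. *)
pose G := D + (C1 + 1) * dP.
have GP p y : K p -> `|p - y| < dP -> `|Phi y| <= G.
  move=> Kp py; have [_ H] := dPP p y Kp py.
  have -> : Phi y = Phi p + ((Phi y - Phi p - (y - p) *m jac Phi p) + (y - p) *m jac Phi p).
    by rewrite subrK addrCA subrr addr0.
  apply: le_trans (ler_normD _ _) _; apply: lerD; first exact: DP.
  apply: le_trans (ler_normD _ _) _; rewrite addrC mulrDl; apply: lerD; last first.
    by apply: le_trans H _; rewrite ler_wpM2l ?ltW.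
  apply: le_trans (mulmx_norm_le _ _) _; rewrite distrC mulrC.
  by apply: ler_pM; rewrite ?entry_sum_ge0 ?C1P// ltW.
have bC : Cc (bump_over G : E -> R) by exact: Cc_bump_over.
have b0 : 0 <= L (bump_over G).
  by apply: (haar_ge0 hL) => // y; exact: bump_over_ge0.
pose ah y := `|h y|.
have ahC : Cc ah.
  split; last by exists B => y /hB; rewrite /ah => ->; rewrite normr0.
  by move=> y; apply: continuous_comp; [exact: hc|exact: norm_continuous].
have ah0 : 0 <= L ah by apply: (haar_ge0 hL) => // y; exact: normr_ge0.
apply/esym/(cvg_unique _ (haar_mesh_cvg hL hdC)) => //.
apply/cvgrPdist_le => /= e e0.
(* The interpolation error is at most [e1 * (B + 2)], the maximum of its majorant, on the ball of
   radius G; the tent errors add [e1 * T] times the mesh sum of |h|, which is eventually at most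
   [L ah + 1]. The last 1 makes the constant positive. *)
pose cst := (B + 2) * L (bump_over G) + T * (L ah + 1) + 1.
have cst0 : 0 < cst by rewrite ltr_wpDl// addr_ge0 ?mulr_ge0 ?addr_ge0.
pose e1 := e / cst.
have e10 : 0 < e1 by rewrite divr_gt0.
have eB0 : 0 <= e1 * (B + 2) by rewrite mulr_ge0 ?(ltW e10)// addr_ge0.
near=> m.
have mP : (m.+1%:R : R)^-1 < dP by near: m; exact: near_infty_natSinv_lt (PosNum dP0).
have close : forall k, m.+1%:R * (B + 1) <= k%:R ->
    forall y, `|h y - interp m k h y| <= e1 * bump_over (B + 1) y.
  by near: m; exact: interp_close.
have tents : forall p, K p -> Cc (pushforward W Psi (tent_at m p)) /\
    `|L (pushforward W Psi (tent_at m p)) - `|\det (jac Phi p)| * mesh_weight L m|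
      <= e1 * T * mesh_weight L m.
  by near: m; exact: TP.
have ahm : mesh_weight L m * lattice_sum (fun z => ah (grid m z)) <= L ah + 1.
  have : `|L ah - mesh_weight L m * lattice_sum (fun z => ah (grid m z))| <= 1.
    by near: m; move: (haar_mesh_cvg hL ahC) => /cvgrPdist_le; apply.
  by rewrite ler_norml => /andP[]; lra.
pose k := (Num.Def.trunc (m.+1%:R * (B + 1))).+1.
have Bk : m.+1%:R * (B + 1) <= k%:R by exact: ltW (truncnS_gt _).
have Bk' : B * m.+1%:R <= k%:R.
  by apply: le_trans Bk; rewrite mulrC ler_wpM2l ?ler0n// lerDl.
pose gz (z : {ffun 'I_n -> 'I_(k.*2.+1)}) : E := grid m (boxpt z).
pose F z w := h (gz z) * pushforward W Psi (tent_at m (gz z)) w.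
have FC z : Cc (F z).
  have [Kz|/hK h0] := pselect (K (gz z)).
    by apply: CcZ; exact: (tents _ Kz).1.
  rewrite (_ : F z = fun=> 0); first exact: Cc_cst0.
  by apply/funext => w; rewrite /F h0 mul0r.
have split1 : `|L (pushforward W Psi h) - \sum_z L (F z)| <= e1 * ((B + 2) * L (bump_over G)).
  rewrite -(haar_sum hL)// -(haarB hL)//; last exact: Cc_sum.
  rewrite mulrA -(haarZ hL)//; apply: (haar_norm_le hL); [|exact: CcZ|].
    by apply: CcB => //; exact: Cc_sum.
  move=> w; rewrite /F /pushforward; case: ifPn => Ww; last first.
    rewrite big1 => [|z _]; last by rewrite mulr0.
    by rewrite subrr normr0 mulr_ge0 ?bump_over_ge0.
  rewrite inE in Ww.
  have [wG|Gw] := leP `|w| G.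
    apply: (@le_trans _ _ (e1 * (B + 2))); last first.
      by rewrite ler_peMr ?bump_over_ge1.
    apply: le_trans (close k Bk (Psi w)) _; rewrite ler_pM2l//.
    rewrite /bump_over ge_max addr_ge0//=; have := normr_ge0 (Psi w); lra.
  rewrite hK => [|KQ]; last first.
    move: Gw; rewrite ltNge => /negP; apply; rewrite -(PQ Ww).
    by apply: (GP (Psi w)); rewrite ?subrr ?normr0.
  rewrite big1 ?subr0 ?normr0 => [|z _].
    by rewrite mulr_ge0 ?bump_over_ge0.
  have [Kz|/hK->] := pselect (K (gz z)); last by rewrite mul0r.
  rewrite tent_at_out ?mulr0// leNgt; apply/negP => wz.
  move: Gw; rewrite ltNge => /negP; apply; rewrite -(PQ Ww).
  by apply: (GP (gz z)) => //; rewrite distrC (lt_trans wz).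
have split2 : `|\sum_z L (F z) - mesh_weight L m * lattice_sum (fun z => hd (grid m z))|
    <= e1 * (T * (L ah + 1)).
  have hdB y : B < `|y| -> hd y = 0 by move=> /hB; rewrite /hd => ->; rewrite mul0r.
  rewrite (grid_sum_box hdB Bk') mulr_sumr -sumrB.
  apply: le_trans (ler_norm_sum _ _ _) _.
  apply: (@le_trans _ _ (\sum_z e1 * T * (mesh_weight L m * ah (gz z)))).
    apply: ler_sum => z _; rewrite /F /hd /ah -/(gz z).
    have [Kz|/hK h0] := pselect (K (gz z)); last first.
      rewrite h0 normr0 !mul0r !mulr0 subr0 (_ : (fun w => _) = fun=> 0).
        by rewrite haar0// normr0.
      by apply/funext => w; rewrite mul0r.
    rewrite (haarZ hL); last exact: (tents _ Kz).1.
    have := (tents _ Kz).2; set X := L _; set J := `|\det _|; set mw := mesh_weight _ _.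
    move=> XJ; have -> : h (gz z) * X - mw * (h (gz z) * J) = h (gz z) * (X - J * mw).
      by ring.
    rewrite normrM (_ : _ * (mw * _) = `|h (gz z)| * (e1 * T * mw)); last by ring.
    by rewrite ler_wpM2l.
  rewrite -mulr_sumr -mulr_sumr.
  have ahB y : B < `|y| -> ah y = 0 by move=> /hB; rewrite /ah => ->; rewrite normr0.
  rewrite -(grid_sum_box ahB Bk') -mulrA ler_pM2l// ler_wpM2l//.
apply: le_trans (ler_distD (\sum_z L (F z)) _ _) _.
apply: le_trans (lerD split1 split2) _.
rewrite -mulrDr /e1 mulrAC ler_pdivrMr// ler_pM2l//.
by rewrite /cst lerDl.
Unshelve. all: by end_near. Qed.

End change_of_variables.

(** * Positive definite matrices and extension by zero *)

Section positive_definite.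
Local Open Scope classical_set_scope.
Local Open Scope ring_scope.
Context {R : realType} {n : nat}.

Lemma row_sqr_gt0 (v : 'rV[R]_n) : v != 0 -> 0 < (v *m v^T) 0 0.
Proof.
move=> v0; have [i vi] : exists i, v 0 i != 0.
  apply: contrapT => /forallNP H; move/eqP: v0; apply; apply/rowP => i.
  by rewrite mxE; have /negP := H i; rewrite negbK => /eqP.
rewrite mxE (bigD1 i)//= mxE ltr_wpDr//; last by rewrite -expr2 exprn_even_gt0.
by apply: sumr_ge0 => j _; rewrite mxE -expr2 sqr_ge0.
Qed.

(** The segment from the identity to G consists of positive definite, hence invertible, matrices, so
    the determinant cannot change sign along it. *)
Lemma posdef_det_gt0 (G : 'M[R]_n) :
  (forall v : 'rV[R]_n, v != 0 -> 0 < (v *m G *m v^T) 0 0) -> 0 < \det G.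
Proof.
move=> Gpos.
pose A (t : R) : 'M[R]_n := t *: G + (1 - t) *: 1%:M.
have A0 t : 0 <= t <= 1 -> \det (A t) != 0.
  move=> /andP[t0 t1]; apply/negP => /det0P[v v0 vA].
  have := congr1 (fun X : 'rV[R]_n => (X *m v^T) 0 0) vA.
  rewrite mul0mx [RHS]mxE /A mulmxDr mulmxDl -!scalemxAr -!scalemxAl mulmx1 !mxE => H.
  have p1 := Gpos v v0; have p2 := row_sqr_gt0 v0.
  rewrite !mxE in p1 p2 *; nra.
have Ac : {within `[0, 1], continuous (fun t => \det (A t))}.
  apply: continuous_subspaceT => t; apply: det_continuous => i j.
  rewrite (_ : (fun s => A s i j) =
    (fun s : R => s * G i j + (1 - s) * (1%:M : 'M[R]_n) i j)); last first.
    by apply/funext => s; rewrite !mxE.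
  apply: (@continuousD _ _ _ (fun s : R => s * G i j)
    (fun s : R => (1 - s) * (1%:M : 'M[R]_n) i j)); apply: continuousM.
  - exact: id.
  - exact: cst_continuous.
  - by apply: continuousB; [exact: cst_continuous|exact: id].
  - exact: cst_continuous.
have E1 : A 1 = G by rewrite /A subrr scale0r addr0 scale1r.
have E0 : A 0 = 1%:M by rewrite /A subr0 scale0r add0r scale1r.
rewrite ltNge; apply/negP => dG.
have [|t] := @IVT R (fun t => \det (A t)) 0 1 0 ler01 Ac.
  rewrite E1 E0 det1 ge_min le_max ler01 /= andbT dG orbT.
  by rewrite ?orbT.
by rewrite in_itv /= => /A0 /eqP.
Qed.

End positive_definite.

Section zero_extension.
Local Open Scope classical_set_scope.
Local Open Scope ring_scope.
Context {R : realType} {n : nat}.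
Local Notation E := 'rV[R]_n.
Implicit Types (U K : set E) (F : E -> R).

Definition ext U F y : R := if y \in U then F y else 0.

Lemma ext_in U F y : U y -> ext U F y = F y.
Proof. by move=> Uy; rewrite /ext mem_set. Qed.

Lemma ext_out U K F y : (forall y, U y -> ~ K y -> F y = 0) -> ~ K y -> ext U F y = 0.
Proof. by move=> F0 nK; rewrite /ext; case: ifP => //; rewrite inE => /F0; apply. Qed.

Lemma compact_closed_rV K : compact K -> closed K.
Proof. by apply: compact_closed; exact: norm_hausdorff. Qed.

Lemma compact_supported_Cc K F : compact K -> (forall y, ~ K y -> F y = 0) ->
  continuous F -> Cc F.
Proof.
move=> cK FK Fc; split => //.
have /ex_strict_bound_gt0[B B0 /= BP] : bounded_set K by exact: compact_bounded.
by exists B => w Bw; apply: FK => /BP; rewrite ltNge ltW.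
Qed.

Lemma ext_Cc U K F : open U -> compact K -> K `<=` U ->
  (forall y, U y -> {for y, continuous F}) ->
  (forall y, U y -> ~ K y -> F y = 0) -> Cc (ext U F).
Proof.
move=> oU cK KU Fc F0; have out y := @ext_out U K F y F0.
apply: (compact_supported_Cc cK) => // y.
have [Uy|nU] := pselect (U y).
  apply: eq_near_continuous (Fc y Uy).
  by apply: filterS (open_nbhs_nbhs (conj oU Uy)) => z Uz; rewrite ext_in.
have nK : (~` K) y by move=> /KU.
apply: (@eq_near_continuous _ _ (fun=> 0)); last exact: cst_continuous.
have oC : open (~` K) by apply: closed_openC; exact: compact_closed_rV.
by apply: filterS (open_nbhs_nbhs (conj oC nK)) => z /out.
Qed.

(** The open sets U and the complement of K cover R^n; the extension is F on the first and 0 on the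
    second. *)
Lemma ext_C1 U K F : open U -> compact K -> K `<=` U -> C1 U F ->
  (forall y, U y -> ~ K y -> F y = 0) -> C1 setT (ext U F).
Proof.
move=> oU cK KU FC F0; have out y := @ext_out U K F y F0.
have oC : open (~` K) by apply: closed_openC; exact: compact_closed_rV.
apply: (@C1_sub _ _ _ (U `|` ~` K)).
  by move=> y _; have [/KU|] := pselect (K y); [left|right].
apply: C1U; first by apply: C1_eq FC => // y Uy; rewrite ext_in.
by apply: (@C1_eq _ _ _ (fun=> 0)) => //; [move=> y /out->|exact: C1_cst].
Qed.

End zero_extension.

(** * Functions on manifolds *)

Section charts.
Local Open Scope classical_set_scope.
Local Open Scope ring_scope.
Context {R : realType} {n : nat} {M : smoothManifold R n}.
Local Notation E := 'rV[R]_n.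
Implicit Types (a b c : chart R n M) (x : M) (y : E) (u phi : M -> R).

Lemma open_continuousP (T S : topologicalType) (A : set T) (f : T -> S) :
  open A -> {within A, continuous f} -> forall x : T, A x -> {for x, continuous f}.
Proof.
move=> oA; rewrite continuous_open_subspace// => fc x Ax.
by apply: fc; rewrite inE.
Qed.

Lemma open_dom a : atlas a -> open (chart_dom a).
Proof. by move=> /atlas_chart[]. Qed.

Lemma open_img a : atlas a -> open (chart_img a).
Proof. by move=> /atlas_chart[]. Qed.

Lemma coordK a x : atlas a -> chart_dom a x -> param a (coord a x) = x.
Proof. by move=> /atlas_chart[_ _ + _ _] => /[apply]. Qed.

Lemma coord_img a x : chart_dom a x -> chart_img a (coord a x).
Proof. by exists x. Qed.

Lemma param_dom a y : atlas a -> chart_img a y -> chart_dom a (param a y).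
Proof. by move=> aM [x ax <-]; rewrite coordK. Qed.

Lemma paramK a y : atlas a -> chart_img a y -> coord a (param a y) = y.
Proof. by move=> aM [x ax <-]; rewrite coordK. Qed.

Lemma coord_continuous_at a x : atlas a -> chart_dom a x -> {for x, continuous (coord a)}.
Proof. by move=> /atlas_chart[od _ _ + _] => /(open_continuousP od); apply. Qed.

Lemma param_continuous_at a y : atlas a -> chart_img a y -> {for y, continuous (param a)}.
Proof. by move=> /atlas_chart[_ oi _ _] => /(open_continuousP oi); apply. Qed.

Definition overlap a b : set E := coord a @` (chart_dom a `&` chart_dom b).

Lemma overlapE a b y : atlas a -> overlap a b y <->
  chart_img a y /\ chart_dom b (param a y).
Proof.
move=> aM; split => [[x [ax bx] <-]|[ay by_]].
  by split; [exact: coord_img|rewrite coordK].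
by exists (param a y); [split => //; exact: param_dom|exact: paramK].
Qed.

Lemma open_param_preimage a (O : set M) : atlas a -> open O ->
  open (chart_img a `&` param a @^-1` O).
Proof.
move=> aM oO; rewrite openE => y [ay Oy]; apply: filterI.
  by apply: open_nbhs_nbhs; split => //; exact: open_img.
by apply: (param_continuous_at aM ay); exact: open_nbhs_nbhs.
Qed.

Lemma overlap_open a b : atlas a -> atlas b -> open (overlap a b).
Proof.
move=> aM bM; have := open_param_preimage aM (open_dom bM); congr open.
by apply/seteqP; split => y /(overlapE _ _ aM).
Qed.

Lemma transition_overlap a b y : atlas a -> overlap a b y ->
  overlap b a (transition a b y).
Proof.
move=> aM [x [ax bx] <-]; rewrite /transition coordK//.
by exists x.
Qed.

Lemma transitionK a b y : atlas a -> atlas b -> overlap a b y ->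
  transition b a (transition a b y) = y.
Proof. by move=> aM bM [x [ax bx] <-]; rewrite /transition !coordK. Qed.

Lemma transition_C1 a b : atlas a -> atlas b -> C1_map (overlap a b) (transition a b).
Proof. by move=> aM bM k; apply: smooth_C1; exact: atlas_smooth. Qed.

Lemma param_transition a b y : atlas a -> atlas b -> overlap a b y ->
  param b (transition a b y) = param a y.
Proof. by move=> aM bM [x [ax bx] <-]; rewrite /transition !coordK. Qed.

Definition pull a u : E -> R := fun y => u (param a y).

Lemma continuous_pull a u y : atlas a -> chart_img a y -> continuous u ->
  {for y, continuous (pull a u)}.
Proof.
move=> aM ay uc; apply: continuous_comp; first exact: param_continuous_at.
exact: uc.
Qed.

Lemma continuous_from_charts u :
  (forall a, atlas a -> forall y, chart_img a y -> {for y, continuous (pull a u)}) ->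
  continuous u.
Proof.
move=> H x; have [a aM ax] := atlas_cover x.
apply: (@eq_near_continuous _ _ (pull a u \o coord a)).
  apply: filterS (open_nbhs_nbhs (conj (open_dom aM) ax)) => z az.
  by rewrite /pull /= coordK.
apply: continuous_comp; first exact: coord_continuous_at.
by apply: H => //; exact: coord_img.
Qed.

Definition C1_fun phi := forall a, atlas a -> C1 (chart_img a) (pull a phi).

Lemma C1_fun_continuous phi : C1_fun phi -> continuous phi.
Proof.
move=> pC; apply: continuous_from_charts => a aM y ay.
by have [] := pC a aM y ay.
Qed.

Lemma compact_closed_M (K : set M) : compact K -> closed K.
Proof. by apply: compact_closed; exact: manifold_hausdorff. Qed.

Lemma compact_coord a (K : set M) : atlas a -> compact K -> K `<=` chart_dom a ->
  compact (coord a @` K).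
Proof.
move=> aM cK Ka; apply: continuous_compact => //.
by apply: continuous_in_subspaceT => x; rewrite inE => /Ka; exact: coord_continuous_at.
Qed.

End charts.

(** * Riemannian volume and inner product of gradients in charts *)

Section volume.
Local Open Scope classical_set_scope.
Local Open Scope ring_scope.
Context {R : realType} {n : nat} {M : smoothManifold R n} (g : riemannianMetric M).
Local Notation E := 'rV[R]_n.
Implicit Types (a b c : chart R n M) (x : M) (y : E) (u phi psi : M -> R).

Lemma metric_det_gt0 a y : atlas a -> chart_img a y -> 0 < \det (g a y).
Proof. by move=> aM ay; apply: posdef_det_gt0 => v; exact: metric_posdef. Qed.

Lemma metric_unit a y : atlas a -> chart_img a y -> g a y \in unitmx.
Proof. by move=> aM ay; rewrite unitmxE unitfE gt_eqF// metric_det_gt0. Qed.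

Lemma metric_C1 a i j : atlas a -> C1 (chart_img a) (fun y => g a y i j).
Proof. by move=> aM; apply: smooth_C1; exact: metric_smooth. Qed.

Lemma det_C1 (U : set E) (m : nat) (A : E -> 'M[R]_m) : open U ->
  (forall i j, C1 U (fun y => A y i j)) -> C1 U (fun y => \det (A y)).
Proof.
move=> oU AC; apply: C1_sum => // s; apply: C1M => //; first exact: C1_cst.
exact: C1_prod.
Qed.

Definition vol a y := Num.sqrt (\det (g a y)).

Lemma vol_gt0 a y : atlas a -> chart_img a y -> 0 < vol a y.
Proof. by move=> aM ay; rewrite sqrtr_gt0 metric_det_gt0. Qed.

Lemma vol_C1 a : atlas a -> C1 (chart_img a) (vol a).
Proof.
move=> aM; have oa := open_img aM.
apply: C1_sqrt => //; last by move=> y; exact: metric_det_gt0.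
by apply: det_C1 => // i j; exact: metric_C1.
Qed.

(** Cramer's rule writes each entry as a cofactor divided by the determinant. *)
Lemma invmx_C1 a i j : atlas a -> C1 (chart_img a) (fun y => invmx (g a y) i j).
Proof.
move=> aM; have oa := open_img aM.
have dC : C1 (chart_img a) (fun y => \det (g a y)).
  by apply: det_C1 => // k l; exact: metric_C1.
apply: (@C1_eq _ _ _ (fun y => (\det (g a y))^-1 *
    ((-1) ^+ (j + i) * \det (row' j (col' i (g a y))))) _ oa).
  by move=> y ay; rewrite /invmx metric_unit// !mxE.
apply: (C1M oa).
  by apply: (C1V oa dC) => y ay; rewrite gt_eqF// metric_det_gt0.
apply: (C1M oa (C1_cst _)); apply: (det_C1 oa) => k l.
by apply: (C1_eq oa _ (metric_C1 (lift j k) (lift i l) aM)) => y _; rewrite !mxE.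
Qed.

Lemma transition_jacobianE a b y : transition_jacobian a b y = (jac (transition a b) y)^T.
Proof. by apply/matrixP => k i; rewrite !mxE. Qed.

Lemma metric_change a b y : atlas a -> atlas b -> overlap a b y ->
  g a y = jac (transition a b) y *m g b (transition a b y) *m (jac (transition a b) y)^T.
Proof.
move=> aM bM [x [ax bx] <-]; rewrite {1}(metric_transform g aM bM ax bx).
by rewrite transition_jacobianE trmxK /transition coordK.
Qed.

(** The determinant of the transformation law contains the squared Jacobian determinant, whose
    square root is exactly the factor in [haar_change_of_variables]. *)
Lemma vol_change a b y : atlas a -> atlas b -> overlap a b y ->
  vol a y = `|\det (jac (transition a b) y)| * vol b (transition a b y).
Proof.
move=> aM bM yab; have yba := transition_overlap aM yab.
have [bt _] := (overlapE _ _ bM).1 yba.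
rewrite /vol (metric_change aM bM yab) !det_mulmx det_tr mulrAC -expr2 sqrtrM ?sqr_ge0//.
by rewrite sqrtr_sqr.
Qed.

(* pairing is the chart expression g^ij d_i phi d_j psi of <grad phi, grad psi>. *)
Definition dvec a phi y : E := \row_i partial i (pull a phi) y.

Definition pairing a phi psi y : R :=
  (dvec a phi y *m invmx (g a y) *m (dvec a psi y)^T) 0 0.

Lemma dvec_change a b phi y : atlas a -> atlas b -> overlap a b y -> C1_fun phi ->
  dvec a phi y = dvec b phi (transition a b y) *m (jac (transition a b) y)^T.
Proof.
move=> aM bM yab pC; apply/rowP => i; rewrite !mxE.
have oab := overlap_open aM bM.
have [tb _] := (overlapE _ _ bM).1 (transition_overlap aM yab).
have H := partial_comp i oab (open_img bM) (transition_C1 aM bM) (pC b bM) yab tb.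
rewrite (@near_partial _ _ i _ (pull b phi \o transition a b)).
  have := H => /@derive_val; rewrite /partial => ->.
  by apply: eq_bigr => k _; rewrite !mxE.
apply: filterS (open_nbhs_nbhs (conj oab yab)) => z zab.
by rewrite /pull /= param_transition.
Qed.

Lemma pairing_change a b phi psi y : atlas a -> atlas b -> overlap a b y ->
  C1_fun phi -> C1_fun psi -> pairing a phi psi y = pairing b phi psi (transition a b y).
Proof.
move=> aM bM yab pC qC; rewrite /pairing (dvec_change aM bM yab pC) (dvec_change aM bM yab qC).
have [ya _] := (overlapE _ _ aM).1 yab.
have [tb _] := (overlapE _ _ bM).1 (transition_overlap aM yab).
have gu := metric_unit aM ya; have gbu := metric_unit bM tb.
move: gu; rewrite (metric_change aM bM yab); set A := jac _ _; set G := g b _.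
rewrite !unitmx_mul unitmx_tr => /andP[/andP[Au _] _].
have ATu : A^T \in unitmx by rewrite unitmx_tr.
rewrite trmx_mul trmxK; congr (fun_of_matrix _ _ _).
have -> : invmx (A *m G *m A^T) = invmx A^T *m invmx G *m invmx A.
  apply: (can_inj (mulmxK (_ : A *m G *m A^T \in unitmx))); first by rewrite !unitmx_mul Au gbu.
  rewrite mulVmx; last by rewrite !unitmx_mul Au gbu.
  by rewrite !mulmxA mulmxKV// mulmxKV// mulVmx.
by rewrite !mulmxA mulmxKV// mulmxK//.
Qed.

Lemma chart_at_ex x : exists a, atlas a /\ chart_dom a x.
Proof. by have [a] := atlas_cover x; exists a. Qed.

Definition chart_at x := projT1 (cid (chart_at_ex x)).

Lemma chart_at_atlas x : atlas (chart_at x).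
Proof. by rewrite /chart_at; case: cid => a []. Qed.

Lemma chart_at_dom x : chart_dom (chart_at x) x.
Proof. by rewrite /chart_at; case: cid => a []. Qed.

(** Choosing a chart at each point makes the inner product a global function; [grad_dotE] recovers
    its expression in any chart when both arguments are C^1. *)
Definition grad_dot phi psi x := pairing (chart_at x) phi psi (coord (chart_at x) x).

Lemma grad_dotE a phi psi y : atlas a -> chart_img a y -> C1_fun phi -> C1_fun psi ->
  grad_dot phi psi (param a y) = pairing a phi psi y.
Proof.
move=> aM ay pC qC; rewrite /grad_dot.
set x := param a y; have bM := chart_at_atlas x; have bx := chart_at_dom x.
have yab : overlap a (chart_at x) y by apply/overlapE.
by rewrite (pairing_change aM bM yab pC qC).
Qed.

Variables (L : (E -> R) -> R) (hL : haar L).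

(** The Riemannian integral of a function supported in the chart; [ext] discards the meaningless
    values of [param] outside the chart image. *)
Definition chart_int a u := L (ext (chart_img a) (fun y => u (param a y) * vol a y)).

Section compact_in_chart.
Variables (a : chart R n M) (K : set M).
Hypotheses (aM : atlas a) (cK : compact K) (Ka : K `<=` chart_dom a).

Lemma chart_int_Cc u : continuous u -> (forall x, ~ K x -> u x = 0) ->
  Cc (ext (chart_img a) (fun y => u (param a y) * vol a y)).
Proof.
move=> uc uK; apply: (@ext_Cc _ _ _ (coord a @` K)).
- exact: open_img.
- exact: compact_coord.
- by move=> _ [x /Ka ax <-]; exact: coord_img.
- move=> y ay; apply: continuousM; first exact: continuous_pull.
  by have [] := vol_C1 aM ay.
- move=> y ay yK; rewrite uK ?mul0r// => Ky; apply: yK.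
  by exists (param a y) => //; exact: paramK.
Qed.

Lemma chart_intD u v : continuous u -> continuous v ->
  (forall x, ~ K x -> u x = 0) -> (forall x, ~ K x -> v x = 0) ->
  chart_int a (fun x => u x + v x) = chart_int a u + chart_int a v.
Proof.
move=> uc vc uK vK; rewrite /chart_int -(haarD hL); try exact: chart_int_Cc.
congr L; apply/funext => y; rewrite /ext; case: ifP => _; last by rewrite addr0.
by rewrite mulrDl.
Qed.

Lemma chart_intZ (t : R) u : continuous u -> (forall x, ~ K x -> u x = 0) ->
  chart_int a (fun x => t * u x) = t * chart_int a u.
Proof.
move=> uc uK; rewrite /chart_int -(haarZ hL); last exact: chart_int_Cc.
congr L; apply/funext => y; rewrite /ext; case: ifP => _; last by rewrite mulr0.
by rewrite mulrA.
Qed.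

Lemma chart_int_ge0 u : continuous u -> (forall x, ~ K x -> u x = 0) ->
  (forall x, 0 <= u x) -> 0 <= chart_int a u.
Proof.
move=> uc uK u0; apply: (haar_ge0 hL); first exact: chart_int_Cc.
by move=> y; rewrite /ext; case: ifP => // _; rewrite mulr_ge0 ?sqrtr_ge0.
Qed.

Lemma chart_int_gt0 u x : continuous u -> (forall x, ~ K x -> u x = 0) ->
  (forall x, 0 <= u x) -> 0 < u x -> 0 < chart_int a u.
Proof.
move=> uc uK u0 ux; have Kx : K x by apply: contrapT => /uK ux0; rewrite ux0 ltxx in ux.
have ax := Ka Kx; have ay := coord_img ax.
apply: (haar_gt0 hL (chart_int_Cc uc uK) (y0 := coord a x)).
  by move=> y; rewrite /ext; case: ifP => // _; rewrite mulr_ge0 ?sqrtr_ge0.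
by rewrite ext_in// coordK// mulr_gt0// vol_gt0.
Qed.

Lemma chart_int_change b u : atlas b -> K `<=` chart_dom b ->
  continuous u -> (forall x, ~ K x -> u x = 0) -> chart_int a u = chart_int b u.
Proof.
move=> bM Kb uc uK.
have oab := overlap_open aM bM; have oba := overlap_open bM aM.
(* The density of the chart b is read in the coordinates of a: times the Jacobian determinant it
   becomes [vol g a], and its pushforward is the integrand of b. *)
pose h := ext (overlap a b) (fun y => u (param a y) * vol b (transition a b y)).
have tK : coord a @` K `<=` overlap a b.
  by move=> _ [x Kx <-]; exists x => //; split; [exact: Ka|exact: Kb].
have h0 y : overlap a b y -> ~ (coord a @` K) y ->
    u (param a y) * vol b (transition a b y) = 0.
  move=> yab yK; rewrite uK ?mul0r// => Ky; apply: yK; exists (param a y) => //.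
  by have [ay _] := (overlapE _ _ aM).1 yab; exact: paramK.
have cKa := compact_coord aM cK Ka.
have hC : Cc h.
  apply: (@ext_Cc _ _ _ (coord a @` K)) => // y yab.
  have [ay _] := (overlapE _ _ aM).1 yab.
  have [tb _] := (overlapE _ _ bM).1 (transition_overlap aM yab).
  apply: continuousM; first exact: continuous_pull.
  apply: continuous_comp; first exact: (C1_map_continuous oab (transition_C1 aM bM)).
  by have [] := vol_C1 bM tb.
have hK y : ~ (coord a @` K) y -> h y = 0 by exact: ext_out.
have [_ _ H] := haar_change_of_variables hL oab oba (transition_C1 aM bM)
  (transition_C1 bM aM) (fun y => @transition_overlap _ _ _ a b y aM)
  (fun y => @transitionK _ _ _ a b y aM bM) (fun y => @transitionK _ _ _ b a y bM aM)
  cKa tK hC.1 hK.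
have -> : chart_int a u = L (fun y => h y * `|\det (jac (transition a b) y)|).
  congr L; apply/funext => y; rewrite /h /ext.
  have [yab|nab] := pselect (overlap a b y).
    have [ay _] := (overlapE _ _ aM).1 yab.
    by rewrite !mem_set// (vol_change aM bM yab) -!mulrA [_ * vol _ _]mulrC.
  rewrite (memNset nab) mul0r; case: ifP => //; rewrite inE => ay.
  rewrite uK ?mul0r// => /Kb bx; apply: nab; exact/overlapE.
rewrite -H; congr L; apply/funext => w; rewrite /pushforward /ext.
have [wba|nba] := pselect (overlap b a w).
  have [bw _] := (overlapE _ _ bM).1 wba.
  rewrite !mem_set// /h ext_in; last exact: transition_overlap.
  by rewrite param_transition// transitionK.
rewrite (memNset nba); case: ifP => //; rewrite inE => bw.
by rewrite uK ?mul0r// => /Ka ax; apply: nba; exact/overlapE.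
Qed.

End compact_in_chart.

End volume.

(** * Green's formula *)

Section bump_functions.
Local Open Scope classical_set_scope.
Local Open Scope ring_scope.
Context {R : realType}.

Lemma is_derive_quadratic_error (s : R -> R) (x d : R) :
  (forall h, `|s (h + x) - s x - d * h| <= h ^+ 2) -> is_derive x 1 s d.
Proof.
move=> sd.
have H : (h^-1 *: (s (h *: 1 + x) - s x) @[h --> 0^']) --> d.
  apply/cvgrPdist_le => /= e e0; near=> h.
  have h0 : h != 0 by near: h; exact: nbhs_dnbhs_neq.
  have he : `|h| < e.
    near: h; apply: nbhs_dnbhs; have : nbhs (0 : R) (ball (0 : R) e) by exact: nbhsx_ballx.
    by apply: filterS => z; rewrite -ball_normE /= sub0r normrN.
  have -> : d - h^-1 *: (s (h *: 1 + x) - s x) = - (h^-1 * (s (h + x) - s x - d * h)).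
    by rewrite [h *: 1]mulr1 -[_ *: _]/(_ * _); field.
  rewrite normrN normrM normfV ler_pdivrMl ?normr_gt0//.
  apply: le_trans (sd h) _; rewrite -normr_id -real_normK ?num_real// normr_id expr2.
  by rewrite ler_pM2l ?normr_gt0// ltW.
apply: DeriveDef; first by apply/cvg_ex; exists d.
by apply: cvg_lim.
Unshelve. all: by end_near. Qed.

(** The squared positive part is C^1 with an elementary derivative, which is all the regularity that
    the partition of unity needs. *)
Lemma pospart_sqr_derive (x : R) :
  is_derive x 1 (fun t => Num.max 0 t ^+ 2) (2 * Num.max 0 x).
Proof.
apply: is_derive_quadratic_error => h; rewrite ler_norml.
by case: (leP 0 x) => x0; case: (leP 0 (h + x)) => hx; apply/andP; split; nra.
Qed.

Lemma pospart_sqr_derive_continuous (x : R) :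
  {for x, continuous (fun t : R => 2 * Num.max 0 t)}.
Proof.
apply: (@continuousM R R (fun=> 2 : R) (fun t : R => Num.max 0 t) x); first exact: cst_continuous.
exact: (@continuous_max0 R R id).
Qed.

Context {n : nat}.
Implicit Types (p y : 'rV[R]_n) (r : R).

(** It is positive only inside the Euclidean ball of radius r, which lies in the sup norm ball used
    for supports. *)
Definition cap p r y : R := 1 - \sum_i ((y 0 i - p 0 i) / r) ^+ 2.

Definition smooth_bump p r y : R := Num.max 0 (cap p r y) ^+ 2.

Lemma smooth_bump_ge0 p r y : 0 <= smooth_bump p r y.
Proof. exact: sqr_ge0. Qed.

Lemma smooth_bump_center p r : 0 < smooth_bump p r p.
Proof.
rewrite /smooth_bump /cap big1 => [|i _]; last by rewrite subrr mul0r expr0n.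
by rewrite subr0 max_r ?ler01// expr1n ltr01.
Qed.

Lemma smooth_bump_out p r y : 0 < r -> r < `|p - y| -> smooth_bump p r y = 0.
Proof.
move=> r0 ry; case: (rV_norm_gt (ltW r0) ry) => i; rewrite !mxE distrC => ri.
rewrite /smooth_bump max_l ?expr0n// /cap subr_le0 (bigD1 i)//=.
apply: ler_wpDr; first by apply: sumr_ge0 => j _; exact: sqr_ge0.
rewrite -real_normK ?num_real// normrM normfV (gtr0_norm r0).
have h1 : 1 <= `|y 0 i - p 0 i| / r by rewrite ler_pdivlMr// mul1r ltW.
exact: exprn_ege1.
Qed.

Lemma coord_C1 (U : set 'rV[R]_n) (i : 'I_n) : open U -> C1 U (fun y => y 0 i).
Proof.
move=> oU; apply: (@C1_by_formula _ _ _ _ (fun j _ => (j == i)%:R) oU).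
- by move=> y _; exact: coord_continuous.
- move=> y j _; rewrite -(partial_coord j i y); apply/derivableP.
  by apply: diff_derivable; exact: differentiable_coord.
- by move=> y j _; exact: cst_continuous.
Qed.

Lemma smooth_bump_C1 p r : C1 setT (smooth_bump p r).
Proof.
have oT : open [set: 'rV[R]_n] by exact: openT.
have capC : C1 setT (cap p r).
  apply: (C1D oT (C1_cst _)).
  apply: (@C1_eq _ _ _ (fun y => (-1) * \sum_i ((y 0 i - p 0 i) / r) ^+ 2) _ oT).
    by move=> y _; rewrite mulN1r.
  apply: (C1M oT (C1_cst _)); apply: (C1_sum _ oT) => i.
  have lin : C1 setT (fun y : 'rV[R]_n => (y 0 i - p 0 i) / r).
    by apply: (C1M oT) (C1_cst _); apply: (C1D oT) (C1_cst _); exact: coord_C1.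
  by under eq_fun do rewrite expr2; exact: (C1M oT lin lin).
apply: (@C1_comp1 _ _ _ setT (fun t => Num.max 0 t ^+ 2) (fun t => 2 * Num.max 0 t) _ oT capC).
- by [].
- by move=> x _; exact: pospart_sqr_derive.
- by move=> x _; exact: pospart_sqr_derive_continuous.
Qed.

End bump_functions.

(** * A C^1 partition of unity *)

Section partition_of_unity.
Local Open Scope classical_set_scope.
Local Open Scope ring_scope.
Context {R : realType} {n : nat} {M : smoothManifold R n}.
Local Notation E := 'rV[R]_n.
Implicit Types (a b c : chart R n M) (x k : M) (y : E) (u phi psi : M -> R).

Lemma C1_funD phi psi : C1_fun phi -> C1_fun psi -> C1_fun (fun x => phi x + psi x).
Proof. by move=> pC qC a aM; exact: (C1D (open_img aM) (pC a aM) (qC a aM)). Qed.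

Lemma C1_funM phi psi : C1_fun phi -> C1_fun psi -> C1_fun (fun x => phi x * psi x).
Proof. by move=> pC qC a aM; exact: (C1M (open_img aM) (pC a aM) (qC a aM)). Qed.

Lemma C1_fun_sum (I : Type) (r : seq I) (F : I -> M -> R) :
  (forall i, C1_fun (F i)) -> C1_fun (fun x => \sum_(i <- r) F i x).
Proof. by move=> FC a aM; exact: (C1_sum r (open_img aM) (fun i => FC i a aM)). Qed.

Lemma C1_funV phi : C1_fun phi -> (forall x, phi x != 0) -> C1_fun (fun x => (phi x)^-1).
Proof. by move=> pC p0 a aM; apply: (C1V (open_img aM) (pC a aM)) => y _; exact: p0. Qed.

Lemma radius_ex k : exists r, 0 < r /\
  (fun y => `|coord (chart_at k) k - y| <= r) `<=` chart_img (chart_at k).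
Proof.
have aM := chart_at_atlas k; have ak := chart_at_dom k.
have : nbhs (coord (chart_at k) k) (chart_img (chart_at k)).
  by apply: open_nbhs_nbhs; split; [exact: open_img|exact: coord_img].
(* An open ball of radius r fits in the chart image; halving makes the closed ball fit, and this
   ball is compact. *)
move=> /nbhs_ballP[r /= r0 rP]; exists (r / 2); split; first by rewrite divr_gt0.
move=> y ky; apply: rP; rewrite -ball_normE /=; apply: le_lt_trans ky _.
by rewrite ltr_pdivrMr// ltr_pMr// ltr1n.
Qed.

Definition radius k := projT1 (cid (radius_ex k)).

Lemma radius_gt0 k : 0 < radius k.
Proof. by rewrite /radius; case: cid => r []. Qed.

Lemma radius_img k y : `|coord (chart_at k) k - y| <= radius k -> chart_img (chart_at k) y.
Proof. by rewrite /radius; case: cid => r /= [_]; apply. Qed.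

Definition bump_supp k : set M :=
  param (chart_at k) @` [set y | `|coord (chart_at k) k - y| <= radius k].

Definition bump k x : R := if x \in chart_dom (chart_at k)
  then smooth_bump (coord (chart_at k) k) (radius k) (coord (chart_at k) x) else 0.

Lemma bump_supp_dom k : bump_supp k `<=` chart_dom (chart_at k).
Proof.
by move=> _ [y ky <-]; apply: param_dom; [exact: chart_at_atlas|exact: radius_img].
Qed.

Lemma bump_supp_compact k : compact (bump_supp k).
Proof.
apply: continuous_compact; last exact: compact_norm_ball.
apply: continuous_in_subspaceT => y; rewrite inE => ky.
by apply: param_continuous_at; [exact: chart_at_atlas|exact: radius_img].
Qed.

Lemma bump_out k x : ~ bump_supp k x -> bump k x = 0.
Proof.
move=> kx; rewrite /bump; case: ifP => //; rewrite inE => ax.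
apply: smooth_bump_out; first exact: radius_gt0.
rewrite ltNge; apply/negP => H; apply: kx.
by exists (coord (chart_at k) x) => //; apply: coordK => //; exact: chart_at_atlas.
Qed.

Lemma bump_ge0 k x : 0 <= bump k x.
Proof. by rewrite /bump; case: ifP => // _; exact: smooth_bump_ge0. Qed.

Lemma bump_center k : 0 < bump k k.
Proof. by rewrite /bump mem_set ?smooth_bump_center//; exact: chart_at_dom. Qed.

(** In another chart c the bump is a C^1 function composed with a transition map on the overlap, and
    0 off [bump_supp k], which is compact and hence closed because M is Hausdorff. These two open
    sets cover the image of c. *)
Lemma bump_C1 k : C1_fun (bump k).
Proof.
move=> c cM; set a := chart_at k; have aM : atlas a := chart_at_atlas k.
have oca := overlap_open cM aM.
have oK : open (~` bump_supp k).
  by apply: closed_openC; apply: compact_closed_M; exact: bump_supp_compact.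
have oc2 := open_param_preimage cM oK.
apply: (@C1_sub _ _ _ (overlap c a `|` (chart_img c `&` param c @^-1` (~` bump_supp k)))).
  move=> y cy; have [ky|nk] := pselect (bump_supp k (param c y)); [left|right => //].
  by apply/overlapE => //; split => //; exact: bump_supp_dom.
apply: C1U.
  apply: (@C1_eq _ _ _ (smooth_bump (coord a k) (radius k) \o transition c a) _ oca).
    move=> y /(overlapE _ _ cM)[cy ay].
    by rewrite /pull /bump -/a mem_set.
  by apply: (@C1_comp _ _ _ _ setT) => //; [exact: openT|exact: transition_C1|exact: smooth_bump_C1].
apply: (@C1_eq _ _ _ (fun=> 0) _ oc2); last exact: C1_cst.
by move=> y [_ /= /bump_out]; rewrite /pull => ->.
Qed.

Hypothesis cM : closed_manifold M.

Lemma finite_bump_cover : exists s : seq M, forall x, 0 < \sum_(k <- s) bump k x.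
Proof.
have bc k : continuous (bump k) by apply: C1_fun_continuous; exact: bump_C1.
have [[x0 _]|M0] := pselect (exists x : M, True); last first.
  by exists [::] => x; case: M0; exists x.
(* Covering compactness is stated for pointed spaces, whence the separate treatment of the empty
   manifold, where the empty list serves. *)
pose N : ptopologicalType := HB.pack_for ptopologicalType M (isPointed.Build M x0).
have : @cover_compact N [set: N] by rewrite -compact_cover; exact: cM.
move=> /(_ M setT (fun k => bump k @^-1` [set t | 0 < t])) [].
- by move=> k _; apply: open_comp => [x _|]; [exact: bc|exact: open_gt].
- by move=> x _; exists x => //=; exact: bump_center.
move=> D _ Dcov; exists (finmap.enum_fset D) => x.
have [k kD kx] := Dcov x I.
have kD' : k \in finmap.enum_fset D by exact: kD.
rewrite (big_rem k)//= ltr_wpDr//; apply: sumr_ge0 => j _; exact: bump_ge0.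
Qed.

Lemma partition_of_unity : exists (s : seq M) (rho : M -> M -> R),
  [/\ forall k, C1_fun (rho k), forall k x, 0 <= rho k x,
      forall k x, ~ bump_supp k x -> rho k x = 0 &
      forall x, \sum_(k <- s) rho k x = 1].
Proof.
have [s sP] := finite_bump_cover.
exists s, (fun k x => bump k x * (\sum_(j <- s) bump j x)^-1); split.
- move=> k; apply: C1_funM; first exact: bump_C1.
  apply: C1_funV; first by apply: C1_fun_sum => j; exact: bump_C1.
  by move=> x; rewrite gt_eqF.
- by move=> k x; rewrite mulr_ge0 ?bump_ge0// invr_ge0 ltW.
- by move=> k x /bump_out ->; rewrite mul0r.
- by move=> x; rewrite -mulr_suml mulfV// gt_eqF.
Qed.

End partition_of_unity.

(** * The divergence theorem, in one chart and globally *)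

Section green.
Local Open Scope classical_set_scope.
Local Open Scope ring_scope.
Context {R : realType} {n : nat} {M : smoothManifold R n} (g : riemannianMetric M).
Local Notation E := 'rV[R]_n.
Implicit Types (a b c : chart R n M) (x k : M) (y : E) (u phi psi h l : M -> R).

Definition rgrad a h y i : R := \sum_j invmx (g a y) i j * partial j (pull a h) y.

Definition lap a h y : R :=
  (vol g a y)^-1 * \sum_i partial i (fun z => vol g a z * rgrad a h z i) y.

Definition smooth_real h := forall a, atlas a -> smooth_on (chart_img a) (pull a h).

Lemma smooth_real_C1 h : smooth_real h -> C1_fun h.
Proof. by move=> hs a aM; apply: smooth_C1; exact: hs. Qed.

Lemma flux_C1 a h i : atlas a -> smooth_real h ->
  C1 (chart_img a) (fun y => vol g a y * rgrad a h y i).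
Proof.
move=> aM hs; have oa := open_img aM.
apply: (C1M oa (vol_C1 g aM)); apply: (C1_sum _ oa) => j.
by apply: (C1M oa (invmx_C1 g i j aM)); apply: smooth_partial_C1; exact: hs.
Qed.

Lemma metric_inv_sym a y : atlas a -> chart_img a y -> (invmx (g a y))^T = invmx (g a y).
Proof. by move=> aM ay; rewrite trmx_inv metric_sym. Qed.

Lemma pairing_rgrad a phi h y : atlas a -> chart_img a y ->
  pairing g a phi h y = \sum_i partial i (pull a phi) y * rgrad a h y i.
Proof.
move=> aM ay; rewrite /pairing -mulmxA mxE; apply: eq_bigr => i _; rewrite !mxE.
by congr (_ * _); apply: eq_bigr => j _; rewrite !mxE.
Qed.

Lemma pairing_continuous a phi psi y : atlas a -> chart_img a y ->
  C1_fun phi -> C1_fun psi -> {for y, continuous (pairing g a phi psi)}.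
Proof.
move=> aM ay pC qC.
rewrite (_ : pairing g a phi psi = fun z => \sum_i (\sum_j
    partial j (pull a phi) z * invmx (g a z) j i) * partial i (pull a psi) z).
  apply: continuous_sum => i; apply: continuousM.
    apply: continuous_sum => j; apply: continuousM.
      by have [_ _] := pC a aM y ay; exact.
    by have [] := invmx_C1 g j i aM ay.
  by have [_ _] := qC a aM y ay; exact.
apply/funext => z; rewrite /pairing mxE; apply: eq_bigr => i _; rewrite !mxE.
by congr (_ * _); apply: eq_bigr => j _; rewrite !mxE.
Qed.

Lemma grad_dot_continuous phi psi : C1_fun phi -> C1_fun psi ->
  continuous (grad_dot g phi psi).
Proof.
move=> pC qC; apply: continuous_from_charts => a aM y ay.
apply: eq_near_continuous (pairing_continuous aM ay pC qC).
apply: filterS (open_nbhs_nbhs (conj (open_img aM) ay)) => z az.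
by rewrite /pull grad_dotE.
Qed.

Lemma dvec_near a phi psi y : (\forall z \near y, pull a phi z = pull a psi z) ->
  dvec a phi y = dvec a psi y.
Proof. by move=> H; apply/rowP => i; rewrite !mxE; exact: near_partial. Qed.

Lemma grad_dot_out (K : set M) phi psi x : compact K -> (forall z, ~ K z -> phi z = 0) ->
  ~ K x -> grad_dot g phi psi x = 0.
Proof.
move=> cK pK xK; rewrite /grad_dot /pairing; set a := chart_at x.
have aM : atlas a := chart_at_atlas x; have ax : chart_dom a x := chart_at_dom x.
have oK : open (~` K) by apply: closed_openC; exact: compact_closed_M.
rewrite (@dvec_near _ _ (fun=> 0)).
  rewrite (_ : dvec a (fun=> 0) _ = 0) ?mul0mx ?mxE//.
  by apply/rowP => i; rewrite !mxE /partial /pull derive_cst.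
have oaK := open_param_preimage aM oK.
have : (chart_img a `&` param a @^-1` (~` K)) (coord a x).
  by split; [exact: coord_img|rewrite /= coordK].
move=> H; apply: filterS (open_nbhs_nbhs (conj oaK H)) => z [_ /= zK].
by rewrite /pull pK.
Qed.

Lemma dvecM a phi psi y : atlas a -> chart_img a y -> C1_fun phi -> C1_fun psi ->
  dvec a (fun x => phi x * psi x) y =
    phi (param a y) *: dvec a psi y + psi (param a y) *: dvec a phi y.
Proof.
move=> aM ay pC qC; apply/rowP => i; rewrite !mxE.
exact: (partialM i (pC a aM) (qC a aM) ay).
Qed.

Lemma grad_dotMl phi psi h x : C1_fun phi -> C1_fun psi ->
  grad_dot g (fun x => phi x * psi x) h x =
    phi x * grad_dot g psi h x + psi x * grad_dot g phi h x.
Proof.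
move=> pC qC; rewrite /grad_dot /pairing; set a := chart_at x.
have aM : atlas a := chart_at_atlas x; have ax : chart_dom a x := chart_at_dom x.
rewrite (dvecM aM _ pC qC); last exact: coord_img.
by rewrite (coordK aM ax) !mulmxDl -!scalemxAl !mxE.
Qed.

Lemma grad_dot_suml (I : Type) (s : seq I) (F : I -> M -> R) h x :
  (forall i, C1_fun (F i)) ->
  \sum_(i <- s) grad_dot g (F i) h x = grad_dot g (fun x => \sum_(i <- s) F i x) h x.
Proof.
move=> FC; rewrite /grad_dot /pairing; set a := chart_at x.
have aM : atlas a := chart_at_atlas x; have ax : chart_dom a x := chart_at_dom x.
have ay := coord_img ax.
have -> : dvec a (fun x => \sum_(i <- s) F i x) (coord a x) =
    \sum_(i <- s) dvec a (F i) (coord a x).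
  elim: s => [|i s IH].
    rewrite big_nil; apply/rowP => j; rewrite !mxE /pull.
    by under eq_fun do rewrite big_nil; rewrite /partial derive_cst.
  rewrite big_cons -IH; apply/rowP => j; rewrite !mxE /pull.
  under eq_fun do rewrite big_cons.
  have sC : C1_fun (fun x => \sum_(i <- s) F i x) by exact: C1_fun_sum.
  have := is_deriveD (C1_is_derive j (FC i a aM) ay) (C1_is_derive j (sC a aM) ay).
  by move=> /@derive_val.
by rewrite mulmx_suml mulmx_suml summxE.
Qed.

Lemma grad_dot_cst (t : R) h x : grad_dot g (fun=> t) h x = 0.
Proof.
rewrite /grad_dot /pairing (_ : dvec _ _ _ = 0) ?mul0mx ?mxE//.
by apply/rowP => i; rewrite !mxE /partial /pull derive_cst.
Qed.

Variables (L : (E -> R) -> R) (hL : haar L).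
Local Notation chart_int := (chart_int g L).

(** The left-hand side integrates the divergence of the compactly supported field [phi grad h].
    Multiplied by the density it is a sum of partial derivatives of C^1 functions of compact
    support, each of integral 0 by [haar_partial]. *)
Lemma chart_green a (K : set M) phi h l : atlas a -> compact K -> K `<=` chart_dom a ->
  C1_fun phi -> (forall x, ~ K x -> phi x = 0) -> smooth_real h ->
  (forall y, chart_img a y -> lap a h y = l (param a y)) ->
  chart_int a (fun x => phi x * l x + grad_dot g phi h x) = 0.
Proof.
move=> aM cK Ka pC pK hs hl; have oa := open_img aM.
have cKa := compact_coord aM cK Ka.
have Kimg : coord a @` K `<=` chart_img a.
  by move=> _ [x /Ka ax <-]; exact: coord_img.
pose Y i y := vol g a y * rgrad a h y i.
pose F i := ext (chart_img a) (fun y => pull a phi y * Y i y).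
have pK' y : chart_img a y -> ~ (coord a @` K) y -> pull a phi y = 0.
  move=> ay yK; apply: pK => Ky; apply: yK; exists (param a y) => //; exact: paramK.
have F0 i y : chart_img a y -> ~ (coord a @` K) y -> pull a phi y * Y i y = 0.
  by move=> ay yK; rewrite pK' ?mul0r.
have YC i : C1 (chart_img a) (Y i) by exact: flux_C1.
have pYC i : C1 (chart_img a) (fun y => pull a phi y * Y i y).
  exact: (C1M oa (pC a aM) (YC i)).
have FC i : C1 setT (F i) by exact: (ext_C1 oa cKa Kimg (pYC i) (F0 i)).
have FCc i : Cc (F i).
  apply: (ext_Cc oa cKa Kimg _ (F0 i)) => y ay.
  by have [] := pYC i y ay.
have : \sum_i L (partial i (F i)) = 0.
  by rewrite big1// => i _; exact: haar_partial.
rewrite -(haar_sum hL); last by move=> i; exact: Cc_partial.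
move=> <-; congr L; apply/funext => y; rewrite /ext.
case: ifPn => [|nay]; last first.
  (* Outside the chart image the integrand is 0 by convention; the partial derivatives agree because
     each [F i] vanishes on the whole open complement of the compact support. *)
  have yK : ~ (coord a @` K) y by move=> Ky; move/negP: nay; apply; rewrite inE; exact: Kimg.
  have oC : open (~` (coord a @` K)) by apply: closed_openC; exact: compact_closed_rV.
  rewrite big1// => i _; rewrite (@near_partial _ _ i _ (fun=> 0)).
    by rewrite /partial derive_cst.
  apply: filterS (open_nbhs_nbhs (conj oC yK)) => z zK.
  exact: (ext_out (F0 i)).
rewrite inE => ay.
have -> : \sum_i partial i (F i) y = \sum_i partial i (fun y => pull a phi y * Y i y) y.
  apply: eq_bigr => i _; apply: near_partial.
  by apply: filterS (open_nbhs_nbhs (conj oa ay)) => z az; rewrite /F ext_in.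
have -> : \sum_i partial i (fun y => pull a phi y * Y i y) y =
    \sum_i (pull a phi y * partial i (Y i) y + Y i y * partial i (pull a phi) y).
  by apply: eq_bigr => i _; exact: (partialM i (pC a aM) (YC i) ay).
rewrite big_split -mulr_sumr /= mulrDl.
have v0 := vol_gt0 g aM ay.
congr (_ + _).
  rewrite -(hl y ay) /lap -/(Y _) mulrAC -!mulrA; congr (_ * _).
  by rewrite mulrA mulfV ?mul1r// gt_eqF.
rewrite (grad_dotE g aM ay pC (smooth_real_C1 hs)) (pairing_rgrad _ _ aM ay) mulr_suml.
by apply: eq_bigr => i _; rewrite /Y mulrC mulrCA mulrC -mulrA mulrC.
Qed.

Hypothesis cM : closed_manifold M.

Lemma green_functional : exists I : (M -> R) -> R,
  [/\ forall u v, continuous u -> continuous v -> I (fun x => u x + v x) = I u + I v,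
      forall t u, continuous u -> I (fun x => t * u x) = t * I u,
      forall u, continuous u -> (forall x, 0 <= u x) -> 0 <= I u,
      forall u x, continuous u -> (forall x, 0 <= u x) -> 0 < u x -> 0 < I u &
      forall phi h l, C1_fun phi -> smooth_real h -> continuous l ->
        (forall a, atlas a -> forall y, chart_img a y -> lap a h y = l (param a y)) ->
        I (fun x => phi x * l x + grad_dot g phi h x) = 0].
Proof.
have [s [rho [rhoC rho0 rhoK rho1]]] := partition_of_unity cM.
have rc k : continuous (rho k) by exact: C1_fun_continuous.
have ac k : atlas (chart_at k) := chart_at_atlas k.
have cK := @bump_supp_compact R n M; have Kd := @bump_supp_dom R n M.
have ruc k u : continuous u -> continuous (fun x => rho k x * u x).
  by move=> uc x; apply: continuousM; [exact: rc|exact: uc].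
have ruK k u x : ~ bump_supp k x -> rho k x * u x = 0 by move=> /rhoK ->; rewrite mul0r.
pose Ik k u := chart_int (chart_at k) (fun x => rho k x * u x).
exists (fun u => \sum_(k <- s) Ik k u); split.
- move=> u v uc vc; rewrite -big_split; apply: eq_bigr => k _ /=.
  rewrite /Ik -(chart_intD g hL (ac k) (cK k) (Kd k) (ruc k u uc) (ruc k v vc) (ruK k u) (ruK k v)).
  by congr chart_int; apply/funext => x; rewrite mulrDr.
- move=> t u uc; rewrite mulr_sumr; apply: eq_bigr => k _ /=.
  rewrite /Ik -(chart_intZ g hL (ac k) (cK k) (Kd k) t (ruc k u uc) (ruK k u)).
  by congr chart_int; apply/funext => x; rewrite mulrCA.
- move=> u uc u0; apply: sumr_ge0 => k _.
  apply: (chart_int_ge0 g hL (ac k) (cK k) (Kd k) (ruc k u uc) (ruK k u)) => x.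
  by rewrite mulr_ge0.
- move=> u x uc u0 ux.
  have ge0 k : 0 <= Ik k u.
    apply: (chart_int_ge0 g hL (ac k) (cK k) (Kd k) (ruc k u uc) (ruK k u)) => z.
    by rewrite mulr_ge0.
  have [k ks kx] : exists2 k, k \in s & 0 < rho k x.
    apply: contrapT => H; have := rho1 x; rewrite big_seq big1 => [/eqP|k ks].
      by rewrite eq_sym oner_eq0.
    apply/eqP; rewrite eq_le rho0 andbT leNgt; apply/negP => kx; apply: H.
    by exists k.
  rewrite (big_rem k)//= ltr_wpDr//; first by apply: sumr_ge0 => j _; exact: ge0.
  apply: (chart_int_gt0 g hL (ac k) (cK k) (Kd k) (x := x) (ruc k u uc) (ruK k u)).
    by move=> z; rewrite mulr_ge0.
  by rewrite mulr_gt0.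
- move=> phi h l pC hs lc hl.
  have hC := smooth_real_C1 hs; have pc := C1_fun_continuous pC.
  have gc k : continuous (grad_dot g (rho k) h) := grad_dot_continuous (rhoC k) hC.
  have gphic : continuous (grad_dot g phi h) := grad_dot_continuous pC hC.
  pose w k x := phi x * grad_dot g (rho k) h x.
  have wc k : continuous (w k) by move=> x; apply: continuousM; [exact: pc|exact: gc].
  have wK k x : ~ bump_supp k x -> w k x = 0.
    by move=> xk; rewrite /w (grad_dot_out _ (cK k) (rhoK k) xk) mulr0.
  pose v x := phi x * l x + grad_dot g phi h x.
  have vc : continuous v.
    move=> x; apply: (@continuousD _ _ _ (fun x => phi x * l x)); last exact: gphic.
    by apply: continuousM; [exact: pc|exact: lc].
  (* [chart_green] for [rho k * phi]; the Leibniz rule isolates [w k]. *)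
  have step k : Ik k v = - chart_int (chart_at k) (w k).
    have rpC : C1_fun (fun x => rho k x * phi x) by exact: (C1_funM (rhoC k) pC).
    have rpK x : ~ bump_supp k x -> rho k x * phi x = 0 by exact: (ruK k phi x).
    have := chart_green (ac k) (cK k) (Kd k) rpC rpK hs (hl _ (ac k)).
    rewrite (_ : (fun x => _) = fun x => rho k x * v x + w k x).
      rewrite (chart_intD g hL (ac k) (cK k) (Kd k) (ruc k v vc) (wc k) (ruK k v) (wK k)).
      by move/eqP; rewrite addr_eq0 => /eqP.
    apply/funext => x; rewrite (grad_dotMl h x (rhoC k) pC) /v /w; ring.
  rewrite -/v; under eq_bigr do rewrite step.
  rewrite sumrN; apply/eqP; rewrite oppr_eq0; apply/eqP.
  have wsum (J : Type) (r : seq J) k (F : J -> M -> R) :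
      (forall j, continuous (F j)) -> (forall j x, ~ bump_supp k x -> F j x = 0) ->
      chart_int (chart_at k) (fun x => \sum_(j <- r) F j x) =
      \sum_(j <- r) chart_int (chart_at k) (F j).
    move=> Fc FK; elim: r => [|j r IH].
      rewrite big_nil; under eq_fun do rewrite big_nil.
      rewrite -[RHS](mul0r (chart_int (chart_at k) (fun x => rho k x * 0))).
      rewrite -(chart_intZ g hL (ac k) (cK k) (Kd k) 0 _ (ruK k (fun=> 0))).
        by congr chart_int; apply/funext => x; rewrite mul0r.
      by apply: ruc => x; exact: cst_continuous.
    rewrite big_cons -IH; under eq_fun do rewrite big_cons.
    rewrite (chart_intD g hL (ac k) (cK k) (Kd k)) //.
    - by move=> x; apply: continuous_sum => i; exact: Fc.
    - by move=> x; exact: FK.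
    - by move=> x xk; rewrite big1// => i _; rewrite FK.
  have expand k : chart_int (chart_at k) (w k) =
      \sum_(j <- s) chart_int (chart_at k) (fun x => rho j x * w k x).
    rewrite -wsum.
    - congr chart_int; apply/funext => x.
      by rewrite -mulr_suml rho1 mul1r.
    - by move=> j; exact: (ruc j _ (wc k)).
    - by move=> j x /wK ->; rewrite mulr0.
  under eq_bigr do rewrite expand.
  rewrite exchange_big big1// => j _ /=.
  (* The function is supported in the intersection of the two bump supports, a compact set lying in
     both charts. *)
  have swap k : chart_int (chart_at k) (fun x => rho j x * w k x) =
      chart_int (chart_at j) (fun x => rho j x * w k x).
    have cI : compact (bump_supp k `&` bump_supp j).
      apply: (subclosed_compact _ (cK k)); last exact: subIsetl.
      by apply: closedI; apply: compact_closed_M; exact: cK.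
    apply: (chart_int_change g hL (ac k) cI _ (ac j)).
    - by move=> x [/Kd].
    - by move=> x [_ /Kd].
    - exact: (ruc j _ (wc k)).
    - move=> x xI; have [xk|/wK->] := pselect (bump_supp k x); last by rewrite mulr0.
      by rewrite rhoK ?mul0r// => xj; apply: xI.
  under eq_bigr do rewrite swap.
  rewrite -wsum; last 2 first.
  - by move=> k; exact: (ruc j _ (wc k)).
  - by move=> k x /rhoK ->; rewrite mul0r.
  rewrite (_ : (fun x => _) = fun x => rho j x * 0).
    rewrite -[RHS](mul0r (chart_int (chart_at j) (fun x => rho j x * 0))).
    rewrite -(chart_intZ g hL (ac j) (cK j) (Kd j) 0 _ (ruK j (fun=> 0))).
      by congr chart_int; apply/funext => x; rewrite mul0r mulr0.
    by apply: ruc => x; exact: cst_continuous.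
  apply/funext => x; rewrite -mulr_sumr -mulr_sumr grad_dot_suml//.
  by rewrite (_ : (fun x => _) = fun=> 1) ?grad_dot_cst ?mulr0//; apply/funext.
Qed.

End green.

(** * Second-order analysis at a critical point *)

Section calculus_at_a_point.
Local Open Scope classical_set_scope.
Local Open Scope ring_scope.
Context {R : realType} {n : nat}.
Local Notation E := 'rV[R]_n.
Implicit Types (U : set E) (F G : E -> R) (y v h : E) (i j : 'I_n).

Lemma partial_shift i F w y : partial i (fun z => F (z + w)) y = partial i F (y + w).
Proof.
rewrite /partial /derive; set f := (X in lim (X @ _)); set k := (X in _ = lim (X @ _)).
by have -> : f = k by apply/funext => t; rewrite /f /k /= addrA.
Qed.

Lemma derivable_shift F w y v : derivable F (y + w) v -> derivable (fun z => F (z + w)) y v.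
Proof.
rewrite /derivable; set f := (X in cvg (X @ _)); set k := (X in _ -> cvg (X @ _)).
by have -> : f = k by apply/funext => t; rewrite /f /k /= addrA.
Qed.

Lemma delta_norm_le (t : R) i : `|t *: delta_mx 0 i : E| <= `|t|.
Proof.
apply: rV_norm_le => // j; rewrite !mxE normrM ler_piMr//.
by rewrite eqxx /=; case: (j == i); rewrite ?normr0 ?normr1.
Qed.

Lemma C1_partial_max U F y i : open U -> C1 U F -> U y ->
  (forall z, U z -> F z <= F y) -> partial i F y = 0.
Proof.
move=> oU FC Uy Fmax.
have /nbhs_ballP[r /= r0 rU] := open_nbhs_nbhs (conj oU Uy).
have line t : t \in `](- r), r[ -> U (y + t *: delta_mx 0 i).
  rewrite in_itv /= => tr; apply: rU; rewrite -ball_normE /= opprD addNKr normrN.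
  by apply: le_lt_trans (delta_norm_le t i) _; rewrite ltr_norml.
have Fd t : t \in `](- r), r[ -> is_derive t 1 (fun s : R => F (y + s *: delta_mx 0 i))
    (partial i F (y + t *: delta_mx 0 i)).
  by move=> /line /FC[_ Fd _]; exact: line_derive.
have r0' : 0 \in `](- r), r[ by rewrite in_itv /= oppr_lt0 r0.
have := Fd 0 r0'; rewrite scale0r addr0 => /@derive_val <-.
apply: (@derive_val _ _ _ _ _ _ _ (derive1_at_max (a := - r) (b := r) _ _ r0' _)).
- by rewrite ge0_cp// ltW.
- by move=> t /Fd.
- by move=> t /line Ut; rewrite scale0r addr0; exact: Fmax.
Qed.

Lemma partial0_near_cst U F y : open U -> C1 U F -> U y ->
  (forall z i, U z -> partial i F z = 0) -> \forall z \near y, F z = F y.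
Proof.
move=> oU FC Uy F0.
have /nbhs_ballP[r /= r0 rU] := open_nbhs_nbhs (conj oU Uy).
apply/nbhs_ballP; exists r => // z0; pose z : E := z0; rewrite -[z0]/z -ball_normE /= => yz.
have line (t : R) : t \in `[0, 1] -> U (y + t *: (z - y)).
  rewrite in_itv /= => /andP[t0 t1]; apply: rU; rewrite -ball_normE /= opprD addNKr normrN.
  rewrite normrZ ger0_norm// distrC; apply: le_lt_trans yz.
  by rewrite ler_piMl.
have Fd (t : R) : t \in `[0, 1] -> is_derive t 1 (fun s : R => F (y + s *: (z - y))) 0.
  move=> /line Ut; have dF := C1_differentiable oU FC Ut.
  have := line_derive (@diff_derivable _ _ _ _ _ (z - y) dF).
  rewrite deriveE// diff_partial// /lin_form big1// => i _.
  by rewrite F0 ?mul0r.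
pose f (t : R) := F (y + t *: (z - y)).
have le01 : (0 : R) <= 1 by exact: ler01.
have fd (t : R) : t \in `]0, 1[ -> is_derive t 1 f 0 by move=> /subset_itv_oo_cc /Fd.
have fc : {within `[0, 1], continuous f}.
  apply: continuous_in_subspaceT => t; rewrite inE => /Fd td.
  by apply/differentiable_continuous/derivable1_diffP; exact: ex_derive.
have [t _] := MVT_segment le01 fd fc.
by rewrite /f mul0r scale0r scale1r addr0 subrKC => /eqP; rewrite subr_eq0 => /eqP.
Qed.

(* The second difference of F in the directions i and j is, by the mean value
   theorem, t ^ 2 times a mixed partial derivative in either order. *)
Lemma second_difference U F y i j (t : R) : C1 U F -> C1 U (partial i F) ->
  (forall z, `|z - y| <= `|t| + `|t| -> U z) ->
  exists2 z, `|z - y| <= `|t| + `|t| &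
    F (y + t *: delta_mx 0 i + t *: delta_mx 0 j) - F (y + t *: delta_mx 0 i) -
      F (y + t *: delta_mx 0 j) + F y = t ^+ 2 * partial j (partial i F) z.
Proof.
move=> FC FiC tU; pose ei := (delta_mx 0 i : E); pose ej := (delta_mx 0 j : E).
have near (s s' : R) : `|s| <= `|t| -> `|s'| <= `|t| -> U (y + s *: ei + s' *: ej).
  move=> st st'; apply: tU; rewrite -(addrA y) [X in `|X|]addrC addKr.
  apply: le_trans (ler_normD _ _) _.
  by rewrite lerD// (le_trans (delta_norm_le _ _)).
pose D z := F (z + t *: ej) - F z.
have near0 (s : R) : `|s| <= `|t| -> U (y + s *: ei).
  by move=> st; have := near s 0 st; rewrite normr0 scale0r addr0; apply.
have D1 s : `|s| <= `|t| -> is_derive (y + s *: ei) ei D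
    (partial i F (y + s *: ei + t *: ej) - partial i F (y + s *: ei)).
  move=> st; have [_ d1 _] := FC _ (near s t st (lexx _)).
  have [_ d0 _] := FC _ (near0 s st).
  have d1' := derivable_shift (d1 i).
  have := is_deriveB (derivableP d1') (derivableP (d0 i)).
  by rewrite -/(partial i (fun z => F (z + t *: ej)) _) partial_shift.
have [|s st sE] := @coord_MVT _ _ D y i t; first by move=> s /D1.
have [|s' st' sE'] := @coord_MVT _ _ (partial i F) (y + s *: ei) j t.
  move=> s' st'; have [_ d _] := FiC _ (near s s' st st'); exact: d.
exists (y + s *: ei + s' *: ej).
  rewrite -(addrA y) [X in `|X|]addrC addKr; apply: le_trans (ler_normD _ _) _.
  by rewrite lerD// (le_trans (delta_norm_le _ _)).
have := sE; rewrite /partial (@derive_val _ _ _ _ _ _ _ (D1 s st)) -/(partial _ _ _).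
rewrite sE' mulrA -expr2 => <-; rewrite /D; ring.
Qed.

(** The second difference is symmetric in i and j, so the two mixed derivatives coincide at two
    points z and z' arbitrarily close to y; continuity concludes. *)
Lemma schwarz U F y i j : open U -> C1 U F -> (forall k, C1 U (partial k F)) -> U y ->
  partial j (partial i F) y = partial i (partial j F) y.
Proof.
move=> oU FC FpC Uy.
have [_ _ ci] := FpC i y Uy; have [_ _ cj] := FpC j y Uy.
apply/eqP; rewrite -subr_eq0 -normr_le0; suff H (e : R) : 0 < e ->
    `|partial j (partial i F) y - partial i (partial j F) y| <= e.
  by apply/ler_addgt0Pl => e /H; rewrite addr0.
move=> e0.
have e2 : 0 < e / 2 by rewrite divr_gt0.
pose A i j : set E := [set z | `|partial j (partial i F) y - partial j (partial i F) z| < e / 2].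
have HA : nbhs y (A i j) by move/cvgrPdist_lt : (ci j); apply.
have HB : nbhs y (A j i) by move/cvgrPdist_lt : (cj i); apply.
have HU : nbhs y U by exact: open_nbhs_nbhs.
have : nbhs y (U `&` (A i j `&` A j i)) by do !apply: filterI.
move=> /nbhs_ballP[d /= d0 dP].
(* The intermediate points lie within 2t = d/2 of y. *)
pose t := d / 4.
have t0 : 0 < t by rewrite divr_gt0.
have td z : `|z - y| <= `|t| + `|t| -> ball y d z.
  rewrite -ball_normE /= distrC (gtr0_norm t0) => zt; apply: le_lt_trans zt _; rewrite /t; lra.
have tU z : `|z - y| <= `|t| + `|t| -> U z by move=> /td /dP[Uz _].
have [z /td /dP[_ [zi _]] zE] := second_difference j FC (FpC i) tU.
have [z' /td /dP[_ [_ zj]] zE'] := second_difference i FC (FpC j) tU.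
have t2 : t ^+ 2 != 0 by rewrite expf_neq0 // gt_eqF.
have PQ : partial j (partial i F) z = partial i (partial j F) z'.
  have swap (p q r s : R) : p - q - r + s = p - r - q + s by rewrite (addrAC p).
  move: zE'; rewrite swap (addrAC y) => zE'.
  exact: (mulfI t2 (etrans (esym zE) zE')).
move: zi zj; rewrite /A /= PQ.
move: (partial i (partial j F) z') (partial j _ y) (partial i _ y) => p q r {zE zE' PQ} qp rp.
rewrite -(subrKA p q (- r)); apply: le_trans (ler_normD _ _) _.
by rewrite (distrC p) [leRHS](splitr e) lerD// ltW.
Qed.

End calculus_at_a_point.

(** * Matrices of square zero and isotropic pairs *)

Section square_zero.
Local Open Scope ring_scope.
Context {F : fieldType} {n : nat}.

(** Write A = C R with C of full column rank and R of full row rank. From C (R C) R = 0 follows R C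
    = 0, and the trace of A is that of R C. *)
Lemma trace_square_zero (A : 'M[F]_n) : A *m A = 0 -> \tr A = 0.
Proof.
move=> AA; have := AA; rewrite -{1 2}(mulmx_base A) => CR.
have RC : row_base A *m col_base A = 0.
  apply: (row_free_inj (row_base_free A)); apply: (row_full_inj (col_base_full A)).
  by rewrite mul0mx mulmx0 -[RHS]CR !mulmxA.
by rewrite -(mulmx_base A) mxtrace_mulC RC mxtrace0.
Qed.

Lemma sym_form_eq0 (A : 'M[F]_n) : (2%:R : F) != 0 -> A^T = A ->
  (forall h : 'rV_n, (h *m A *m h^T) 0 0 = 0) -> A = 0.
Proof.
move=> two AT A0; apply/matrixP => i j; rewrite !mxE.
pose e k : 'rV[F]_n := delta_mx 0 k.
have q k l : (e k *m A *m (e l)^T) 0 0 = A k l.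
  by rewrite trmx_delta -rowE -colE !mxE.
have := A0 (e i + e j); rewrite linearD /= !mulmxDl !mulmxDr.
have Aji : A j i = A i j by rewrite -{1}AT mxE.
have dg k : A k k = 0 by rewrite -q A0.
rewrite mxE [X in X + _ = _]mxE [X in _ + X = _]mxE !q !dg Aji add0r addr0.
by rewrite -mulr2n -mulr_natl => /eqP; rewrite mulf_eq0 (negPf two) => /eqP.
Qed.

End square_zero.

Section isotropic_pair.
Local Open Scope ring_scope.
Context {F : fieldType} {n : nat} (two : (2 : F) != 0).
Implicit Types (A B G : 'M[F]_n).

(* The hypotheses say that N := (A + iB) G satisfies N *m N = 0; the block matrix below
   is the realification of N. *)
Lemma null_pair_trace A B G : A *m G *m A = B *m G *m B ->
  A *m G *m B + B *m G *m A = 0 -> \tr (A *m G) = 0.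
Proof.
move=> AB0 AB1; pose N := block_mx (A *m G) (- (B *m G)) (B *m G) (A *m G).
have : \tr N = 0.
  apply: trace_square_zero; rewrite mulmx_block !mulNmx !mulmxN -[RHS]block_mx_const.
  have e0 : A *m G *m (A *m G) - B *m G *m (B *m G) = 0.
    by rewrite !mulmxA AB0 subrr.
  have e1 : A *m G *m (B *m G) + B *m G *m (A *m G) = 0.
    by rewrite !mulmxA -mulmxDl AB1 mul0mx.
  congr block_mx => //; first by rewrite -opprD e1 oppr0.
    by rewrite addrC e1.
  by rewrite addrC e0.
rewrite /N mxtrace_block => /eqP; rewrite -mulr2n -mulr_natl mulf_eq0 (negPf two) /=.
by move/eqP.
Qed.

(** Polarization turns the two identities of quadratic forms into matrix identities: the matrices
    [A G A - B G B] and [A G B + B G A] are symmetric, so vanishing forms make them 0. *)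
Lemma isotropic_pair_trace A B G : A^T = A -> B^T = B -> G^T = G ->
  (forall h : 'rV_n, (h *m A *m G *m (h *m A)^T) 0 0 = (h *m B *m G *m (h *m B)^T) 0 0) ->
  (forall h : 'rV_n, (h *m A *m G *m (h *m B)^T) 0 0 = 0) ->
  \tr (A *m G) = 0 /\ \tr (B *m G) = 0.
Proof.
move=> AT BT GT q0 q1.
have S0 : A *m G *m A = B *m G *m B.
  apply/eqP; rewrite -subr_eq0; apply/eqP; apply: sym_form_eq0 => // [|h].
    by rewrite linearB /= !trmx_mul AT BT GT !mulmxA.
  rewrite mulmxBr mulmxBl mxE [X in _ + X]mxE !mulmxA.
  by have := q0 h; rewrite !trmx_mul AT BT !mulmxA => ->; rewrite subrr.
have S1 : A *m G *m B + B *m G *m A = 0.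
  apply: sym_form_eq0 => // [|h].
    by rewrite linearD /= !trmx_mul AT BT GT !mulmxA addrC.
  rewrite mulmxDr mulmxDl mxE !mulmxA.
  have := q1 h; rewrite trmx_mul BT !mulmxA => q; rewrite q add0r -q.
  rewrite -[in LHS](trmxK (h *m B *m G *m A *m h^T)) mxE.
  by rewrite !trmx_mul trmxK AT BT GT !mulmxA.
split; first exact: null_pair_trace S0 S1.
(* The pair (B, -A) corresponds to -i(A + iB), so the imaginary part of the trace reduces to the
   real one. *)
apply: (null_pair_trace (B := - A)).
  by rewrite mulNmx mulmxN mulNmx opprK S0.
by rewrite mulmxN !mulNmx -opprD addrC S1 oppr0.
Qed.

End isotropic_pair.

(** * Hessians at a common critical point *)

Section second_order.
Local Open Scope classical_set_scope.
Local Open Scope ring_scope.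
Context {R : realType} {n : nat} {M : smoothManifold R n} (g : riemannianMetric M).
Local Notation E := 'rV[R]_n.
Implicit Types (a : chart R n M) (x : M) (y h : E) (u v phi psi : M -> R).

(** The bare matrix of second partials: the trace and limit formulas use it only at critical points,
    where Christoffel terms would vanish. *)
Definition hess a u y : 'M[R]_n := \matrix_(i, j) partial i (partial j (pull a u)) y.

Lemma hess_sym a u y : atlas a -> chart_img a y -> smooth_real u -> (hess a u y)^T = hess a u y.
Proof.
move=> aM ay us; apply/matrixP => i j; rewrite !mxE.
apply: (schwarz i j (open_img aM) _ _ ay); first exact: (smooth_C1 (us a aM)).
by move=> k; apply: smooth_partial_C1; exact: us.
Qed.

Lemma cvg_sum_filter (T I : Type) (F : set_system T) {FF : Filter F} (r : seq I)
    (f : I -> T -> R) (l : I -> R) : (forall i, f i t @[t --> F] --> l i) ->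
  \sum_(i <- r) f i t @[t --> F] --> \sum_(i <- r) l i.
Proof.
move=> fl; elim: r => [|i r IH].
  by rewrite big_nil; under eq_fun do rewrite big_nil; exact: cvg_cst.
by rewrite big_cons; under eq_fun do rewrite big_cons; exact: cvgD.
Qed.

Lemma line_to y h : y + t *: h @[t --> (0 : R)^'] --> y.
Proof.
have C : y + t *: h @[t --> (0 : R)] --> y + 0 *: h.
  by apply: cvgD; [exact: cvg_cst|apply: cvgZr_tmp; exact: cvg_id].
move: C; rewrite scale0r addr0; exact: cvg_within_filter.
Qed.

Lemma dvec_line a u y h i : atlas a -> chart_img a y -> smooth_real u -> dvec a u y = 0 ->
  t^-1 * dvec a u (y + t *: h) 0 i @[t --> (0 : R)^'] --> (h *m hess a u y) 0 i.
Proof.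
move=> aM ay us du0; have oa := open_img aM.
have pC : C1 (chart_img a) (partial i (pull a u)) by apply: smooth_partial_C1; exact: us.
have dF := C1_differentiable oa pC ay.
have -> : (h *m hess a u y) 0 i = 'D_h (partial i (pull a u)) y.
  rewrite deriveE// diff_partial// mxE; apply: eq_bigr => j _.
  by rewrite mxE mulrC.
have d : derivable (partial i (pull a u)) y h by exact: diff_derivable.
have C : t^-1 *: ((partial i (pull a u) \o shift y) (t *: h) - partial i (pull a u) y)
   @[t --> (0 : R)^'] --> 'D_h (partial i (pull a u)) y := d.
move: C; set f := (X in X @ _ --> _ -> _); set k := (X in _ -> X @ _ --> _).
suff -> : f = k by [].
apply/funext => t; rewrite /f /k /= mxE (addrC y).
by have /rowP/(_ i) := du0; rewrite !mxE => ->; rewrite subr0.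
Qed.

(** Along a line through a common critical point each differential is t times the Hessian applied to
    h, up to o(t), so the pairing vanishes to second order with this leading coefficient. *)
Lemma pairing_second_order a u v y h : atlas a -> chart_img a y ->
  smooth_real u -> smooth_real v -> dvec a u y = 0 -> dvec a v y = 0 ->
  t ^- 2 * pairing g a u v (y + t *: h) @[t --> (0 : R)^'] -->
    (h *m hess a u y *m invmx (g a y) *m (h *m hess a v y)^T) 0 0.
Proof.
move=> aM ay us vs du dv.
have -> : (fun t : R => t ^- 2 * pairing g a u v (y + t *: h)) = fun t => \sum_i (\sum_j
   (t^-1 * dvec a u (y + t *: h) 0 j) * invmx (g a (y + t *: h)) j i) *
   (t^-1 * dvec a v (y + t *: h) 0 i).
  apply/funext => t; rewrite /pairing mxE mulr_sumr; apply: eq_bigr => i _.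
  rewrite mxE !mulr_suml mulr_sumr; apply: eq_bigr => j _.
  by rewrite !mxE -exprVn expr2; ring.
rewrite mxE; apply: cvg_sum_filter => i; apply: cvgM.
  rewrite mxE; apply: cvg_sum_filter => j; apply: cvgM; first exact: dvec_line.
  have [c _ _] := invmx_C1 g j i aM ay.
  have L := @line_to y h; exact: (@cvg_comp _ _ _ (fun t : R => y + t *: h)
    (fun y => invmx (g a y) j i) _ _ _ L c).
by rewrite mxE; exact: dvec_line.
Qed.

(** The identities between pairings hold on a whole neighbourhood, so their second order
    coefficients agree along every line; this gives the hypotheses of [isotropic_pair_trace] for the
    Hessians and the inverse metric. *)
Lemma null_hessian_trace a u v y : atlas a -> chart_img a y ->
  smooth_real u -> smooth_real v -> dvec a u y = 0 -> dvec a v y = 0 ->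
  (forall z, chart_img a z -> pairing g a u u z = pairing g a v v z) ->
  (forall z, chart_img a z -> pairing g a u v z = 0) ->
  \tr (hess a u y *m invmx (g a y)) = 0 /\ \tr (hess a v y *m invmx (g a y)) = 0.
Proof.
move=> aM ay us vs du dv uv0 uv1.
set A := hess a u y; set B := hess a v y; set G := invmx (g a y).
have AT : A^T = A by exact: hess_sym.
have BT : B^T = B by exact: hess_sym.
have GT : G^T = G by exact: metric_inv_sym.
have near_img h : \forall t \near (0 : R)^', chart_img a (y + t *: h).
  have L := @line_to y h.
  have N := open_nbhs_nbhs (conj (open_img aM) ay). exact: (L _ N).
have two : (2 : R) != 0 by rewrite pnatr_eq0.
apply: (isotropic_pair_trace two AT BT GT) => h.
  have cu := pairing_second_order (h := h) aM ay us us du du.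
  have cv := pairing_second_order (h := h) aM ay vs vs dv dv.
  apply: (@cvg_unique R (@norm_hausdorff _ R) _ _ _ _ cu); apply: cvg_trans cv; apply: near_eq_cvg.
  by apply: filterS (near_img h) => t at_; rewrite uv0.
have cuv := pairing_second_order (h := h) aM ay us vs du dv.
apply: (@cvg_unique R (@norm_hausdorff _ R) _ _ _ _ cuv).
apply: (@cvg_trans _ (0 @[t --> (0 : R)^'])); last exact: cvg_cst.
apply: near_eq_cvg.
by apply: filterS (near_img h) => t at_; rewrite uv1 ?mulr0.
Qed.

Lemma partial_sum (U : set E) (I : Type) (r : seq I) (F : I -> E -> R) y i :
  open U -> (forall j, C1 U (F j)) -> U y ->
  partial i (fun z => \sum_(j <- r) F j z) y = \sum_(j <- r) partial i (F j) y.
Proof.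
move=> oU FC Uy; elim: r => [|j r IH].
  by rewrite big_nil; under eq_fun do rewrite big_nil; rewrite /partial derive_cst.
rewrite big_cons -IH; under eq_fun do rewrite big_cons.
have := is_deriveD (C1_is_derive i (FC j) Uy) (C1_is_derive i (C1_sum r oU FC) Uy).
by move=> /@derive_val.
Qed.

(** In the expanded divergence, every derivative that falls on the density or on the inverse metric
    is multiplied by a first derivative of u, which is 0. *)
Lemma lap_critical a u y : atlas a -> chart_img a y -> smooth_real u -> dvec a u y = 0 ->
  lap g a u y = \tr (hess a u y *m invmx (g a y)).
Proof.
move=> aM ay us du; have oa := open_img aM; have v0 := vol_gt0 g aM ay.
have pu0 j : partial j (pull a u) y = 0 by have /rowP/(_ j) := du; rewrite !mxE.
have pC j : C1 (chart_img a) (partial j (pull a u)) by apply: smooth_partial_C1; exact: us.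
have GC i j := invmx_C1 g i j aM.
have tC i j : C1 (chart_img a) (fun z => invmx (g a z) i j * partial j (pull a u) z).
  exact: C1M.
rewrite /lap; apply: (mulfI (lt0r_neq0 v0)); rewrite mulrA mulfV ?lt0r_neq0// mul1r.
rewrite /mxtrace mulr_sumr; apply: eq_bigr => i _.
rewrite (partialM i (vol_C1 g aM) (C1_sum _ oa (tC i)) ay).
rewrite [X in _ + X * _ = _]big1 ?mul0r ?addr0; last first.
  by move=> j _; rewrite pu0 mulr0.
congr (_ * _); rewrite (partial_sum _ _ oa (tC i) ay) mxE; apply: eq_bigr => j _.
rewrite (partialM i (GC i j) (pC j) ay) pu0 mul0r addr0 mxE mulrC.
by have /matrixP/(_ j i) := metric_inv_sym g aM ay; rewrite !mxE => ->.
Qed.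

End second_order.

(** * Eigenfunctions *)

Section real_eigenfunctions.
Local Open Scope classical_set_scope.
Local Open Scope ring_scope.
Context {R : realType} {n : nat} {M : smoothManifold R n} (g : riemannianMetric M).
Local Notation E := 'rV[R]_n.
Implicit Types (a : chart R n M) (x : M) (y h : E) (phi psi : M -> R).

Lemma form_lincomb (G : 'M[R]_n) (s t : R) (d e f : E) :
  ((s *: d + t *: e) *m G *m f^T) 0 0 = s * (d *m G *m f^T) 0 0 + t * (e *m G *m f^T) 0 0.
Proof. by rewrite !mulmxDl -!scalemxAl mxE [X in X + _]mxE [X in _ + X]mxE. Qed.

Lemma form_sym (G : 'M[R]_n) (d e : E) : G^T = G ->
  (d *m G *m e^T) 0 0 = (e *m G *m d^T) 0 0.
Proof. by move=> GT; rewrite -[in LHS](trmxK (d *m G *m e^T)) mxE !trmx_mul trmxK GT mulmxA. Qed.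

(** Raising the index of d gives a nonzero vector whose g-length squared is this number. *)
Lemma inv_metric_gt0 a y (d : E) : atlas a -> chart_img a y -> d != 0 ->
  0 < (d *m invmx (g a y) *m d^T) 0 0.
Proof.
move=> aM ay d0; have gU := metric_unit g aM ay.
have w0 : d *m invmx (g a y) != 0.
  apply: contraNneq d0 => w0; apply/eqP.
  by rewrite -(mulmxKV gU d) w0 mul0mx.
have := metric_posdef g aM ay w0.
by rewrite trmx_mul (metric_inv_sym g aM ay) mulmxKV// mulmxA.
Qed.

Lemma inv_metric_ge0 a y (d : E) : atlas a -> chart_img a y ->
  0 <= (d *m invmx (g a y) *m d^T) 0 0.
Proof.
move=> aM ay; have [->|d0] := eqVneq d 0; first by rewrite mul0mx mul0mx mxE.
exact/ltW/inv_metric_gt0.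
Qed.

Lemma pairing_eq0 a phi y : atlas a -> chart_img a y -> pairing g a phi phi y = 0 ->
  dvec a phi y = 0.
Proof.
move=> aM ay p0; apply/eqP; apply: contraPT p0 => /(inv_metric_gt0 aM ay).
by rewrite -/(pairing g a phi phi y) => /lt0r_neq0/eqP.
Qed.

Lemma grad_dotC phi psi x : grad_dot g phi psi x = grad_dot g psi phi x.
Proof.
by apply: form_sym; apply: metric_inv_sym; [exact: chart_at_atlas|exact/coord_img/chart_at_dom].
Qed.

(** The squared length of [s dphi + t dpsi]. For (phi, psi) = (u, v), the coefficients (u, v) give
    |p|^2, (-v, u) give |q|^2, and (1, 0), (0, 1) the two summands of the energy. *)
Lemma grad_dot_quadratic phi psi (s t : R) x :
  0 <= s ^+ 2 * grad_dot g phi phi x + s * t * grad_dot g phi psi x *+ 2 +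
    t ^+ 2 * grad_dot g psi psi x.
Proof.
have := grad_dotC psi phi x; have := chart_at_dom x; have := chart_at_atlas x.
rewrite /grad_dot /pairing; move: (chart_at x) => a aM /coord_img.
move: (coord a x) => y ay sym.
have := inv_metric_ge0 (s *: dvec a phi y + t *: dvec a psi y) aM ay.
have GT := metric_inv_sym g aM ay.
rewrite form_lincomb !(form_sym _ (_ + _) GT) !form_lincomb sym.
move: (_ 0 0) (_ 0 0) (_ 0 0) => A B C H; apply: le_trans H _.
by rewrite le_eqVlt; apply/orP; left; apply/eqP; ring.
Qed.

Lemma dvecD a phi psi y : atlas a -> chart_img a y -> C1_fun phi -> C1_fun psi ->
  dvec a (fun x => phi x + psi x) y = dvec a phi y + dvec a psi y.
Proof.
move=> aM ay pC qC; apply/rowP => i; rewrite !mxE.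
have := is_deriveD (C1_is_derive i (pC a aM) ay) (C1_is_derive i (qC a aM) ay).
by move=> /@derive_val.
Qed.

Lemma dvec0_near_cst phi x : C1_fun phi ->
  (forall y, chart_img (chart_at x) y -> dvec (chart_at x) phi y = 0) ->
  \forall z \near x, phi z = phi x.
Proof.
set a := chart_at x => pC d0; have aM : atlas a := chart_at_atlas x.
have ax : chart_dom a x := chart_at_dom x; have ay := coord_img ax.
have p0 z i : chart_img a z -> partial i (pull a phi) z = 0.
  by move=> /d0 /rowP/(_ i); rewrite !mxE.
have near_y := partial0_near_cst (open_img aM) (pC a aM) ay p0.
have near_x : \forall z \near x, pull a phi (coord a z) = pull a phi (coord a x).
  exact: (coord_continuous_at aM ax near_y).
have near_a : nbhs x (chart_dom a) by apply: open_nbhs_nbhs; split => //; exact: open_dom.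
apply: filterS2 near_x near_a => z; rewrite /pull /= => + az.
by rewrite !coordK.
Qed.

Variables (u v : M -> R) (l1 l2 m1 m2 : R).
Hypotheses (cM : closed_manifold M) (us : smooth_real u) (vs : smooth_real v).
Hypothesis lapu : forall a, atlas a -> forall y, chart_img a y ->
  lap g a u y = l1 * u (param a y) - l2 * v (param a y).
Hypothesis lapv : forall a, atlas a -> forall y, chart_img a y ->
  lap g a v y = l2 * u (param a y) + l1 * v (param a y).
Hypothesis kappa_re : forall x, grad_dot g u u x - grad_dot g v v x =
  m1 * (u x ^+ 2 - v x ^+ 2) - m2 * (u x * v x *+ 2).
Hypothesis kappa_im : forall x, grad_dot g u v x *+ 2 =
  m2 * (u x ^+ 2 - v x ^+ 2) + m1 * (u x * v x *+ 2).
Hypothesis not_cst : ~ (locally_constant u /\ locally_constant v).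

Let uC : C1_fun u := smooth_real_C1 us.
Let vC : C1_fun v := smooth_real_C1 vs.

Let w x := u x * u x + v x * v x.
Let energy x := grad_dot g u u x + grad_dot g v v x.

Let w_ge0 x : 0 <= w x.
Proof. by rewrite addr_ge0// -expr2 sqr_ge0. Qed.

Let energy_ge0 x : 0 <= energy x.
Proof.
have := grad_dot_quadratic u v 1 0 x; have := grad_dot_quadratic u v 0 1 x.
by rewrite expr1n expr0n /= !(mul0r, mul1r, mulr0, mul0rn, addr0, add0r) => *; exact: addr_ge0.
Qed.

Let wC : C1_fun w.
Proof. by apply: C1_funD; apply: C1_funM. Qed.

Let energy_cont : continuous energy.
Proof.
move=> x; apply: (@continuousD _ _ _ (grad_dot g u u)); exact: grad_dot_continuous.
Qed.

Let u_cont := C1_fun_continuous uC.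
Let v_cont := C1_fun_continuous vC.
Let w_cont := C1_fun_continuous wC.

(* With p = u du + v dv and q = u dv - v du one has w * energy = |p|^2 + |q|^2, while
   kappa gives |p|^2 - |q|^2 = m1 w^2 and <p, q> = m2 w^2 / 2. *)
Let w_energy x : 0 <= w x * energy x + m1 * w x ^+ 2.
Proof.
have := grad_dot_quadratic u v (u x) (v x) x; have := kappa_re x; have := kappa_im x.
rewrite /w /energy; move: (grad_dot g u u x) (grad_dot g v v x) (grad_dot g u v x) (u x) (v x).
move=> U V W r s H1 H2 H.
rewrite (_ : _ + _ = 2 * (r ^+ 2 * U + r * s * W *+ 2 + s ^+ 2 * V)); first by rewrite mulr_ge0.
have e1 : U = V + (m1 * (r ^+ 2 - s ^+ 2) - m2 * (r * s *+ 2)) by rewrite -H2; ring.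
have e2 : W = 2^-1 * (m2 * (r ^+ 2 - s ^+ 2) + m1 * (r * s *+ 2)) by rewrite -H1; field.
by rewrite e1 e2; field.
Qed.

(** Where w is positive it is divided out of [w_energy]; where w is 0 only nonnegativity of the
    energy remains to be used. *)
Let energy_lower x : 0 <= energy x + m1 * w x.
Proof.
have := w_ge0 x; rewrite le_eqVlt => /predU1P[w0|w0].
  by rewrite -w0 mulr0 addr0.
have := w_energy x; rewrite (_ : _ + _ = w x * (energy x + m1 * w x)); last by ring.
by rewrite pmulr_rge0.
Qed.

Let nonzero : exists x, 0 < w x.
Proof.
apply: contrapT => H; apply: not_cst.
have w0 x : w x = 0.
  by apply/eqP; rewrite eq_le w_ge0 andbT leNgt; apply/negP => wx; apply: H; exists x.
have uv0 x : u x = 0 /\ v x = 0.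
  have /eqP := w0 x; rewrite /w paddr_eq0 -?expr2 ?sqr_ge0// !sqrf_eq0.
  by move=> /andP[/eqP -> /eqP ->].
split=> x; near=> z; first by rewrite !(uv0 _).1.
by rewrite !(uv0 _).2.
Unshelve. all: by end_near. Qed.

Let max_point : exists2 x, 0 < w x &
  u x *: dvec (chart_at x) u (coord (chart_at x) x) +
  v x *: dvec (chart_at x) v (coord (chart_at x) x) = 0.
Proof.
have [z wz] := nonzero.
have [||x _ xmax] := @compact_EVT_max M R w [set: M] _ cM; first by exists z.
  by apply: continuous_subspaceT; exact: w_cont.
have wmax t : w t <= w x by apply: xmax; rewrite inE.
exists x; first exact: lt_le_trans wz (wmax z).
set a := chart_at x; have aM : atlas a := chart_at_atlas x.
have ax : chart_dom a x := chart_at_dom x; have ay := coord_img ax.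
have : dvec a w (coord a x) = 0.
  apply/rowP => i; rewrite !mxE; apply: (C1_partial_max i (open_img aM) (wC aM) ay).
  by move=> y _; rewrite /pull coordK.
rewrite (dvecD aM ay (C1_funM uC uC) (C1_funM vC vC)).
rewrite (dvecM aM ay uC uC) (dvecM aM ay vC vC) coordK// -!mulr2n -mulrnDl -scaler_nat.
by move/eqP; rewrite scaler_eq0 pnatr_eq0 /= => /eqP.
Qed.

Let first_order x : u x *: dvec (chart_at x) u (coord (chart_at x) x) +
  v x *: dvec (chart_at x) v (coord (chart_at x) x) = 0 ->
  forall psi, u x * grad_dot g u psi x + v x * grad_dot g v psi x = 0.
Proof.
move=> d0 psi; rewrite /grad_dot /pairing -form_lincomb d0.
by rewrite !mul0mx mxE.
Qed.

Let mu_first_order : m2 = 0 /\ m1 <= 0.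
Proof.
have [x wx /first_order d0] := max_point.
have := d0 u; have := d0 v; rewrite (grad_dotC v u).
have := kappa_re x; have := kappa_im x.
have := grad_dot_quadratic u v (- v x) (u x) x.
move: wx; rewrite /w.
move: (grad_dot g u u x) (grad_dot g v v x) (grad_dot g u v x) (u x) (v x).
move=> U V W r s w0 H H1 H2 e1 e2.
have w2 : 0 < (r * r + s * s) ^+ 2 by rewrite exprn_gt0.
(* [p0] and [pq0] say that |p|^2 and the inner product of p and q vanish at the maximum. *)
have p0 : r * (r * U + s * W) + s * (r * W + s * V) = 0 by rewrite e1 e2 !mulr0 addr0.
have pq0 : r * (r * W + s * V) - s * (r * U + s * W) = 0 by rewrite e1 e2 !mulr0 subr0.
split.
  apply: (mulIf (lt0r_neq0 w2)); rewrite mul0r.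
  (* Imaginary part of [mu w^2 = conj(f)^2 kappa(f, f)]; the same device with the real part treats
     m1 below. *)
  rewrite (_ : m2 * _ = (r ^+ 2 - s ^+ 2) * (m2 * (r ^+ 2 - s ^+ 2) + m1 * (r * s *+ 2)) -
    (r * s *+ 2) * (m1 * (r ^+ 2 - s ^+ 2) - m2 * (r * s *+ 2))); last by ring.
  rewrite -H1 -H2 -[RHS](mulr0 2) -pq0; ring.
rewrite -(pmulr_lle0 _ w2).
rewrite (_ : m1 * _ = (r ^+ 2 - s ^+ 2) * (m1 * (r ^+ 2 - s ^+ 2) - m2 * (r * s *+ 2)) +
    (r * s *+ 2) * (m2 * (r ^+ 2 - s ^+ 2) + m1 * (r * s *+ 2))); last by ring.
rewrite -H1 -H2 -oppr_ge0; apply: le_trans H _.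
rewrite [leRHS](_ : _ = ((- s) ^+ 2 * U + - s * r * W *+ 2 + r ^+ 2 * V) -
  (r * (r * U + s * W) + s * (r * W + s * V))); last by ring.
by rewrite p0 subr0.
Qed.

(** The last conjunct serves the exclusion of mu = 0: a nonnegative continuous function of integral
    0 vanishes. *)
Let lambda_le_mu : l2 = 0 /\ l1 <= m1 /\ (l1 = 0 -> forall x, energy x = 0).
Proof.
have [L hL] := @haar_exists R n.
have [I [ID IZ I0 Ipos Igreen]] := green_functional g hL cM.
have mul_cont phi psi : continuous phi -> continuous psi -> continuous (fun x => phi x * psi x).
  by move=> pc qc x; apply: continuousM; [exact: pc|exact: qc].
have add_cont phi psi : continuous phi -> continuous psi -> continuous (fun x => phi x + psi x).
  by move=> pc qc x; apply: continuousD; [exact: pc|exact: qc].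
have scal_cont (t : R) phi : continuous phi -> continuous (fun x => t * phi x).
  by move=> pc; apply: mul_cont => // x; exact: cst_continuous.
pose lu x := l1 * u x - l2 * v x; pose lv x := l2 * u x + l1 * v x.
have luc : continuous lu.
  rewrite (_ : lu = fun x => l1 * u x + (- l2) * v x); last by apply/funext => x; rewrite mulNr.
  by apply: add_cont; exact: scal_cont.
have lvc : continuous lv by apply: add_cont; exact: scal_cont.
have [x wx] := nonzero.
have Iw : 0 < I w by exact: Ipos wx.
have gc phi psi : C1_fun phi -> C1_fun psi -> continuous (grad_dot g phi psi).
  by move=> pC qC; exact: grad_dot_continuous.
have term_cont phi (l h : M -> R) : continuous phi -> continuous l -> C1_fun phi -> C1_fun h ->
    continuous (fun x => phi x * l x + grad_dot g phi h x).
  by move=> pc lc pC hC; apply: add_cont; [exact: mul_cont|exact: gc].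
have guu := Igreen u u lu uC us luc lapu.
have guv := Igreen u v lv uC vs lvc lapv.
have gvu := Igreen v u lu vC us luc lapu.
have gvv := Igreen v v lv vC vs lvc lapv.
have E1 : l1 * I w + I energy = 0.
  rewrite -IZ// -ID//; last exact: scal_cont.
  rewrite -[RHS]addr0 -{1}guu -gvv -ID; try exact: term_cont.
  by congr I; apply/funext => z; rewrite /lu /lv /w /energy; ring.
(* Subtracting the formulas for (u, v) and (v, u) cancels the symmetric gradient term, and the
   remaining integrand [u lv - v lu] is [l2 w]. *)
have E2 : l2 * I w = 0.
  rewrite -IZ//; have <- : I (fun x => u x * lv x + grad_dot g u v x) +
      -1 * I (fun x => v x * lu x + grad_dot g v u x) = 0 by rewrite guv gvu mulr0 addr0.
  rewrite -IZ; last exact: term_cont.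
  rewrite -ID; last 2 first.
  - exact: term_cont.
  - by apply: scal_cont; exact: term_cont.
  by congr I; apply/funext => z; rewrite (grad_dotC v u) /lu /lv /w; ring.
split.
  by move/eqP: E2; rewrite mulf_eq0 (gt_eqF Iw) orbF => /eqP.
split.
  have : 0 <= I (fun x => energy x + m1 * w x).
    by apply: I0 energy_lower; apply: add_cont => //; exact: scal_cont.
  rewrite ID//; last exact: scal_cont.
  rewrite IZ// => H; rewrite -(ler_pM2r Iw).
  rewrite -subr_ge0; apply: le_trans H _.
  by move: E1 => /eqP; rewrite addrC addr_eq0 => /eqP ->; rewrite addrC.
move=> l10 z; apply/eqP; rewrite eq_le energy_ge0 andbT leNgt; apply/negP => ez.
have := Ipos energy z energy_cont energy_ge0 ez.
by move: E1; rewrite l10 mul0r add0r => ->; rewrite ltxx.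
Qed.

Let m1_neq0 : m1 != 0.
Proof.
apply/eqP => m10; have [m20 _] := mu_first_order.
have [l20 [_ flat]] := lambda_le_mu.
have energy0 x : energy x = 0 -> grad_dot g u u x = 0 /\ grad_dot g v v x = 0.
  move=> e0; have := grad_dot_quadratic u v 1 0 x; have := grad_dot_quadratic u v 0 1 x.
  rewrite expr1n expr0n /= !(mul0r, mul1r, mulr0, mul0rn, addr0, add0r) => V0 U0.
  by move/eqP: e0; rewrite paddr_eq0// => /andP[/eqP -> /eqP ->].
have l10 : l1 = 0.
  have [x wx d0] := max_point.
  set a := chart_at x in d0; have aM : atlas a := chart_at_atlas x.
  have ax : chart_dom a x := chart_at_dom x; have ay := coord_img ax.
  (* For mu = 0 the differentials of u and v are orthogonal of equal length. Pairing
     [u du + v dv = 0] with du and with dv gives u |du|^2 = 0 and v |du|^2 = 0, while u and v are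
     not both 0 at x. *)
  have ex : energy x = 0.
    have fo := first_order d0.
    have := kappa_re x; rewrite m10 m20 !mul0r subr0 => /eqP; rewrite subr_eq0 => /eqP UV.
    have := kappa_im x; rewrite m10 m20 !mul0r addr0 => /eqP.
    rewrite mulrn_eq0 /= => /eqP W0.
    have := fo u; rewrite (grad_dotC v u) W0 mulr0 addr0 => uU.
    have := fo v; rewrite W0 mulr0 add0r -UV => vU.
    apply: (mulfI (lt0r_neq0 wx)); rewrite mulr0 /w /energy -UV mulrDr !mulrDl -!mulrA uU vU.
    by rewrite !mulr0 !addr0.
  have [U0 V0] := energy0 x ex.
  have du := pairing_eq0 aM ay U0; have dv := pairing_eq0 aM ay V0.
  have uv0 z : chart_img a z -> pairing g a u u z = pairing g a v v z.
    move=> az; rewrite -!(grad_dotE g aM az)//; apply/eqP; rewrite -subr_eq0.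
    by rewrite kappa_re m10 m20 !mul0r subr0.
  have uv1 z : chart_img a z -> pairing g a u v z = 0.
    move=> az; rewrite -(grad_dotE g aM az)//.
    have := kappa_im (param a z); rewrite m10 m20 !mul0r addr0 => /eqP.
    by rewrite mulrn_eq0 /= => /eqP.
  have [tu tv] := null_hessian_trace aM ay us vs du dv uv0 uv1.
  have lu := etrans (esym (etrans (lap_critical g aM ay us du) tu)) (lapu aM ay).
  have lv := etrans (esym (etrans (lap_critical g aM ay vs dv) tv)) (lapv aM ay).
  move: lu lv; rewrite (coordK aM ax : param a (coord a x) = x) l20 !mul0r add0r subr0 => lu lv.
  apply: contraTeq wx => l10; rewrite -leNgt /w.
  have -> : u x = 0 by move/esym/eqP: lu; rewrite mulf_eq0 (negPf l10) => /eqP.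
  have -> : v x = 0 by move/esym/eqP: lv; rewrite mulf_eq0 (negPf l10) => /eqP.
  by rewrite mulr0 addr0.
apply: not_cst.
have d0 x y : chart_img (chart_at x) y ->
    dvec (chart_at x) u y = 0 /\ dvec (chart_at x) v y = 0.
  move=> ay; have aM := chart_at_atlas x.
  have [U0 V0] := energy0 _ (flat l10 (param (chart_at x) y)).
  by split; apply: (pairing_eq0 aM ay); rewrite -(grad_dotE g aM ay).
by split=> x; apply: dvec0_near_cst => // y /d0[].
Qed.

Lemma real_eigenfunction : [/\ l2 = 0, m2 = 0, l1 <= m1 & m1 < 0].
Proof.
have [m20 m1le] := mu_first_order; have [l20 [le _]] := lambda_le_mu.
by split=> //; rewrite lt_neqAle m1_neq0.
Qed.

End real_eigenfunctions.

(** * From complex eigenfunctions to real and imaginary parts *)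

Section complex_eigenfunctions.
Local Open Scope classical_set_scope.
Local Open Scope ring_scope.
Local Open Scope complex_scope.
Context {R : realType} {n : nat} {M : smoothManifold R n} (g : riemannianMetric M).
Implicit Types (a : chart R n M) (x : M) (y : 'rV[R]_n) (f : M -> R[i]) (phi psi : M -> R).

Lemma sum_complex (I : Type) (r : seq I) (F G : I -> R) :
  \sum_(i <- r) (F i +i* G i) = (\sum_(i <- r) F i) +i* (\sum_(i <- r) G i).
Proof. by elim/big_rec3: _ => // i s t z _ ->. Qed.

Lemma real_mul_complex (t p q : R) : t%:C * (p +i* q) = (t * p) +i* (t * q).
Proof. by congr Complex; rewrite /= mul0r ?subr0 ?addr0. Qed.

Definition re_part f x : R := complex.Re (f x).
Definition im_part f x : R := complex.Im (f x).

Lemma grad_complex a f y i :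
  grad g a f y i = rgrad g a (re_part f) y i +i* rgrad g a (im_part f) y i.
Proof.
rewrite /grad /rgrad -sum_complex; apply: eq_bigr => j _.
exact: real_mul_complex.
Qed.

Lemma laplacian_complex a f x : laplacian_in g a f x =
  lap g a (re_part f) (coord a x) +i* lap g a (im_part f) (coord a x).
Proof.
rewrite /laplacian_in /divergence /lap -real_mul_complex; congr (_ * _).
rewrite -sum_complex; apply: eq_bigr => i _; rewrite /cpartial.
have E z : (Num.sqrt (\det (g a z)))%:C * grad g a f z i =
    (vol g a z * rgrad g a (re_part f) z i) +i* (vol g a z * rgrad g a (im_part f) z i).
  by rewrite grad_complex real_mul_complex.
by congr (partial i _ _ +i* partial i _ _); apply/funext => z; rewrite E.
Qed.

(** Each gradient raises an index by the inverse metric; the metric cancels one of the two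
    inverses. *)
Lemma metric_rgrad a phi psi y : atlas a -> chart_img a y ->
  \sum_i \sum_j g a y i j * rgrad g a phi y i * rgrad g a psi y j = pairing g a phi psi y.
Proof.
move=> aM ay; pose r h : 'rV[R]_n := dvec a h y *m invmx (g a y).
have rE h i : rgrad g a h y i = r h 0 i.
  rewrite mxE; apply: eq_bigr => j _; rewrite mxE mulrC.
  by have /matrixP/(_ j i) := metric_inv_sym g aM ay; rewrite mxE => ->.
transitivity ((r phi *m g a y *m (r psi)^T) 0 0).
  under eq_bigr do under eq_bigr do rewrite !rE.
  move: (r phi) (r psi) => p q.
  rewrite mxE exchange_big; apply: eq_bigr => j _ /=; rewrite !mxE mulr_suml.
  by apply: eq_bigr => i _; ring.
rewrite /r /pairing trmx_mul (metric_inv_sym g aM ay) mulmxKV ?metric_unit//.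
by rewrite mulmxA.
Qed.

Lemma kappa_complex a f x : atlas a -> chart_dom a x -> kappa_in g a f f x =
  (pairing g a (re_part f) (re_part f) (coord a x) -
     pairing g a (im_part f) (im_part f) (coord a x)) +i*
  (pairing g a (re_part f) (im_part f) (coord a x) *+ 2).
Proof.
move=> aM ax; have ay := coord_img ax; rewrite /kappa_in /cmetric.
move: (coord a x) ay => y ay.
set p := rgrad g a (re_part f) y; set q := rgrad g a (im_part f) y.
have E i j : (g a y i j)%:C * grad g a f y i * grad g a f y j =
    (g a y i j * p i * p j - g a y i j * q i * q j) +i*
    (g a y i j * p i * q j + g a y i j * q i * p j).
  rewrite !grad_complex -/p -/q real_mul_complex.
  by congr Complex => /=; ring.
under eq_bigr do under eq_bigr do rewrite E.
under eq_bigr do rewrite sum_complex sumrB big_split /=.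
rewrite sum_complex sumrB big_split /= !(metric_rgrad _ _ aM ay).
congr Complex; rewrite mulr2n; congr (_ + _).
by apply: form_sym; exact: metric_inv_sym.
Qed.

End complex_eigenfunctions.

Local Open Scope ring_scope.

(** Constants satisfy both equations with lambda = mu = 0, and the zero function satisfies them for
    all lambda and mu, so such functions are excluded. As M may be disconnected, the exclusion
    concerns locally constant functions. *)
Theorem theorem1 (R : realType) (n : nat) (M : smoothManifold R n)
  (g : riemannianMetric M) (f : M -> R[i]%C) (lambda mu : R[i]%C)
  (M_closed : closed_manifold M)
  (f_eigen : eigenfunction g lambda mu f)
  (f_not_locally_constant : ~ locally_constant f) :
  lambda <= mu /\ mu < 0.
Proof.
have [fs lapf kappaf] := f_eigen.
set u := re_part f; set v := im_part f.
have us : smooth_real u by move=> a aM; exact: (fs a aM).1.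
have vs : smooth_real v by move=> a aM; exact: (fs a aM).2.
have uC := smooth_real_C1 us; have vC := smooth_real_C1 vs.
pose l1 := complex.Re lambda; pose l2 := complex.Im lambda.
pose m1 := complex.Re mu; pose m2 := complex.Im mu.
have lap_uv a y : atlas a -> chart_img a y ->
    lap g a u y = l1 * u (param a y) - l2 * v (param a y) /\
    lap g a v y = l2 * u (param a y) + l1 * v (param a y).
  move=> aM ay; have := lapf a aM (param a y) (param_dom aM ay).
  rewrite laplacian_complex (paramK aM ay) /l1 /l2 /u /v /re_part /im_part.
  by move: (lambda) (f (param a y)) => [r s] [p q] [-> ->]; split => //; rewrite addrC.
have kap x : grad_dot g u u x - grad_dot g v v x =
      m1 * (u x ^+ 2 - v x ^+ 2) - m2 * (u x * v x *+ 2) /\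
    grad_dot g u v x *+ 2 = m2 * (u x ^+ 2 - v x ^+ 2) + m1 * (u x * v x *+ 2).
  have := kappaf _ (chart_at_atlas x) x (chart_at_dom x).
  rewrite (kappa_complex g f (chart_at_atlas x) (chart_at_dom x)).
  rewrite -/u -/v -!/(grad_dot g _ _ x) /m1 /m2.
  move: (grad_dot g u u x) (grad_dot g v v x) (grad_dot g u v x) => U V W.
  rewrite /u /v /re_part /im_part.
  by move: (mu) (f x) => [r s] [p q] [-> ->]; split; rewrite /=; ring.
have not_cst : ~ (locally_constant u /\ locally_constant v).
  move=> [uc vc]; apply: f_not_locally_constant => x.
  apply: filterS2 (uc x) (vc x) => z; rewrite /u /v /re_part /im_part.
  by case: (f z) (f x) => [p q] [r s] /= -> ->.
have [l20 m20 le lt] := real_eigenfunction M_closed us vs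
  (fun a aM y ay => (lap_uv a y aM ay).1) (fun a aM y ay => (lap_uv a y aM ay).2)
  (fun x => (kap x).1) (fun x => (kap x).2) not_cst.
(* The order on complex numbers compares only numbers with equal imaginary parts, so [l2 = 0] and
   [m2 = 0], the reality of lambda and mu, are part of the conclusion. *)
rewrite lecE ltcE /= -/l1 -/l2 -/m1 -/m2 l20 m20 !eqxx /=; by split.
Qed.
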